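(* Let $p\ge q\ge1$ be integers. Let $A_0(z),A_1(z),\dots,A_k(z)$ be entire functions and suppose there exists an integer $l$ $(0\le l\le k)$ such that $$\max\{\rho_{A_j}(p,q): j=0,1,\dots,k,\ j\ne l\}\le\rho_{A_l}(p,q),$$ $$\max\{\tau_{A_j}(p,q): \rho_{A_j}(p,q)=\rho_{A_l}(p,q),\ j\neq l\}<\tau_{A_l}(p,q),$$ where $0<\rho_{A_l}(p,q)<\infty$ and $0<\tau_{A_l}(p,q)<\infty$. Let $F$ be an entire function, and consider the equation $$A_k(z)f(z+c_k)+A_{k-1}(z)f(z+c_{k-1})+\cdots+A_1(z)f(z+c_1)+A_0(z)f(z)=F(z).\qquad( * )$$ Then the following hold. (i) If $\rho_F(p,q)<\rho_{A_l}(p,q)$, or $\rho_F(p,q)=\rho_{A_l}(p,q)$ and $\tau_F(p,q)<\tau_{A_l}(p,q)$, then every meromorphic solution $f\not\equiv0$ of $( * )$ satisfies $\rho_f(p,q)\ge\rho_{A_l}(p,q)$. (ii) If $\rho_F(p,q)>\rho_{A_l}(p,q)$, then every meromorphic solution $f\not\equiv0$ of $( * )$ satisfies $\rho_f(p,q)\ge\rho_F(p,q)$.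
   Context: Meromorphic means meromorphic in $\mathbb{C}$; $T(r,f)$ is the Nevanlinna characteristic and $M(r,f)$ the maximum modulus. Iterated logarithms: $\log_0 r=r$, $\log_1 r=\log r$, $\log_{n+1}r=\log(\log_n r)$ for large $r$. The $(p,q)$-order of a transcendental meromorphic function $f$ is $\rho_f(p,q)=\limsup_{r\to\infty}\frac{\log_p T(r,f)}{\log_q r}$; if $f$ is transcendental entire, $\rho_f(p,q)=\limsup_{r\to\infty}\frac{\log_{p+1}M(r,f)}{\log_q r}$. For a rational function $\rho_f(p,q)=0$. The $(p,q)$-type of a meromorphic function $f$ with nonzero finite $(p,q)$-order is $\tau_f(p,q)=\limsup_{r\to\infty}\frac{\log_{p-1}T(r,f)}{(\log_{q-1}r)^{\rho_f(p,q)}}$; if $f$ is transcendental entire, $\tau_f(p,q)=\limsup_{r\to\infty}\frac{\log_p M(r,f)}{(\log_{q-1}r)^{\rho_f(p,q)}}$. A condition on the maximum over an empty set is regarded as vacuous. Standing assumptions on the equation: $k\ge2$, the functions $A_0,\dots,A_k$ and $F$ are not identically zero, and $c_1,\dots,c_k$ are distinct nonzero complex numbers. *)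

(* Defs.v *)
From HB Require Import structures.
From mathcomp Require Import all_boot all_order all_algebra.
From mathcomp Require Import complex.
From mathcomp Require Import all_classical all_reals all_analysis.

Set Implicit Arguments.
Unset Strict Implicit.
Unset Printing Implicit Defensive.

Import Order.TTheory GRing.Theory Num.Theory.
Import numFieldNormedType.Exports.

Local Open Scope classical_set_scope.
Local Open Scope ring_scope.

Local Notation normc := ComplexField.Normc.normc.

(* The topology and the normed-module structure over itself of R[i] are carried
   by its alias R[i]^o, so that derivability in the direction 1 : R[i]^o is
   complex differentiability. *)
Definition cdifferentiable (R : realType) (f : R[i] -> R[i]) (z : R[i]) : Prop :=
  derivable (f : R[i]^o -> R[i]^o) (z : R[i]^o) 1.

Definition entire (R : realType) (f : R[i] -> R[i]) : Prop :=
  forall z, cdifferentiable f z.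

Definition pole_of_order (R : realType) (f : R[i] -> R[i]) (z : R[i]) (m : nat)
    : Prop :=
  (0 < m)%N /\
  exists2 a : R[i], a != 0 &
    ((w - z) ^+ m * f w : R[i]^o) @[w --> (z : R[i]^o)^'] --> (a : R[i]^o).

Definition pole (R : realType) (f : R[i] -> R[i]) (z : R[i]) : Prop :=
  exists m, pole_of_order f z m.

(* A meromorphic function is represented by a total function whose values at
   its poles are irrelevant; away from the poles it is holomorphic, so there
   are no removable singularities. *)
Definition meromorphic (R : realType) (f : R[i] -> R[i]) : Prop :=
  forall z, (\forall w \near (z : R[i]^o), cdifferentiable f w) \/
    ((\forall w \near (z : R[i]^o)^', cdifferentiable f w) /\ pole f z).

Definition rational (R : realType) (f : R[i] -> R[i]) : Prop :=
  exists P Q : {poly R[i]},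
    Q != 0 /\ forall z, Q.[z] != 0 -> f z = P.[z] / Q.[z].

(* 0 if z is not a pole. *)
Definition pole_mult (R : realType) (f : R[i] -> R[i]) (z : R[i]) : nat :=
  xget 0%N (pole_of_order f z).

(* n(t, f): a meromorphic function has finitely many poles in a disc, so the
   sum has finite support. *)
Definition pole_count (R : realType) (t : R) (f : R[i] -> R[i]) : nat :=
  (\sum_(z \in [set z : R[i] | (normc z <= t)%R]) pole_mult f z)%N.

(* m(r, f); [ln x = 0] for [x <= 0], so [Num.max (ln x) 0] is log^+ x for all
   x >= 0. *)
Definition proximity (R : realType) (r : R) (f : R[i] -> R[i]) : R :=
  (2 * pi)^-1 * \int[@lebesgue_measure R]_(t in `[0, 2 * pi])
    Num.max (ln (normc (f (Complex (r * cos t) (r * sin t))))) 0.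

(* N(r, f) *)
Definition counting_function (R : realType) (r : R) (f : R[i] -> R[i]) : R :=
  \int[@lebesgue_measure R]_(t in `]0, r])
     (((pole_count t f)%:R - (pole_count 0 f)%:R) / t)
  + (pole_count 0 f)%:R * ln r.

(* T(r, f) *)
Definition nevanlinna_characteristic (R : realType) (r : R) (f : R[i] -> R[i])
    : R :=
  proximity r f + counting_function r f.

(* M(r, f) *)
Definition maximum_modulus (R : realType) (r : R) (f : R[i] -> R[i]) : R :=
  sup [set normc (f z) |
        z in [set z : R[i] | normc z = r]].

Definition iterlog (R : realType) (n : nat) (r : R) : R := iter n (@ln R) r.

Definition limsup_pinfty (R : realType) (u : R -> R) : \bar R :=
  limf_esup (fun r => (u r)%:E) (pinfty_nbhs R).

(* (p,q)-order: by M(r, f) for transcendental entire functions and by T(r, f)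
   for the other transcendental meromorphic functions. *)
Definition pq_order (R : realType) (p q : nat) (f : R[i] -> R[i]) : \bar R :=
  if `[< rational f >] then 0%E
  else if `[< entire f >] then
    limsup_pinfty (fun r => iterlog p.+1 (maximum_modulus r f) / iterlog q r)
  else
    limsup_pinfty
      (fun r => iterlog p (nevanlinna_characteristic r f) / iterlog q r).

(* (p,q)-type, meaningful for p, q >= 1 and f of nonzero finite (p,q)-order
   (hence transcendental).  For p = 1 the M- and T-normalisations differ by a
   factor that depends on f: entire functions use M(r, f). *)
Definition pq_type (R : realType) (p q : nat) (f : R[i] -> R[i]) : \bar R :=
  let rho := fine (pq_order p q f) in
  if `[< entire f >] then
    limsup_pinfty
      (fun r => iterlog p (maximum_modulus r f) / iterlog q.-1 r `^ rho)
  else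
    limsup_pinfty
      (fun r => iterlog p.-1 (nevanlinna_characteristic r f)
                / iterlog q.-1 r `^ rho).

Definition not_identically_zero (R : realType) (f : R[i] -> R[i]) : Prop :=
  exists z, ~ pole f z /\ f z != 0.

(* Equality of meromorphic functions: it is required only where no term is
   evaluated at a pole of f.  The coefficients A 1, ..., A k are the
   A (lift ord0 j) for j : 'I_k, with shift c j. *)
Definition difference_equation (R : realType) (k : nat)
    (A : 'I_k.+1 -> R[i] -> R[i]) (c : 'I_k -> R[i]) (F f : R[i] -> R[i])
    : Prop :=
  forall z, ~ pole f z -> (forall j, ~ pole f (z + c j)) ->
    \sum_(j < k) A (lift ord0 j) z * f (z + c j) + A ord0 z * f z = F z.

(* Main.v *)
Require Import Defs.
From HB Require Import structures.
From mathcomp Require Import all_boot all_order all_algebra.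
From mathcomp Require Import complex ring lra.
From mathcomp Require Import all_classical all_reals all_analysis.
From mathcomp Require Import measurable_realfun.

(** Write the equation as a linear relation
  [\sum_i A i * phi i = 0] in which the right-hand side is one more coefficient,
  multiplied by a constant function, while the other phi i are translates of f.
  Both parts then say the same: if one coefficient A l grows faster than all the
  others, then f cannot grow slowly ([growth_transfer]).  In (i) the dominant
  coefficient is the one of largest type among those of largest order, in (ii) it is
  the right-hand side.

  Suppose that the order of f is less than that of A l.  On large discs f is a
  quotient u / Q of holomorphic functions such that log |u| and log |Q| are at most
  K, and log |Q| is at least - K at prescribed points, where K is of smaller growth
  than log |A l| ([order_rep]).  For an entire f one takes Q = 1, for a rational f
  its numerator and denominator.  Otherwise Q is the Blaschke product of the poles:
  the proximity function bounds u by Poisson's formula, the counting function bounds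
  the number of factors of Q ([meromorphic_disc_rep]), and each factor costs log r,
  which is negligible on the scale of the first index p of the order because p >= q
  ([iterexp_product]).

  Clearing denominators gives A l G = - \sum_{i <> l} A i T i, where G and the T i
  are products of u's and Q's ([family_bound]).  Hence log |A l G| is bounded by the
  logarithms of the other A i, up to a multiple of K.  To divide by G in spite of
  its zeros, one removes them by Blaschke factors of a slightly larger disc.  This
  keeps the modulus on the larger circle, where the bound for A l G is taken, and
  increases it inside; the resulting v has no zeros, so that Harnack's inequality
  extends a lower bound for log |v| from one point to the smaller disc
  ([quotient_bound]).  There are no exceptional radii, and the outcome is

    log M(r, A l) <= max_{i <> l} log M((1 + d) r, A i) + C K(D r)

  for all large r, with d as small as one likes and C, D depending on d.  Since K is
  of smaller order, this contradicts the dominance of A l ([growth_comparison]).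

  The complex analysis starts from differentiability alone.  Bisection of rectangles
  gives Goursat's theorem and local primitives.  Cauchy's formula is first proved for
  functions with a continuous derivative, by shrinking the circle; applied to
  primitives it shows that derivatives are differentiable.  Poisson's formula is
  Cauchy's formula for a modified function, and it yields the maximum principle, the
  representation of log |v| for v without zeros, and Harnack's inequality. *)

Set Implicit Arguments.
Unset Strict Implicit.
Unset Printing Implicit Defensive.

Import Order.TTheory GRing.Theory Num.Theory.
Import numFieldNormedType.Exports.

Local Open Scope classical_set_scope.
Local Open Scope ring_scope.

Local Notation normc := ComplexField.Normc.normc.
Local Notation cderiv g z d :=
  (is_derive (z : (_[i])^o) (1 : (_[i])^o) (g : (_[i])^o -> (_[i])^o) d).

(** * Complex derivatives as estimates *)

Section ComplexBasics.
Variable R : realType.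
Implicit Types (z w : R[i]) (x y : R) (g : R[i] -> R[i]).

Lemma le_of_eq x y : x = y -> x <= y.
Proof. by move=> ->. Qed.

Lemma normc_norm z : `|z| = (normc z)%:C%C.
Proof. by []. Qed.

Lemma normc_ge0 z : 0 <= normc z.
Proof. by case: z => a b; exact: sqrtr_ge0. Qed.

Lemma normc_eq0 z : (normc z == 0) = (z == 0).
Proof.
apply/eqP/eqP => [|->]; first exact: ComplexField.Normc.eq0_normc.
exact: ComplexField.Normc.normc0.
Qed.

Lemma normc00 : normc (0 : R[i]) = 0.
Proof. exact: ComplexField.Normc.normc0. Qed.

Lemma normc_gt0 z : (0 < normc z) = (z != 0).
Proof. by rewrite lt_def normc_ge0 andbT normc_eq0. Qed.

Lemma normcD z w : normc (z + w) <= normc z + normc w.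
Proof. exact: (@le_normcD R z w). Qed.

Lemma normcNE z : normc (- z) = normc z.
Proof. exact: (@normcN R z). Qed.

Lemma normcB z w : normc (z - w) <= normc z + normc w.
Proof. by rewrite -(normcNE w) normcD. Qed.

Lemma normc_distC z w : normc (z - w) = normc (w - z).
Proof. by rewrite -normcNE opprB. Qed.

Lemma normcMl z w : normc (z * w) = normc z * normc w.
Proof. exact: ComplexField.Normc.normcM. Qed.

Lemma normcVl z : normc z^-1 = (normc z)^-1.
Proof. exact: ComplexField.Normc.normcV. Qed.

Lemma normc_real x : normc (x%:C)%C = `|x|.
Proof. by rewrite /= expr0n /= addr0 sqrtr_sqr. Qed.

Lemma normcX z n : normc (z ^+ n) = normc z ^+ n.
Proof.
elim: n => [|n IH]; first by rewrite !expr0 ComplexField.Normc.normc1.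
by rewrite !exprS normcMl IH.
Qed.

Lemma normc_prod (I : Type) (s : seq I) (P : pred I) (F : I -> R[i]) :
  normc (\prod_(i <- s | P i) F i) = \prod_(i <- s | P i) normc (F i).
Proof.
elim/big_rec2 : _ => [|i x y _ <-]; first exact: ComplexField.Normc.normc1.
by rewrite normcMl.
Qed.

Lemma normc_sum (I : Type) (s : seq I) (P : pred I) (F : I -> R[i]) :
  normc (\sum_(i <- s | P i) F i) <= \sum_(i <- s | P i) normc (F i).
Proof.
elim/big_ind2 : _ => [|x1 x2 y1 y2 h1 h2|//].
  by rewrite normc00.
by apply: le_trans (normcD _ _) _; exact: lerD.
Qed.

Lemma normc_Re z : `|complex.Re z| <= normc z.
Proof.
case: z => a b /=; rewrite -sqrtr_sqr; apply: ler_wsqrtr.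
by rewrite lerDl sqr_ge0.
Qed.

Lemma normc_Im z : `|complex.Im z| <= normc z.
Proof.
case: z => a b /=; rewrite -sqrtr_sqr; apply: ler_wsqrtr.
by rewrite lerDr sqr_ge0.
Qed.

Lemma normc_leD z : normc z <= `|complex.Re z| + `|complex.Im z|.
Proof.
case: z => a b /=; rewrite -[leRHS]ger0_norm ?addr_ge0//.
rewrite -sqrtr_sqr; apply: ler_wsqrtr.
rewrite sqrrD !real_normK ?num_real// -addrA lerD2l lerDr.
by rewrite mulrn_wge0 // mulr_ge0.
Qed.

Lemma normc_sqr z : normc z ^+ 2 = complex.Re z ^+ 2 + complex.Im z ^+ 2.
Proof. by case: z => a b /=; rewrite sqr_sqrtr // addr_ge0 ?sqr_ge0. Qed.

Lemma normc_dist_ge z w : normc z - normc w <= normc (z - w).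
Proof. by rewrite lerBlDr; apply: le_trans (normcD _ _); rewrite subrK. Qed.

Lemma complex_gt0 (e : R[i]) : (0 < e) -> 0 < complex.Re e /\ e = (complex.Re e)%:C%C.
Proof. by case: e => a b; rewrite ltcE /= => /andP[/eqP -> ?]. Qed.

Lemma cnbhsP (P : R[i] -> Prop) z :
  (\forall w \near (z : R[i]^o), P w) <->
  exists2 d : R, 0 < d & forall w, normc (w - z) < d -> P w.
Proof.
split.
  move=> /nbhs_ballP [e /= /complex_gt0[e0 eE] H]; exists (complex.Re e) => // w.
  move=> wz; apply: H; rewrite /ball /= eE normc_norm ltcR.
  by rewrite normc_distC.
move=> [d d0 H]; apply/nbhs_ballP; exists (d%:C)%C => /=; first by rewrite ltcR.
move=> w; rewrite /ball /= normc_norm ltcR normc_distC; exact: H.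
Qed.

Lemma cdnbhsP (P : R[i] -> Prop) z :
  (\forall w \near (z : R[i]^o)^', P w) <->
  exists2 d : R, 0 < d & forall w, w != z -> normc (w - z) < d -> P w.
Proof.
rewrite /dnbhs /within /=; split.
  move=> /(cnbhsP (fun w => w != z -> P w))[d d0 H]; exists d => // w wz ?.
  exact: H.
move=> [d d0 H]; apply/(cnbhsP (fun w => w != z -> P w)); exists d => // w ? ?.
exact: H.
Qed.

Lemma ccvgP (g : R[i] -> R[i]) z (a : R[i]) :
  ((g w : R[i]^o) @[w --> (z : R[i]^o)^'] --> (a : R[i]^o)) <->
  forall e : R, 0 < e -> exists2 d : R, 0 < d &
    forall w, w != z -> normc (w - z) < d -> normc (g w - a) <= e.
Proof.
split.
  move=> /cvgrPdist_le H e e0.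
  have /H : 0 < (e%:C%C : R[i]) by rewrite ltcR.
  move=> /cdnbhsP[d d0 Hd]; exists d => // w wz wd.
  by have := Hd w wz wd; rewrite normc_norm lecR normc_distC.
move=> H; apply/cvgrPdist_le => e /complex_gt0[e0 ->].
have [d d0 Hd] := H _ e0.
apply/cdnbhsP; exists d => // w wz wd.
by rewrite normc_norm lecR normc_distC; exact: Hd.
Qed.

(** Multiplying the difference quotient by the increment gives an estimate that
  holds at the base point too, so that no later argument has to leave it out. *)
Lemma cderivP g z d : cderiv g z d <->
  forall e : R, 0 < e -> exists2 dl : R, 0 < dl & forall w, normc (w - z) < dl ->
    normc (g w - g z - d * (w - z)) <= e * normc (w - z).
Proof.
have key : ((fun h : R[i]^o => h^-1 *: ((g : R[i]^o -> R[i]^o) (h *: (1 : R[i]^o) + z) - g z)) @ (0 : R[i]^o)^' --> (d : R[i]^o))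
  <-> (forall e : R, 0 < e -> exists2 dl : R, 0 < dl & forall w, normc (w - z) < dl ->
    normc (g w - g z - d * (w - z)) <= e * normc (w - z)).
  split.
    move=> /ccvgP H e e0; have [dl dl0 Hd] := H _ e0; exists dl => // w wz.
    have [->|wnz] := eqVneq w z.
      by rewrite !subrr mulr0 subrr normc00 mulr0.
    have wz0 : w - z != 0 by rewrite subr_eq0.
    have := Hd (w - z) wz0; rewrite subr0 => /(_ wz).
    rewrite /= [(w - z) *: 1]mulr1 subrK => h.
    have -> : g w - g z - d * (w - z) = ((w - z)^-1 *: (g w - g z : R[i]^o) - d) * (w - z).
      rewrite /GRing.scale /=; by field.
    by rewrite normcMl ler_wpM2r // normc_ge0.
  move=> H; apply/ccvgP => e e0; have [dl dl0 Hd] := H _ e0; exists dl => // h h0.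
  rewrite subr0 => hd /=.
  have := Hd (h + z); rewrite addrK => /(_ hd).
  have -> : (h *: (1 : R[i]^o) + z : R[i]^o) = h + z by rewrite [_ *: _]mulr1.
  move=> h1; rewrite -(@ler_pM2r _ (normc h)) ?normc_gt0 // -normcMl.
  apply: le_trans h1; apply: le_of_eq; congr normc.
  rewrite /GRing.scale /=; by field.
split => [[h hd]|H]; first by apply/(proj1 key); rewrite -hd; exact: h.
have {}H := proj2 key H; split; first by apply/cvg_ex; exists d; exact: H.
by apply: cvg_lim; [exact: norm_hausdorff|exact: H].
Qed.

(** Complex differentiability as the existence of a derivative: unlike its
  synonym [cdifferentiable], it does not unfold to a limit of filters. *)
Definition cdiff g z := exists d, cderiv g z d.

Lemma cdiffP g z : cdifferentiable g z <-> cdiff g z.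
Proof.
split => [/derivableP h|[d []//]]; eexists; exact: h.
Qed.

Lemma cderiv_diff g z d : cderiv g z d -> cdiff g z.
Proof. by exists d. Qed.

Lemma cderiv_unique g z a b : cderiv g z a -> cderiv g z b -> a = b.
Proof. by move=> [_ <-] [_ <-]. Qed.

Lemma near_cderiv g h z d : cderiv g z d ->
  (exists2 e : R, 0 < e & forall w, normc (w - z) < e -> g w = h w) -> cderiv h z d.
Proof.
move=> /cderivP H [e e0 He]; apply/cderivP => e1 /H[dl dl0 Hd].
exists (Num.min e dl) => [|w]; first by rewrite lt_min e0.
rewrite lt_min => /andP[we wd]; rewrite -He // -He; last by rewrite subrr normc00.
exact: Hd.
Qed.

Lemma cderiv_cst (a z : R[i]) : cderiv (fun=> a) z 0.
Proof. exact: is_derive_cst. Qed.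
Lemma cderiv_id z : cderiv id z 1.
Proof. exact: is_derive_id. Qed.
Lemma cderivD g h z a b : cderiv g z a -> cderiv h z b ->
  cderiv (fun w => g w + h w) z (a + b).
Proof. by move=> ? ?; exact: is_deriveD. Qed.
Lemma cderivB g h z a b : cderiv g z a -> cderiv h z b ->
  cderiv (fun w => g w - h w) z (a - b).
Proof. by move=> ? ?; exact: is_deriveB. Qed.
Lemma cderivM g h z a b : cderiv g z a -> cderiv h z b ->
  cderiv (fun w => g w * h w) z (a * h z + g z * b).
Proof.
move=> ha hb; have := @is_deriveM _ _ (g : R[i]^o -> R[i]^o) h z 1 a b ha hb.
by rewrite /GRing.scale /= addrC [h z * a]mulrC.
Qed.

Lemma ccontP g z : cdiff g z ->
  forall e, 0 < e -> exists2 d, 0 < d & forall w, normc (w - z) < d -> normc (g w - g z) < e.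
Proof.
move=> [D /cderivP H] e e0; have [dl dl0 Hd] := H _ ltr01.
set K := 1 + normc D.
have K0 : 0 < K by rewrite ltr_pwDl // normc_ge0.
exists (Num.min dl (e / K)) => [|w]; first by rewrite lt_min dl0 divr_gt0.
rewrite lt_min => /andP[h1 h2].
have -> : g w - g z = (g w - g z - D * (w - z)) + D * (w - z) by ring.
apply: le_lt_trans (normcD _ _) _; rewrite normcMl.
apply: le_lt_trans (lerD (Hd _ h1) (lexx _)) _.
by rewrite -mulrDl mulrC -ltr_pdivlMr.
Qed.

Lemma cderivV g z a : g z != 0 -> cderiv g z a ->
  cderiv (fun w => (g w)^-1) z (- a / (g z) ^+ 2).
Proof.
move=> g0 ha; split; first by apply: derivableV => //; case: ha.
have [h1 h2] := ha; rewrite (deriveV g0 h1) h2 /GRing.scale /=.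
by rewrite mulrC mulrN mulNr.
Qed.

Lemma cdiffD g h z : cdiff g z -> cdiff h z -> cdiff (fun w => g w + h w) z.
Proof. by move=> [a ha] [b hb]; exists (a + b); exact: cderivD. Qed.
Lemma cdiffB g h z : cdiff g z -> cdiff h z -> cdiff (fun w => g w - h w) z.
Proof. by move=> [a ha] [b hb]; exists (a - b); exact: cderivB. Qed.
Lemma cdiffM g h z : cdiff g z -> cdiff h z -> cdiff (fun w => g w * h w) z.
Proof. by move=> [a ha] [b hb]; exists (a * h z + g z * b); exact: cderivM. Qed.
Lemma cdiffV g z : g z != 0 -> cdiff g z -> cdiff (fun w => (g w)^-1) z.
Proof. by move=> g0 [a ha]; exists (- a / (g z) ^+ 2); exact: cderivV. Qed.
Lemma cdiff_cst (a z : R[i]) : cdiff (fun=> a) z.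
Proof. by exists 0; exact: cderiv_cst. Qed.
Lemma cdiff_id z : cdiff id z.
Proof. by exists 1; exact: cderiv_id. Qed.
Lemma cdiff_sub (a z : R[i]) : cdiff (fun w => w - a) z.
Proof. by apply: cdiffB; [exact: cdiff_id|exact: cdiff_cst]. Qed.
Lemma cdiff_linear (a b z : R[i]) : cdiff (fun w => a - b * w) z.
Proof.
by apply: cdiffB; [exact: cdiff_cst|apply: cdiffM; [exact: cdiff_cst|exact: cdiff_id]].
Qed.
Lemma eq_cdiff g h z : (forall w, g w = h w) -> cdiff g z -> cdiff h z.
Proof. by move=> /funext ->. Qed.
Lemma cdiffX g n z : cdiff g z -> cdiff (fun w => g w ^+ n) z.
Proof.
move=> h; elim: n => [|n IH].
  by apply: (eq_cdiff _ (cdiff_cst 1 z)) => w; rewrite expr0.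
by apply: (eq_cdiff _ (cdiffM h IH)) => w; rewrite exprS.
Qed.
Lemma cdiff_prod (I : Type) (s : seq I) (P : pred I) (F : I -> R[i] -> R[i]) z :
  (forall i, P i -> cdiff (F i) z) ->
  cdiff (fun w => \prod_(i <- s | P i) F i w) z.
Proof.
move=> h; elim: s => [|i s IH].
  by apply: (eq_cdiff _ (cdiff_cst 1 z)) => w; rewrite big_nil.
case Pi : (P i).
  by apply: (eq_cdiff _ (cdiffM (h _ Pi) IH)) => w; rewrite big_cons Pi.
by apply: (eq_cdiff _ IH) => w; rewrite big_cons Pi.
Qed.
Lemma cdiff_sum (I : Type) (s : seq I) (P : pred I) (F : I -> R[i] -> R[i]) z :
  (forall i, P i -> cdiff (F i) z) ->
  cdiff (fun w => \sum_(i <- s | P i) F i w) z.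
Proof.
move=> h; elim: s => [|i s IH].
  by apply: (eq_cdiff _ (cdiff_cst 0 z)) => w; rewrite big_nil.
case Pi : (P i).
  by apply: (eq_cdiff _ (cdiffD (h _ Pi) IH)) => w; rewrite big_cons Pi.
by apply: (eq_cdiff _ IH) => w; rewrite big_cons Pi.
Qed.

Lemma near_cdiff g h z : cdiff g z ->
  (exists2 e : R, 0 < e & forall w, normc (w - z) < e -> g w = h w) -> cdiff h z.
Proof. by move=> [d hd] H; exists d; exact: near_cderiv hd H. Qed.

Lemma cderiv_affine g (a b z d : R[i]) : cderiv g (a + b * z) d ->
  cderiv (fun w => g (a + b * w)) z (b * d).
Proof.
move=> /cderivP H; apply/cderivP => e e0.
have nb : 0 < 1 + normc b by rewrite ltr_pwDl // normc_ge0.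
have [dl dl0 Hd] := H _ (divr_gt0 e0 nb).
exists (dl / (1 + normc b)) => [|w]; first exact: divr_gt0.
rewrite ltr_pdivlMr // => wz.
have E : a + b * w - (a + b * z) = b * (w - z) by ring.
have le1 : normc (b * (w - z)) <= normc (w - z) * (1 + normc b).
  by rewrite normcMl mulrC ler_wpM2l ?normc_ge0 // lerDr.
have := Hd (a + b * w); rewrite E => /(_ (le_lt_trans le1 wz)).
have -> : d * (b * (w - z)) = b * d * (w - z) by ring.
move=> h; apply: le_trans h _.
apply: le_trans (ler_wpM2l _ le1) _; first by rewrite divr_ge0 ?ltW.
apply: le_of_eq; field; exact: lt0r_neq0.
Qed.

End ComplexBasics.

(** * Bisection of rectangles *)

Section Bisection.
Variable R : realType.
Implicit Types x y w h : R.

(** If P fails on a rectangle, it fails on one of its quarters.  Choosing such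
  quarters repeatedly gives nested rectangles that shrink to a point, and P holds
  on every small enough rectangle around that point. *)
Lemma bisection (P : R -> R -> R -> R -> Prop) x0 y0 w0 h0 :
  0 <= w0 -> 0 <= h0 ->
  (forall x y w h, P x y (w / 2) (h / 2) -> P (x + w / 2) y (w / 2) (h / 2) ->
     P x (y + h / 2) (w / 2) (h / 2) -> P (x + w / 2) (y + h / 2) (w / 2) (h / 2) ->
     P x y w h) ->
  (forall p q, x0 <= p <= x0 + w0 -> y0 <= q <= y0 + h0 ->
     exists2 d, 0 < d & forall x y w h, 0 <= w < d -> 0 <= h < d ->
       x0 <= x -> x + w <= x0 + w0 -> y0 <= y -> y + h <= y0 + h0 ->
       x <= p <= x + w -> y <= q <= y + h -> P x y w h) ->
  P x0 y0 w0 h0.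
Proof.
move=> w00 h00 Psplit Ploc; apply: contrapT => nP0.
pose W n := w0 / 2 ^+ n; pose H n := h0 / 2 ^+ n.
have WS n : W n.+1 = W n / 2.
  by rewrite /W exprS invfM mulrA mulrAC.
have HS n : H n.+1 = H n / 2.
  by rewrite /H exprS invfM mulrA mulrAC.
have W0 n : 0 <= W n by rewrite divr_ge0 // exprn_ge0.
have H0 n : 0 <= H n by rewrite divr_ge0 // exprn_ge0.
pose bad n (s : R * R) := ~ P s.1 s.2 (W n) (H n).
pose sub n (s s' : R * R) :=
  [/\ s.1 <= s'.1, s'.1 + W n.+1 <= s.1 + W n, s.2 <= s'.2 & s'.2 + H n.+1 <= s.2 + H n].
have step (ns : nat * (R * R)) : exists s', bad ns.1 ns.2 -> bad ns.1.+1 s' /\ sub ns.1 ns.2 s'.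
  case: ns => n [x y] /=; have [b|nb] := pselect (bad n (x, y)); last first.
    by exists (x, y) => /nb.
  have Wn := W0 n; have Hn := H0 n.
  suff [s' [b' s'b]] : exists s', bad n.+1 s' /\ sub n (x, y) s' by exists s'.
  apply: contrapT => nex; apply: b => /=.
  have all4 x' y' : sub n (x, y) (x', y') -> P x' y' (W n / 2) (H n / 2).
    move=> ss; apply: contrapT => b'; apply: nex; exists (x', y').
    by split => //; rewrite /bad /= WS HS.
  by apply: Psplit; apply: all4; rewrite /sub /= WS HS; split; lra.
have [f fP] := choice step.
pose u := fix u n := if n is m.+1 then f (m, u m) else (x0, y0).
have ubad n : bad n (u n).
  elim: n => [|n IH]; first by rewrite /bad /= /W /H !expr0 !divr1.
  exact: (fP (n, u n) IH).1.
have usub n : sub n (u n) (u n.+1) := (fP (n, u n) (ubad n)).2.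
have umon n m : (n <= m)%N -> [/\ (u n).1 <= (u m).1, (u m).1 + W m <= (u n).1 + W n,
    (u n).2 <= (u m).2 & (u m).2 + H m <= (u n).2 + H n].
  move=> /subnKC <-; elim: (m - n)%N => [|k [a1 a2 a3 a4]]; first by rewrite addn0.
  rewrite addnS; have [b1 b2 b3 b4] := usub (n + k)%N.
  by split; [exact: le_trans b1|exact: le_trans a2|exact: le_trans b3|exact: le_trans a4].
have ub1 n m : (u m).1 <= (u n).1 + W n.
  have := W0 m; have := W0 n; have [/umon[]|/ltnW/umon[]] := leqP n m; lra.
have ub2 n m : (u m).2 <= (u n).2 + H n.
  have := H0 m; have := H0 n; have [/umon[]|/ltnW/umon[]] := leqP n m; lra.
pose A := range (fun n => (u n).1); pose B := range (fun n => (u n).2).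
have supA : has_sup A.
  by split; [exists (u 0%N).1; exists 0%N|exists ((u 0%N).1 + W 0%N) => _ [m _ <-]].
have supB : has_sup B.
  by split; [exists (u 0%N).2; exists 0%N|exists ((u 0%N).2 + H 0%N) => _ [m _ <-]].
have pA n : (u n).1 <= sup A <= (u n).1 + W n.
  apply/andP; split; first by apply: (ub_le_sup supA.2); exists n.
  by apply: ge_sup; [case: supA|move=> _ [m _ <-]].
have qB n : (u n).2 <= sup B <= (u n).2 + H n.
  apply/andP; split; first by apply: (ub_le_sup supB.2); exists n.
  by apply: ge_sup; [case: supB|move=> _ [m _ <-]].
have [|| d d0 Hd] := Ploc (sup A) (sup B).
- by have := pA 0%N; rewrite /= /W expr0 divr1.
- by have := qB 0%N; rewrite /= /H expr0 divr1.
have small c : 0 <= c -> exists N, forall n, (N <= n)%N -> c / 2 ^+ n < d.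
  move=> c0; exists (Num.trunc (c / d)).+1 => n Nn.
  rewrite ltr_pdivrMr ?exprn_gt0 // mulrC -ltr_pdivrMr //.
  apply: (@lt_trans _ _ (Num.trunc (c / d)).+1%:R); first exact: truncnS_gt.
  rewrite -natrX ltr_nat; apply: leq_ltn_trans Nn _; exact: ltn_expl.
have [N1 HN1] := small _ w00; have [N2 HN2] := small _ h00.
pose N := maxn N1 N2.
have [a1 a2 a3 a4] := umon 0%N N (leq0n _).
move: a1 a2 a3 a4; rewrite /= {2}/W {2}/H !expr0 !divr1 => a1 a2 a3 a4.
apply: (ubad N); apply: Hd => //.
- by rewrite W0 HN1 // leq_maxl.
- by rewrite H0 HN2 // leq_maxr.
Qed.

End Bisection.

(** * Curves in the complex plane *)

Section CurveDerivative.
Variable R : realType.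
Implicit Types (x y : R) (g : R[i] -> R[i]).

Lemma rderivP (f : R -> R) x d : is_derive x 1 f d <->
  forall e, 0 < e -> exists2 dl, 0 < dl & forall y, `|y - x| < dl ->
    `|f y - f x - d * (y - x)| <= e * `|y - x|.
Proof.
have key : ((fun h => h^-1 *: (f (h *: 1 + x) - f x)) @ (0 : R)^' --> d)
  <-> (forall e, 0 < e -> exists2 dl, 0 < dl & forall y, `|y - x| < dl ->
    `|f y - f x - d * (y - x)| <= e * `|y - x|).
  split.
    move=> /cvgrPdist_le H e e0; have /= := H _ e0.
    rewrite near_withinE => /nbhs_ballP[dl /= dl0 Hd].
    exists dl => // y yx; have [->|ynx] := eqVneq y x.
      by rewrite !subrr mulr0 subrr !normr0 mulr0.
    have yx0 : y - x != 0 by rewrite subr_eq0.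
    have := Hd (y - x); rewrite /ball /= sub0r normrN => /(_ yx yx0).
    rewrite /GRing.scale /= mulr1 subrK distrC => h.
    have -> : f y - f x - d * (y - x) = ((y - x)^-1 * (f y - f x) - d) * (y - x).
      by field.
    by rewrite normrM ler_wpM2r.
  move=> H; apply/cvgrPdist_le => e e0; have [dl dl0 Hd] := H _ e0.
  rewrite near_withinE; apply/nbhs_ballP; exists dl => // h.
  rewrite /ball /= sub0r normrN => hd h0.
  have := Hd (h + x); rewrite addrK => /(_ hd).
  rewrite /GRing.scale /= mulr1 distrC => h1.
  rewrite -(@ler_pM2r _ `|h|) ?normr_gt0 // -normrM.
  apply: le_trans h1; apply: le_of_eq; congr (`|_|).
  by field.
split => [[h hd]|H]; first by apply/(proj1 key); rewrite -hd; exact: h.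
have {}H := proj2 key H; split; first by apply/cvg_ex; exists d; exact: H.
by apply: cvg_lim; [exact: norm_hausdorff|exact: H].
Qed.

Definition curve_deriv (c : R -> R[i]) x (d : R[i]) :=
  is_derive x 1 (fun t => complex.Re (c t)) (complex.Re d) /\
  is_derive x 1 (fun t => complex.Im (c t)) (complex.Im d).

Lemma complex_ReB (a b : R[i]) : complex.Re (a - b) = complex.Re a - complex.Re b.
Proof. by case: a; case: b. Qed.
Lemma complex_ImB (a b : R[i]) : complex.Im (a - b) = complex.Im a - complex.Im b.
Proof. by case: a; case: b. Qed.
Lemma complex_Re_mulr (a : R[i]) x : complex.Re (a * x%:C%C) = complex.Re a * x.
Proof. by case: a => a b /=; rewrite mulr0 subr0. Qed.
Lemma complex_Im_mulr (a : R[i]) x : complex.Im (a * x%:C%C) = complex.Im a * x.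
Proof. by case: a => a b /=; rewrite mulr0 add0r. Qed.

Lemma curve_derivP (c : R -> R[i]) x d : curve_deriv c x d <->
  forall e, 0 < e -> exists2 dl, 0 < dl & forall y, `|y - x| < dl ->
    normc (c y - c x - d * (y - x)%:C%C) <= e * `|y - x|.
Proof.
split.
  move=> [/rderivP H1 /rderivP H2] e e0; have e2 : 0 < e / 2 by rewrite divr_gt0.
  have [d1 d10 h1] := H1 _ e2; have [d2 d20 h2] := H2 _ e2.
  exists (Num.min d1 d2) => [|y]; first by rewrite lt_min d10.
  rewrite lt_min => /andP[/h1 k1 /h2 k2].
  apply: le_trans (normc_leD _) _.
  rewrite !complex_ReB !complex_ImB complex_Re_mulr complex_Im_mulr; apply: le_trans (lerD k1 k2) _.
  by apply: le_of_eq; field.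
move=> H; split; apply/rderivP => e e0; have [dl dl0 Hd] := H e e0;
    exists dl => // y /Hd; apply: le_trans.
  by rewrite -complex_Re_mulr -!complex_ReB normc_Re.
by rewrite -complex_Im_mulr -!complex_ImB normc_Im.
Qed.

Lemma normc_dist_le (a b : R[i]) : normc a <= normc b + normc (a - b).
Proof. by rewrite -lerBlDl normc_dist_ge. Qed.

Lemma curve_deriv_comp g (c : R -> R[i]) x D d :
  cderiv g (c x) D -> curve_deriv c x d -> curve_deriv (fun t => g (c t)) x (D * d).
Proof.
move=> /cderivP Hg /curve_derivP Hc; apply/curve_derivP => e e0.
set K := 1 + normc D + normc d.
have K1 : 1 <= K by rewrite /K -addrA lerDl addr_ge0 ?normc_ge0.
have K0 : 0 < K := lt_le_trans ltr01 K1.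
have nD := normc_ge0 D; have nd := normc_ge0 d.
set e1 := Num.min 1 (e / (2 * K)).
have e10 : 0 < e1 by rewrite lt_min ltr01 divr_gt0 // mulr_gt0.
have e11 : e1 <= 1 by rewrite ge_min lexx.
have e1K : e1 * K <= e / 2.
  have : e1 <= e / (2 * K) by rewrite ge_min lexx orbT.
  move=> /(ler_wpM2r (ltW K0)) /le_trans; apply; apply: le_of_eq; field.
  exact: lt0r_neq0.
have [dg dg0 hg] := Hg _ e10; have [dc dc0 hc] := Hc _ e10.
exists (Num.min dc (dg / K)) => [|y]; first by rewrite lt_min dc0 divr_gt0.
rewrite lt_min => /andP[/hc k1 k2].
have nc : normc (c y - c x) <= K * `|y - x|.
  apply: le_trans (normc_dist_le _ (d * (y - x)%:C%C)) _.
  rewrite normcMl normc_real; apply: le_trans (lerD (lexx _) k1) _.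
  rewrite -mulrDl; apply: ler_wpM2r => //; rewrite /K; lra.
have /hg k3 : normc (c y - c x) < dg.
  by apply: le_lt_trans nc _; rewrite mulrC -ltr_pdivlMr.
have -> : g (c y) - g (c x) - D * d * (y - x)%:C%C =
  (g (c y) - g (c x) - D * (c y - c x)) + D * (c y - c x - d * (y - x)%:C%C) by ring.
apply: le_trans (normcD _ _) _; rewrite normcMl.
apply: (@le_trans _ _ (e1 * (K * `|y - x|) + K * (e1 * `|y - x|))); last first.
  have := ler_wpM2r (normr_ge0 (y - x)) e1K; lra.
apply: lerD; first by apply: le_trans k3 _; apply: ler_wpM2l => //; exact: ltW.
by apply: ler_pM => //; [exact: normc_ge0|rewrite /K; lra].
Qed.

Lemma curve_derivD (b c : R -> R[i]) x db dc :
  curve_deriv b x db -> curve_deriv c x dc ->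
  curve_deriv (fun t => b t + c t) x (db + dc).
Proof.
move=> [b1 b2] [c1 c2]; split.
  have -> : (fun t => complex.Re (b t + c t)) = (fun t => complex.Re (b t) + complex.Re (c t)).
    by apply/funext => t; case: (b t); case: (c t).
  have -> : complex.Re (db + dc) = complex.Re db + complex.Re dc by case: db b1 b2; case: dc c1 c2.
  exact: is_deriveD.
have -> : (fun t => complex.Im (b t + c t)) = (fun t => complex.Im (b t) + complex.Im (c t)).
  by apply/funext => t; case: (b t); case: (c t).
have -> : complex.Im (db + dc) = complex.Im db + complex.Im dc by case: db b1 b2; case: dc c1 c2.
exact: is_deriveD.
Qed.

Lemma curve_derivB (b c : R -> R[i]) x db dc :
  curve_deriv b x db -> curve_deriv c x dc ->
  curve_deriv (fun t => b t - c t) x (db - dc).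
Proof.
move=> hb hc; have h : curve_deriv (fun t => -1 * c t) x (-1 * dc).
  apply: (curve_deriv_comp (g := fun w => -1 * w)) => //.
  have := cderivM (cderiv_cst (-1) (c x)) (cderiv_id (c x)).
  by rewrite mul0r add0r mulr1.
have := curve_derivD hb h; rewrite mulN1r.
by have -> : (fun t => b t + -1 * c t) = (fun t => b t - c t) by apply/funext => t; rewrite mulN1r.
Qed.

Lemma curve_deriv_hor y x : curve_deriv (fun t => t +i* y)%C x 1.
Proof. by split; [exact: is_derive_id|exact: is_derive_cst]. Qed.
Lemma curve_deriv_ver y x : curve_deriv (fun t => x +i* t)%C y 'i%C.
Proof. by split; [exact: is_derive_cst|exact: is_derive_id]. Qed.

Lemma real_mean_value (f df : R -> R) a b e :
  (forall x, Num.min a b <= x <= Num.max a b -> is_derive x 1 f (df x) /\ `|df x| <= e) ->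
  `|f b - f a| <= e * `|b - a|.
Proof.
wlog ab : a b / a <= b => [W|].
  move=> H; have /orP[ab|ba] := le_total a b; first exact: W.
  rewrite distrC (distrC b); apply: (W b a ba) => x.
  by rewrite minC maxC; exact: H.
rewrite (min_idPl ab) (max_idPr ab) => H.
have d1 x : x \in `]a, b[ -> is_derive x 1 f (df x).
  by rewrite in_itv /= => /andP[/ltW h1 /ltW h2]; apply: (H x _).1; rewrite h1.
have c1 : {within `[a, b], continuous f}.
  apply: derivable_within_continuous => x; rewrite in_itv /= => xab.
  by case: (H x xab).1.
have [c] := @MVT_segment R f df a b ab d1 c1.
rewrite in_itv /= => cab ->; rewrite normrM; apply: ler_wpM2r => //.
exact: (H c cab).2.
Qed.

(** The factor 2 comes from bounding the real and imaginary parts separately. *)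
Lemma curve_mean_value (c dc : R -> R[i]) a b e :
  (forall x, Num.min a b <= x <= Num.max a b ->
     curve_deriv c x (dc x) /\ normc (dc x) <= e) ->
  normc (c b - c a) <= 2 * e * `|b - a|.
Proof.
move=> H; apply: le_trans (normc_leD _) _; rewrite complex_ReB complex_ImB -mulrA mulrDl mul1r.
apply: lerD.
  apply: (@real_mean_value (fun t => complex.Re (c t)) (fun t => complex.Re (dc t))) => x /H[[h _] h2].
  by split => //; apply: le_trans h2; exact: normc_Re.
apply: (@real_mean_value (fun t => complex.Im (c t)) (fun t => complex.Im (dc t))) => x /H[[_ h] h2].
by split => //; apply: le_trans h2; exact: normc_Im.
Qed.

Lemma antiderivative (f : R -> R) (a b : R) : continuous f ->
  exists F, forall x, a < x < b -> is_derive x 1 F (f x).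
Proof.
move=> cf; have fi : lebesgue_measure.-integrable `[a, b] (EFin \o f).
  by apply: continuous_compact_integrable; [exact: segment_compact|exact: continuous_subspaceT].
exists (fun x => \int[lebesgue_measure]_(t in `[a, x]) f t) => x /andP[ax xb].
have [d1 d2] := continuous_FTC1_closed xb fi ax (cf x).
by split; [exact: d1|rewrite -derive1E; exact: d2].
Qed.

End CurveDerivative.

(** * Goursat's theorem and local primitives *)

Section Goursat.
Variable R : realType.
Implicit Types (x y : R) (g : R[i] -> R[i]).

Lemma cderiv_eq g z (a b : R[i]) : cderiv g z a -> a = b -> cderiv g z b.
Proof. by move=> h <-. Qed.

Definition ccont g (z : R[i]) := forall e, 0 < e -> exists2 d, 0 < d &
  forall w, normc (w - z) < d -> normc (g w - g z) < e.

Lemma cdiff_cont g z : cdiff g z -> ccont g z.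
Proof. exact: ccontP. Qed.

Definition curve_cont (c : R -> R[i]) := forall x e, 0 < e ->
  exists2 d, 0 < d & forall y, `|y - x| < d -> normc (c y - c x) < e.

Lemma real_continuousP (f : R -> R) : continuous f <-> forall x e, 0 < e ->
  exists2 d, 0 < d & forall y, `|y - x| < d -> `|f y - f x| < e.
Proof.
split=> [cf x e e0|H x].
  have /cvgrPdist_lt /(_ e e0) := cf x; move=> /nbhs_ballP[d /= d0 Hd].
  by exists d => // y yx; rewrite distrC; apply: Hd; rewrite /ball /= distrC.
apply/cvgrPdist_lt => e e0; have [d d0 Hd] := H x e e0.
apply/nbhs_ballP; exists d => // y; rewrite /ball /= distrC => /Hd.
by rewrite distrC.
Qed.

Lemma curve_cont_Re c : curve_cont c -> continuous (fun t => complex.Re (c t)).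
Proof.
move=> H; apply/real_continuousP => x e e0; have [d d0 Hd] := H x e e0.
by exists d => // y /Hd; apply: le_lt_trans; rewrite -complex_ReB normc_Re.
Qed.

Lemma curve_cont_Im c : curve_cont c -> continuous (fun t => complex.Im (c t)).
Proof.
move=> H; apply/real_continuousP => x e e0; have [d d0 Hd] := H x e e0.
by exists d => // y /Hd; apply: le_lt_trans; rewrite -complex_ImB normc_Im.
Qed.

Lemma curve_cont_comp g c : curve_cont c -> (forall x, ccont g (c x)) ->
  curve_cont (fun t => g (c t)).
Proof.
move=> cc cg x e e0; have [d d0 Hd] := cg x e e0; have [d' d'0 Hd'] := cc x d d0.
by exists d' => // y /Hd' /Hd.
Qed.

(** The integral of a function along the boundary of a rectangle, in terms of its
  primitives [H y] along horizontal and [V x] along vertical lines. *)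
Definition boundary_sum (H V : R -> R -> R[i]) x1 x2 y1 y2 : R[i] :=
  (H y1 x2 - H y1 x1) + (V x2 y2 - V x2 y1)
  - (H y2 x2 - H y2 x1) - (V x1 y2 - V x1 y1).

(** Goursat's argument.  A bound of the boundary integral by [e * (w ^+ 2 + h ^+ 2)]
  passes from the four quarters to the whole rectangle.  It holds on small
  rectangles around a point: there the function differs little from an affine one,
  and an affine function has the primitive [G], hence zero boundary integral. *)
Lemma goursat_rectangle g (H V : R -> R -> R[i]) x0 y0 w0 h0 :
  0 <= w0 -> 0 <= h0 ->
  (forall x y, x0 <= x <= x0 + w0 -> y0 <= y <= y0 + h0 ->
    [/\ cdiff g (x +i* y)%C, curve_deriv (H y) x (g (x +i* y)%C) &
        curve_deriv (V x) y (g (x +i* y)%C * 'i%C)]) ->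
  boundary_sum H V x0 (x0 + w0) y0 (y0 + h0) = 0.
Proof.
move=> w00 h00 HV.
suff bnd e : 0 < e -> normc (boundary_sum H V x0 (x0 + w0) y0 (y0 + h0))
    <= e * (w0 ^+ 2 + h0 ^+ 2).
  apply/eqP; rewrite -normc_eq0 eq_le normc_ge0 andbT.
  set K := w0 ^+ 2 + h0 ^+ 2; have K0 : 0 <= K by rewrite addr_ge0 // sqr_ge0.
  apply/ler_addgt0Pl => e e0; rewrite addr0.
  have K1 : 0 < 1 + K by rewrite ltr_pwDl.
  apply: le_trans (bnd (e / (1 + K)) (divr_gt0 e0 K1)) _.
  by rewrite -[leRHS]mulr1 -mulrA ler_pM2l // mulrC ler_pdivrMr // mul1r lerDr.
move=> e0; apply: (bisection (P := fun x y w h =>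
    normc (boundary_sum H V x (x + w) y (y + h)) <= e * (w ^+ 2 + h ^+ 2))) => //.
  move=> x y w h.
  have -> : x + w / 2 + w / 2 = x + w by lra.
  have -> : y + h / 2 + h / 2 = y + h by lra.
  move=> b1 b2 b3 b4.
  have -> : boundary_sum H V x (x + w) y (y + h) =
    (boundary_sum H V x (x + w / 2) y (y + h / 2)
     + boundary_sum H V (x + w / 2) (x + w) y (y + h / 2))
    + (boundary_sum H V x (x + w / 2) (y + h / 2) (y + h)
     + boundary_sum H V (x + w / 2) (x + w) (y + h / 2) (y + h)).
    by rewrite /boundary_sum; ring.
  apply: le_trans (normcD _ _) _.
  apply: le_trans (lerD (normcD _ _) (normcD _ _)) _.
  apply: le_trans (lerD (lerD b1 b2) (lerD b3 b4)) _.
  by apply: le_of_eq; field.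
move=> p q px qy; have [/= [D /cderivP HD] _ _] := HV p q px qy.
set c := (p +i* q)%C in HD.
have e8 : 0 < e / 8 by rewrite divr_gt0.
have [d d0 Hd] := HD _ e8; exists (d / 2); first by rewrite divr_gt0.
move=> x y w h /andP[w0' wd] /andP[h0' hd] x0x xw y0y yh /andP[xp pxw] /andP[yq qyh].
set a := g c in Hd.
pose G z := (z - c) * (a + D / 2 * (z - c)).
have dG z : cderiv G z (a + D * (z - c)).
  have h1 : cderiv (fun z => z - c) z 1.
    by apply: cderiv_eq (cderivB (cderiv_id z) (cderiv_cst c z)) _; rewrite subr0.
  apply: cderiv_eq (cderivM h1 (cderivD (cderiv_cst a z) (cderivM (cderiv_cst (D/2) z) h1))) _.
  by field.
have subx s : x <= s <= x + w -> x0 <= s <= x0 + w0.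
  by move=> /andP[? ?]; apply/andP; split; lra.
have suby t : y <= t <= y + h -> y0 <= t <= y0 + h0.
  by move=> /andP[? ?]; apply/andP; split; lra.
have close s t : x <= s <= x + w -> y <= t <= y + h ->
    normc (g (s +i* t)%C - (a + D * ((s +i* t)%C - c))) <= e / 8 * (w + h).
  move=> /andP[s1 s2] /andP[t1 t2].
  have n1 : normc ((s +i* t)%C - c) <= w + h.
    apply: le_trans (normc_leD _) _; rewrite /c /=; apply: lerD; rewrite ler_norml; lra.
  rewrite opprD addrA; apply: le_trans (Hd _ _) _; first by apply: le_lt_trans n1 _; lra.
  by apply: ler_wpM2l => //; exact: ltW.
have hor t : y <= t <= y + h -> normc ((H t (x + w) - G ((x + w) +i* t)%C) - (H t x - G (x +i* t)%C))
    <= 2 * (e / 8 * (w + h)) * w.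
  move=> tb; have /andP[tb1 tb2] := tb; apply: le_trans (@curve_mean_value _ (fun s => H t s - G (s +i* t)%C)
    (fun s => g (s +i* t)%C - (a + D * ((s +i* t)%C - c))) _ _ (e / 8 * (w + h)) _) _.
    rewrite (min_idPl _) ?lerDl // (max_idPr _) ?lerDl // => s sb; have /andP[sb1 sb2] := sb.
    split; last exact: close.
    apply: curve_derivB; first by case: (HV s t (subx _ sb) (suby _ tb)).
    rewrite -[X in curve_deriv _ _ X]mulr1.
    exact: (curve_deriv_comp (dG _) (curve_deriv_hor _ _)).
  by rewrite addrAC subrr add0r ger0_norm.
have ver s : x <= s <= x + w -> normc ((V s (y + h) - G (s +i* (y + h))%C) - (V s y - G (s +i* y)%C))
    <= 2 * (e / 8 * (w + h)) * h.
  move=> sb; have /andP[sb1 sb2] := sb; apply: le_trans (@curve_mean_value _ (fun t => V s t - G (s +i* t)%C)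
    (fun t => (g (s +i* t)%C - (a + D * ((s +i* t)%C - c))) * 'i%C) _ _ (e / 8 * (w + h)) _) _.
    rewrite (min_idPl _) ?lerDl // (max_idPr _) ?lerDl // => t tb; have /andP[tb1 tb2] := tb.
    have ni : normc ('i%C : R[i]) = 1 by rewrite /= expr0n expr1n add0r sqrtr1.
    split; last by rewrite normcMl ni mulr1; exact: close.
    rewrite mulrBl; apply: curve_derivB; first by case: (HV s t (subx _ sb) (suby _ tb)).
    exact: (curve_deriv_comp (dG _) (curve_deriv_ver _ _)).
  by rewrite addrAC subrr add0r ger0_norm.
have xx : x <= x <= x + w by rewrite lexx lerDl.
have xw' : x <= x + w <= x + w by rewrite lexx lerDl w0'.
have yy : y <= y <= y + h by rewrite lexx lerDl.
have yh' : y <= y + h <= y + h by rewrite lexx lerDl h0'.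
have -> : boundary_sum H V x (x + w) y (y + h) =
   (((H y (x + w) - G ((x + w) +i* y)%C) - (H y x - G (x +i* y)%C))
   + ((V (x + w) (y + h) - G ((x + w) +i* (y + h))%C) - (V (x + w) y - G ((x + w) +i* y)%C)))
   - (((H (y + h) (x + w) - G ((x + w) +i* (y + h))%C) - (H (y + h) x - G (x +i* (y + h))%C))
   + ((V x (y + h) - G (x +i* (y + h))%C) - (V x y - G (x +i* y)%C))).
  by rewrite /boundary_sum; ring.
apply: le_trans (normcB _ _) _.
apply: le_trans (lerD (normcD _ _) (normcD _ _)) _.
apply: le_trans (lerD (lerD (hor _ yy) (ver _ xw')) (lerD (hor _ yh') (ver _ xx))) _.
have : 0 <= e / 2 * (w - h) ^+ 2 by rewrite mulr_ge0 ?sqr_ge0 // divr_ge0 // ltW.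
by rewrite -subr_ge0 => hh; rewrite -subr_ge0; apply: le_trans hh _; apply: le_of_eq; field.
Qed.

(** Exchanging two opposite sides only changes the sign of the boundary integral,
  so the corners need not be ordered; the next lemma moves in all directions. *)
Lemma goursat g (H V : R -> R -> R[i]) s :
  (forall x y, `|x| <= s -> `|y| <= s ->
    [/\ cdiff g (x +i* y)%C, curve_deriv (H y) x (g (x +i* y)%C) &
        curve_deriv (V x) y (g (x +i* y)%C * 'i%C)]) ->
  forall x1 x2 y1 y2, `|x1| <= s -> `|x2| <= s -> `|y1| <= s -> `|y2| <= s ->
  boundary_sum H V x1 x2 y1 y2 = 0.
Proof.
move=> HV x1 x2 y1 y2.
wlog x12 : x1 x2 / x1 <= x2 => [W h1 h2 h3 h4|].
  have /orP[x12|x21] := le_total x1 x2; first exact: W.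
  have := W _ _ x21 h2 h1 h3 h4 => /(congr1 (fun z => - z)); rewrite oppr0 => <-.
  by rewrite /boundary_sum; ring.
wlog y12 : y1 y2 / y1 <= y2 => [W h1 h2 h3 h4|].
  have /orP[y12|y21] := le_total y1 y2; first exact: W.
  have := W _ _ y21 h1 h2 h4 h3 => /(congr1 (fun z => - z)); rewrite oppr0 => <-.
  by rewrite /boundary_sum; ring.
rewrite !ler_norml => /andP[a1 a2] /andP[b1 b2] /andP[c1 c2] /andP[d1 d2].
have := @goursat_rectangle g H V x1 y1 (x2 - x1) (y2 - y1).
rewrite !subr_ge0 => /(_ x12 y12); rewrite ![_ + (_ - _)]addrC !subrK; apply.
move=> x y /andP[e1 e2] /andP[f1 f2]; apply: HV; rewrite ler_norml; apply/andP; split; lra.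
Qed.

Lemma between_abs (s a b t : R) : `|a| <= s -> `|b| <= s ->
  Num.min a b <= t <= Num.max a b -> `|t| <= s /\ `|t - a| <= `|b - a|.
Proof.
have := ler_norm (b - a); have := ler_norm (- (b - a)); rewrite normrN.
move: `|b - a| => N n1 n2; rewrite ge_min le_max !ler_norml.
by move=> /andP[? ?] /andP[? ?] /andP[/orP[?|?] /orP[?|?]]; split; apply/andP; split; lra.
Qed.

(** The primitive integrates g from 0 first horizontally, then vertically.  By
  Goursat's theorem an increment of it is an integral along a horizontal segment
  that starts at the base point, followed by a vertical one, and g is close to its
  value at the base point on both. *)
Lemma square_primitive g (s : R) : 0 < s ->
  (forall y, curve_cont (fun x => g (x +i* y)%C)) ->
  (forall x, curve_cont (fun y => g (x +i* y)%C)) ->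
  (forall x y, `|x| <= s -> `|y| <= s -> cdiff g (x +i* y)%C) ->
  exists F, forall x y, `|x| < s -> `|y| < s -> cderiv F (x +i* y)%C (g (x +i* y)%C).
Proof.
move=> s0 ch cv cg.
have prim (c : R -> R[i]) : curve_cont c ->
    exists C, forall x, `|x| <= s -> curve_deriv C x (c x).
  move=> cc; have [F1 h1] := antiderivative (- s - 1) (s + 1) (curve_cont_Re cc).
  have [F2 h2] := antiderivative (- s - 1) (s + 1) (curve_cont_Im cc).
  exists (fun x => F1 x +i* F2 x)%C => x; rewrite ler_norml => /andP[x1 x2].
  by split; [apply: h1|apply: h2]; apply/andP; split; lra.
have [H hH] := choice (fun y => prim _ (ch y)).
have cv' x : curve_cont (fun y => g (x +i* y)%C * 'i%C).
  move=> y e e0; have [d d0 Hd] := cv x y e e0; exists d => // y' /Hd.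
  by rewrite -mulrBl normcMl /= expr0n expr1n add0r sqrtr1 mulr1.
have [V hV] := choice (fun x => prim _ (cv' x)).
have HV x1 x2 y1 y2 : `|x1| <= s -> `|x2| <= s -> `|y1| <= s -> `|y2| <= s ->
    boundary_sum H V x1 x2 y1 y2 = 0.
  apply: (@goursat g) => x y xs ys.
  by split; [exact: cg|exact: hH|exact: hV].
exists (fun z => (H 0 (complex.Re z) - H 0 0) + (V (complex.Re z) (complex.Im z) - V (complex.Re z) 0)) => x y xs ys.
apply/cderivP => e e0; have e4 : 0 < e / 4 by rewrite divr_gt0.
have [d d0 Hd] := cdiff_cont (cg _ _ (ltW xs) (ltW ys)) e4.
exists (Num.min (d / 2) (Num.min (s - `|x|) (s - `|y|))) => [|[x' y']].
  by rewrite !lt_min !subr_gt0 xs ys divr_gt0.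
set z := (x +i* y)%C; set w := (x' +i* y')%C.
rewrite !lt_min => /and3P[wz wx wy].
have nx : `|x' - x| <= normc (w - z) by have := normc_Re (w - z).
have ny : `|y' - y| <= normc (w - z) by have := normc_Im (w - z).
have x's : `|x'| <= s.
  have -> : x' = x + (x' - x) by ring.
  by apply: le_trans (ler_normD _ _) _; lra.
have y's : `|y'| <= s.
  have -> : y' = y + (y' - y) by ring.
  by apply: le_trans (ler_normD _ _) _; lra.
have s00 : `|0 : R| <= s by rewrite normr0 ltW.
have := HV x x' 0 y (ltW xs) x's s00 (ltW ys); rewrite /boundary_sum => E.
move: (normc (w - z)) wz nx ny => N wz nx ny /=.
have -> : H 0 x' - H 0 0 + (V x' y' - V x' 0) - (H 0 x - H 0 0 + (V x y - V x 0)) - g z * (w - z)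
  = ((H y x' - g z * (x' +i* y)%C) - (H y x - g z * (x +i* y)%C)) +
    ((V x' y' - g z * (x' +i* y')%C) - (V x' y - g z * (x' +i* y)%C)).
  apply/eqP; rewrite -subr_eq0; apply/eqP; rewrite -[RHS]E /w /z; ring.
apply: le_trans (normcD _ _) _.
apply: (@le_trans _ _ (2 * (e / 4) * `|x' - x| + 2 * (e / 4) * `|y' - y|)); last first.
  have := ler_wpM2l (ltW e4) nx; have := ler_wpM2l (ltW e4) ny; lra.
have dlin (v : R[i]) : cderiv (fun v => g z * v) v (g z).
  by apply: cderiv_eq (cderivM (cderiv_cst (g z) v) (cderiv_id v)) _; rewrite mul0r add0r mulr1.
have nearx t := @between_abs s x x' t (ltW xs) x's.
have neary t := @between_abs s y y' t (ltW ys) y's.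
apply: lerD.
  apply: (@curve_mean_value _ (fun t => H y t - g z * (t +i* y)%C) (fun t => g (t +i* y)%C - g z)) => t /nearx[ts tx].
  split; last first.
    apply/ltW/Hd; apply: le_lt_trans (normc_leD _) _; rewrite /= subrr normr0 addr0; lra.
  apply: curve_derivB; first exact: hH.
  rewrite -[X in curve_deriv _ _ X]mulr1.
  exact: (curve_deriv_comp (dlin _) (curve_deriv_hor _ _)).
apply: (@curve_mean_value _ (fun t => V x' t - g z * (x' +i* t)%C) (fun t => (g (x' +i* t)%C - g z) * 'i%C)) => t /neary[ts tx].
split; last first.
  rewrite normcMl /= expr0n expr1n add0r sqrtr1 mulr1.
  apply/ltW/Hd; apply: le_lt_trans (normc_leD _) _; rewrite /=; lra.
rewrite mulrBl; apply: curve_derivB; first exact: hV.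
exact: (curve_deriv_comp (dlin _) (curve_deriv_ver _ _)).
Qed.

(** Clipped coordinates turn a function on a square into one that is continuous on
  every horizontal and vertical line, as its primitives along them require. *)
Definition clip s x := Num.max (- s) (Num.min x s).

Lemma clip_lip s x y : `|clip s y - clip s x| <= `|y - x|.
Proof.
have := ler_norm (y - x); have := ler_norm (- (y - x)); rewrite normrN.
move: `|y - x| => N n1 n2; rewrite /clip ler_norml.
have [y1|y1] := leP y s; have [x1|x1] := leP x s;
  (have [y2|y2] := leP (- s) y; have [x2|x2] := leP (- s) x);
  rewrite ?maxEle ?y2 ?x2; repeat case: ifP => //; move=> *; apply/andP; split; lra.
Qed.

Lemma clip_id s x : `|x| <= s -> clip s x = x.
Proof.
by rewrite ler_norml /clip => /andP[x1 x2]; rewrite (min_idPl x2) (max_idPr x1).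
Qed.

Lemma clip_le s x : 0 <= s -> `|clip s x| <= s.
Proof.
by move=> s0; rewrite ler_norml /clip le_max lexx /= ge_max ge_min lexx orbT andbT; lra.
Qed.

Lemma local_primitive g z0 rho : 0 < rho ->
  (forall w, normc (w - z0) < rho -> cdiff g w) ->
  exists F, exists2 r, 0 < r & forall w, normc (w - z0) < r -> cderiv F w (g w).
Proof.
move=> rho0 Hg; set s := rho / 3.
have s0 : 0 < s by rewrite divr_gt0.
have s3 : 3 * s = rho by rewrite /s; field.
pose h z := g (z0 + 1 * z).
have Hh z : normc z < rho -> cdiff h z.
  move=> zr; have [|d hd] := Hg (z0 + 1 * z); first by rewrite addrC addKr mul1r.
  by exists (1 * d); exact: cderiv_affine.
pose k (z : R[i]) := h (clip s (complex.Re z) +i* clip s (complex.Im z))%C.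
have kh x y : `|x| <= s -> `|y| <= s -> k (x +i* y)%C = h (x +i* y)%C.
  by move=> xs ys; rewrite /k /= !clip_id.
have small x y : `|x| <= s -> `|y| <= s -> normc (x +i* y)%C < rho.
  by move=> xs ys; apply: le_lt_trans (normc_leD _) _; rewrite /= -s3; lra.
have hc x y : ccont h (clip s x +i* clip s y)%C.
  by apply: cdiff_cont; apply: Hh; apply: small; apply: clip_le; exact: ltW.
have s20 : 0 < s / 2 by rewrite divr_gt0.
have [|||F HF] := @square_primitive k (s / 2) s20.
- move=> y; apply: (curve_cont_comp (c := fun x => clip s x +i* clip s y)%C) => //.
  move=> x e e0; exists e => // x' xx; apply: le_lt_trans (normc_leD _) _.
  by rewrite /= subrr normr0 addr0; apply: le_lt_trans xx; exact: clip_lip.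
- move=> x; apply: (curve_cont_comp (c := fun y => clip s x +i* clip s y)%C) => //.
  move=> y e e0; exists e => // y' yy; apply: le_lt_trans (normc_leD _) _.
  by rewrite /= subrr normr0 add0r; apply: le_lt_trans yy; exact: clip_lip.
- move=> x y xs ys; apply: (@near_cdiff _ h).
    by apply/Hh/small; lra.
  exists (s / 2) => // -[x' y'] wz; rewrite kh //.
    have -> : x' = x + (x' - x) by ring.
    have hh : `|x' - x| <= normc ((x' +i* y')%C - (x +i* y)%C) := normc_Re ((x' +i* y')%C - (x +i* y)%C).
    by apply: le_trans (ler_normD _ _) _; lra.
  have -> : y' = y + (y' - y) by ring.
  have hh : `|y' - y| <= normc ((x' +i* y')%C - (x +i* y)%C) := normc_Im ((x' +i* y')%C - (x +i* y)%C).
  by apply: le_trans (ler_normD _ _) _; lra.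
exists (fun w => F (- z0 + 1 * w)); exists (s / 2); [exact: s20|move=> w wz].
have [x [y E]] : exists x y, - z0 + 1 * w = (x +i* y)%C.
  by case: (- z0 + 1 * w) => x y; exists x, y.
have wE : w - z0 = (x +i* y)%C by rewrite -E mul1r addrC.
have xs : `|x| < s / 2 by apply: le_lt_trans wz; rewrite wE; exact: (normc_Re (x +i* y)%C).
have ys : `|y| < s / 2 by apply: le_lt_trans wz; rewrite wE; exact: (normc_Im (x +i* y)%C).
have h1 : cderiv F (- z0 + 1 * w) (g w).
  rewrite E; apply: cderiv_eq (HF x y xs ys) _; rewrite kh; [|lra|lra].
  by rewrite /h -E !mul1r addrA subrr add0r.
by apply: cderiv_eq (cderiv_affine h1) _; rewrite mul1r.
Qed.

End Goursat.

(** * Integrals along circles *)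

Section CircleIntegral.
Variable R : realType.
Implicit Types (x y r t l u v M : R) (f g : R -> R) (c : R -> R[i]).

Definition period_integral f := \int[@lebesgue_measure R]_(t in `[0, 2 * pi]) f t.

Definition cintegral c : R[i] :=
  (period_integral (fun t => complex.Re (c t)) +i*
   period_integral (fun t => complex.Im (c t)))%C.

Definition circle r x : R[i] := Complex (r * cos x) (r * sin x).

Let mI : measurable (`[0, 2 * pi]%classic : set (measurableTypeR R)). Proof. by []. Qed.

Lemma continuous_integrable f : continuous f ->
  lebesgue_measure.-integrable `[0, 2 * pi] (EFin \o f).
Proof.
move=> cf; apply: continuous_compact_integrable; first exact: segment_compact.
exact: continuous_subspaceT.
Qed.

Lemma twopi_gt0 : 0 < 2 * pi :> R.
Proof. by rewrite mulr_gt0 // pi_gt0. Qed.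

Lemma period_integralD f g : continuous f -> continuous g ->
  period_integral (fun t => f t + g t) = period_integral f + period_integral g.
Proof. by move=> cf cg; apply: RintegralD => //; exact: continuous_integrable. Qed.

Lemma period_integralB f g : continuous f -> continuous g ->
  period_integral (fun t => f t - g t) = period_integral f - period_integral g.
Proof. by move=> cf cg; apply: RintegralB => //; exact: continuous_integrable. Qed.

Lemma period_integralZ a f : continuous f ->
  period_integral (fun t => a * f t) = a * period_integral f.
Proof. by move=> cf; apply: RintegralZl => //; exact: continuous_integrable. Qed.

Lemma period_integral_cst a : period_integral (fun=> a) = 2 * pi * a.
Proof.
rewrite /period_integral Rintegral_cst // mulrC; congr (_ * _).
have := @lebesgue_measure_itv R `[0, 2 * pi]; rewrite /= lte_fin twopi_gt0 => E.
by rewrite [X in fine X]E -EFinB subr0.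
Qed.

Lemma period_integral_le f g : continuous f -> continuous g ->
  (forall t, f t <= g t) -> period_integral f <= period_integral g.
Proof.
by move=> cf cg fg; apply: le_Rintegral => //; exact: continuous_integrable.
Qed.

Lemma period_integral_deriv f (df : R -> R) : continuous df ->
  (forall t, is_derive t 1 f (df t)) -> f (2 * pi) = f 0 -> period_integral df = 0.
Proof.
move=> cdf hf per.
have cf : continuous f.
  by move=> t; apply/differentiable_continuous/derivable1_diffP; case: (hf t).
rewrite /period_integral /Rintegral (@continuous_FTC2 _ df f) ?twopi_gt0 //.
- by rewrite per -EFinB subrr.
- exact: continuous_subspaceT.
- split.
  + by move=> t _; case: (hf t).
  + exact: cvg_at_right_filter (cf 0).
  + exact: cvg_at_left_filter (cf _).
- by move=> t _; rewrite derive1E; case: (hf t).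
Qed.

Lemma period_integral_param (phi D : R -> R -> R) (u v M : R) :
  (forall l, u < l < v -> continuous (phi l)) ->
  (forall l t, u < l < v -> is_derive l 1 (phi ^~ t) (D l t)) ->
  (forall l t, u < l < v -> `|D l t| <= M) ->
  forall l, u < l < v ->
  is_derive l 1 (fun l => period_integral (phi l)) (period_integral (D l)).
Proof.
move=> cphi dphi bD l ul.
have M0 : 0 <= M by apply: le_trans (bD l 0 ul).
have Il : `]u, v[%classic l by rewrite /= in_itv.
have i1 x : `]u, v[%classic x -> lebesgue_measure.-integrable `[0, 2 * pi] (EFin \o phi x).
  by rewrite /= in_itv => /= ux; exact/continuous_integrable/cphi.
have i2 x y : `]u, v[%classic x -> `[0, 2 * pi]%classic y -> derivable (phi ^~ y) x 1.
  by rewrite /= in_itv => /= ux _; case: (dphi x y ux).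
have i3 : lebesgue_measure.-integrable `[0, 2 * pi] (EFin \o (fun _ : measurableTypeR R => M)).
  by apply: continuous_integrable => ?; exact: cvg_cst.
have i4 x y : `]u, v[%classic x -> `[0, 2 * pi]%classic y -> `|partial1of2 phi x y| <= M.
  rewrite /= in_itv => /= ux _; rewrite partial1of2E; case: (dphi x y ux) => _ ->.
  exact: bD.
have h1 := @derivable_under_integral R _ (measurableTypeR R) lebesgue_measure phi _ mI
  l u v Il i1 i2 (fun=> M) (fun=> M0) i3 i4.
have h2 := @differentiation_under_integral R _ (measurableTypeR R) lebesgue_measure phi _ mI
  l u v Il i1 i2 (fun=> M) (fun=> M0) i3 i4.
split; first exact: h1.
rewrite -derive1E /period_integral [LHS]h2; apply: eq_Rintegral => t _.
by rewrite partial1of2E; case: (dphi l t ul).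
Qed.

Lemma period_integral_param_cst (phi D : R -> R -> R) (u v M : R) :
  (forall l, u < l < v -> continuous (phi l)) ->
  (forall l t, u < l < v -> is_derive l 1 (phi ^~ t) (D l t)) ->
  (forall l t, u < l < v -> `|D l t| <= M) ->
  (forall l, u < l < v -> period_integral (D l) = 0) ->
  forall a b, u < a < v -> u < b < v ->
    period_integral (phi b) = period_integral (phi a).
Proof.
move=> h1 h2 h3 h4 a b /andP[ua av] /andP[ub bv]; apply/eqP; rewrite -subr_eq0 -normr_eq0.
rewrite eq_le normr_ge0 andbT -(mul0r `|b - a|).
apply: (real_mean_value (f := fun l => period_integral (phi l)) (df := fun=> 0)) => x.
rewrite ge_min le_max => xab.
have ux : u < x < v by move: xab => /andP[/orP[?|?] /orP[?|?]]; apply/andP; split; lra.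
by rewrite normr0; split => //; rewrite -(h4 _ ux); exact: period_integral_param h1 h2 h3 _ ux.
Qed.

Lemma curve_contD c d : curve_cont c -> curve_cont d -> curve_cont (fun t => c t + d t).
Proof.
move=> hc hd x e e0; have e2 : 0 < e / 2 by rewrite divr_gt0.
have [d1 d10 h1] := hc x _ e2; have [d2 d20 h2] := hd x _ e2.
exists (Num.min d1 d2) => [|y]; first by rewrite lt_min d10.
rewrite lt_min => /andP[/h1 k1 /h2 k2].
have -> : c y + d y - (c x + d x) = (c y - c x) + (d y - d x) by ring.
by apply: le_lt_trans (normcD _ _) _; lra.
Qed.

Lemma curve_contM c d : curve_cont c -> curve_cont d -> curve_cont (fun t => c t * d t).
Proof.
move=> hc hd x e e0.
set K := 1 + normc (c x) + normc (d x).
have nc := normc_ge0 (c x); have nd := normc_ge0 (d x).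
have K0 : 0 < K by rewrite /K; lra.
have e2 : 0 < Num.min 1 (e / (2 * K)) by rewrite lt_min ltr01 divr_gt0 // mulr_gt0.
have [d1 d10 h1] := hc x _ e2; have [d2 d20 h2] := hd x _ e2.
exists (Num.min d1 d2) => [|y]; first by rewrite lt_min d10.
rewrite lt_min => /andP[/h1 + /h2 +]; rewrite !lt_min => /andP[k1 k2] /andP[l1 l2].
have -> : c y * d y - c x * d x = (c y - c x) * (d x + (d y - d x)) + c x * (d y - d x) by ring.
apply: le_lt_trans (normcD _ _) _; rewrite !normcMl.
have h3 : normc (d x + (d y - d x)) <= K by apply: le_trans (normcD _ _) _; rewrite /K; lra.
have eK : e / (2 * K) * K = e / 2 by field; exact: lt0r_neq0.
have eK0 : 0 <= e / (2 * K) by rewrite divr_ge0 // ltW // mulr_gt0.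
have h4 : normc (c y - c x) * normc (d x + (d y - d x)) <= e / (2 * K) * K.
  by apply: ler_pM => //; rewrite ?normc_ge0 // ltW.
have h5 : normc (c x) * normc (d y - d x) <= normc (c x) * (e / (2 * K)).
  by apply: ler_wpM2l => //; exact: ltW.
have h6 : normc (c x) * (e / (2 * K)) < K * (e / (2 * K)).
  by rewrite ltr_pM2r ?divr_gt0 ?mulr_gt0 // /K; lra.
by rewrite mulrC in h6; rewrite [K * _]mulrC eK in h6; lra.
Qed.

Lemma curve_cont_cst (a : R[i]) : curve_cont (fun=> a).
Proof. by move=> x e e0; exists 1 => // y _; rewrite subrr normc00. Qed.

Lemma curve_cont_deriv c (dc : R -> R[i]) : (forall t, curve_deriv c t (dc t)) -> curve_cont c.
Proof.
move=> h x e e0; have /curve_derivP/(_ _ ltr01)[d d0 Hd] := h x.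
set K := 1 + normc (dc x); have K0 : 0 < K by rewrite ltr_pwDl // normc_ge0.
exists (Num.min d (e / K)) => [|y]; first by rewrite lt_min d0 divr_gt0.
rewrite lt_min => /andP[/Hd k1 k2].
apply: le_lt_trans (normc_dist_le _ (dc x * (y - x)%:C%C)) _.
rewrite normcMl normc_real; apply: le_lt_trans (lerD (lexx _) k1) _.
by rewrite -mulrDl addrC mulrC -ltr_pdivlMr.
Qed.

Lemma eq_period_integral f g : (forall t, f t = g t) -> period_integral f = period_integral g.
Proof. by move=> /funext ->. Qed.

Lemma cintegralD c d : curve_cont c -> curve_cont d ->
  cintegral (fun t => c t + d t) = cintegral c + cintegral d.
Proof.
move=> hc hd; rewrite /cintegral /= /GRing.add /=; congr Complex.
  rewrite -period_integralD; try exact: curve_cont_Re.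
  by apply: eq_period_integral => t; case: (c t); case: (d t).
rewrite -period_integralD; try exact: curve_cont_Im.
by apply: eq_period_integral => t; case: (c t); case: (d t).
Qed.

Lemma cintegralZ (a : R[i]) c : curve_cont c ->
  cintegral (fun t => a * c t) = a * cintegral c.
Proof.
move=> hc; case: a => a b; rewrite /cintegral /= /GRing.mul /=.
have c1 := curve_cont_Re hc; have c2 := curve_cont_Im hc.
have cZ k (f : R -> R) : continuous f -> continuous (fun t => k * f t).
  by move=> cf x; apply: cvgM; [exact: cvg_cst|exact: cf].
congr Complex.
  rewrite -!period_integralZ // -period_integralB; try exact: cZ.
  by apply: eq_period_integral => t; case: (c t).
rewrite -!period_integralZ // -period_integralD; try exact: cZ.
by apply: eq_period_integral => t; case: (c t).
Qed.

Lemma cintegralB c d : curve_cont c -> curve_cont d ->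
  cintegral (fun t => c t - d t) = cintegral c - cintegral d.
Proof.
move=> hc hd; have hd' : curve_cont (fun t => -1 * d t).
  by apply: curve_contM => //; exact: curve_cont_cst.
rewrite -[in RHS]mulN1r -cintegralZ // -cintegralD //.
by congr cintegral; apply/funext => t; rewrite mulN1r.
Qed.

Lemma cintegral_cst (a : R[i]) : cintegral (fun=> a) = (2 * pi)%:C%C * a.
Proof.
case: a => a b; rewrite /cintegral /= !period_integral_cst /GRing.mul /=.
by rewrite !mul0r subr0 addr0.
Qed.

(** Multiplication by a unimodular constant makes the integral real and
  nonnegative, which leaves a comparison of real integrals. *)
Lemma cintegral_norm c M : curve_cont c -> (forall t, normc (c t) <= M) ->
  normc (cintegral c) <= 2 * pi * M.
Proof.
move=> hc hM; have M0 : 0 <= M by apply: le_trans (hM 0); exact: normc_ge0.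
have [->|I0] := eqVneq (cintegral c) 0.
  by rewrite normc00 mulr_ge0 // ltW // twopi_gt0.
have [u [nu uI]] : exists u : R[i], normc u = 1 /\ u * cintegral c = (normc (cintegral c))%:C%C.
  exists ((normc (cintegral c))%:C%C / cintegral c); rewrite divfK //; split => //.
  rewrite normcMl normc_real normcVl ger0_norm ?normc_ge0 // divff //.
  by rewrite normc_eq0.
have hu : curve_cont (fun t => u * c t) by apply: curve_contM => //; exact: curve_cont_cst.
have -> : normc (cintegral c) = complex.Re (cintegral (fun t => u * c t)).
  by rewrite cintegralZ // uI.
rewrite [leLHS]/= -period_integral_cst.
apply: period_integral_le; [exact: curve_cont_Re|by move=> ?; exact: cvg_cst|].
move=> t; apply: le_trans (ler_norm _) _; apply: le_trans (normc_Re _) _.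
by rewrite normcMl nu mul1r.
Qed.

Lemma cintegral_deriv c (dc : R -> R[i]) : curve_cont dc ->
  (forall t, curve_deriv c t (dc t)) -> c (2 * pi) = c 0 -> cintegral dc = 0.
Proof.
move=> cdc hc per; rewrite /cintegral; congr Complex.
  apply: (@period_integral_deriv (fun t => complex.Re (c t))).
  - exact: curve_cont_Re. - by move=> t; case: (hc t). - by rewrite per.
apply: (@period_integral_deriv (fun t => complex.Im (c t))).
- exact: curve_cont_Im. - by move=> t; case: (hc t). - by rewrite per.
Qed.

(** The form in which contours are deformed: in the applications [D l] is the
  derivative of a periodic function of the angle, so its integral vanishes. *)
Lemma cintegral_param_cst (phi D : R -> R -> R[i]) (u v M : R) :
  (forall l, u < l < v -> curve_cont (phi l)) ->
  (forall l t, u < l < v -> curve_deriv (phi ^~ t) l (D l t)) ->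
  (forall l t, u < l < v -> normc (D l t) <= M) ->
  (forall l, u < l < v -> cintegral (D l) = 0) ->
  forall a b, u < a < v -> u < b < v -> cintegral (phi b) = cintegral (phi a).
Proof.
move=> h1 h2 h3 h4 a b ha hb; rewrite /cintegral; congr Complex.
  apply: (@period_integral_param_cst (fun l t => complex.Re (phi l t))
    (fun l t => complex.Re (D l t)) u v M) => //.
  - by move=> l /h1/curve_cont_Re.
  - by move=> l t /(h2 _ t)[].
  - by move=> l t /(h3 _ t); apply: le_trans; exact: normc_Re.
  - by move=> l /h4 [].
apply: (@period_integral_param_cst (fun l t => complex.Im (phi l t))
  (fun l t => complex.Im (D l t)) u v M) => //.
- by move=> l /h1/curve_cont_Im.
- by move=> l t /(h2 _ t)[].
- by move=> l t /(h3 _ t); apply: le_trans; exact: normc_Im.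
- by move=> l /h4 [].
Qed.

Lemma circle_deriv r t : curve_deriv (circle r) t ('i%C * circle r t).
Proof.
have cst0 (k x : R) : is_derive x 1 (cst k) 0 by exact: is_derive_cst.
split; rewrite /circle /=.
  apply: is_derive_eq (is_deriveM (cst0 r t) (is_derive_cos t)) _.
  by rewrite /GRing.scale /=; ring.
apply: is_derive_eq (is_deriveM (cst0 r t) (is_derive_sin t)) _.
by rewrite /GRing.scale /=; ring.
Qed.

Lemma circle_cont r : curve_cont (circle r).
Proof. exact: curve_cont_deriv (circle_deriv r). Qed.

Lemma normc_circle r t : 0 <= r -> normc (circle r t) = r.
Proof.
by move=> r0; rewrite /= !exprMn -mulrDr cos2Dsin2 mulr1 sqrtr_sqr ger0_norm.
Qed.

Lemma circle_period r : circle r (2 * pi) = circle r 0.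
Proof. by rewrite /circle mulr_natl cos2pi sin2pi cos0 sin0. Qed.

End CircleIntegral.

(** * Cauchy's formula for continuously differentiable functions *)

Section Cauchy.
Variable R : realType.
Implicit Types (r t l M : R) (z w : R[i]) (g F : R[i] -> R[i]).

(** Compactness of the disc as an induction principle, obtained by bisection of a
  square around it. *)
Lemma disc_induction (Q : set R[i] -> Prop) r :
  Q set0 -> (forall A B, Q A -> Q B -> Q (A `|` B)) ->
  (forall A B, A `<=` B -> Q B -> Q A) ->
  (forall p, normc p <= r -> exists2 d, 0 < d & Q [set w | normc (w - p) < d]) ->
  Q [set w | normc w <= r].
Proof.
move=> Q0 QU Qs Qloc; have [r0|r0] := leP 0 r; last first.
  by apply: Qs Q0 => w /= wr; have := normc_ge0 w; lra.
pose S (x y w h : R) := [set z : R[i] | [/\ normc z <= r, x <= complex.Re z <= x + w & y <= complex.Im z <= y + h]].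
apply: (Qs _ (S (- r) (- r) (2 * r) (2 * r))).
  move=> z /= zr; split => //.
    by have := normc_Re z; rewrite ler_norml => /andP[? ?]; apply/andP; split; lra.
  by have := normc_Im z; rewrite ler_norml => /andP[? ?]; apply/andP; split; lra.
apply: (@bisection R (fun x y w h : R => Q (S x y w h))); [lra|lra| |].
  move=> x y a b q1 q2 q3 q4.
  apply: Qs (QU _ _ (QU _ _ q1 q2) (QU _ _ q3 q4)) => z [zr /andP[x1 x2] /andP[y1 y2]].
  have [hx|hx] := leP (complex.Re z) (x + a / 2); have [hy|hy] := leP (complex.Im z) (y + b / 2).
  - by left; left; split => //; apply/andP; split; lra.
  - by right; left; split => //; apply/andP; split; lra.
  - by left; right; split => //; apply/andP; split; lra.
  - by right; right; split => //; apply/andP; split; lra.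
move=> p q _ _; have [pr|pr] := leP (normc (p +i* q)%C) r.
  have [d d0 Qd] := Qloc _ pr; exists (d / 2); first by rewrite divr_gt0.
  move=> x y w h /andP[w0 wd] /andP[h0 hd] _ _ _ _ /andP[xp px] /andP[yq qy].
  apply: Qs Qd => -[a b] [_ /= /andP[a1 a2] /andP[b1 b2]].
  change (normc ((a +i* b)%C - (p +i* q)%C) < d).
  apply: le_lt_trans (normc_leD _) _; rewrite /=.
  have : `|a - p| <= w by rewrite ler_norml; apply/andP; split; lra.
  have : `|b - q| <= h by rewrite ler_norml; apply/andP; split; lra.
  lra.
exists ((normc (p +i* q)%C - r) / 2); first by rewrite divr_gt0 // subr_gt0.
move=> x y w h /andP[w0 wd] /andP[h0 hd] _ _ _ _ /andP[xp px] /andP[yq qy].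
apply: Qs Q0 => -[a b] [abr]; rewrite [complex.Re _]/= [complex.Im _]/= => /andP[a1 a2] /andP[b1 b2].
have h1 : `|p - a| <= w by rewrite ler_norml; apply/andP; split; lra.
have h2 : `|q - b| <= h by rewrite ler_norml; apply/andP; split; lra.
have := normc_dist_le (p +i* q)%C (a +i* b)%C.
have h3 : normc ((p +i* q)%C - (a +i* b)%C) <= `|p - a| + `|q - b| := normc_leD ((p +i* q)%C - (a +i* b)%C).
lra.
Qed.

Lemma disc_bounded g r : (forall z, normc z <= r -> ccont g z) ->
  exists2 M, 0 < M & forall z, normc z <= r -> normc (g z) <= M.
Proof.
move=> cg.
apply: (@disc_induction (fun A => exists2 M : R, 0 < M & forall z, A z -> normc (g z) <= M) r).
- by exists 1.
- move=> A B [M M0 hM] [N N0 hN]; exists (M + N); first exact: addr_gt0.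
  by move=> z [/hM|/hN]; lra.
- by move=> A B AB [M M0 hM]; exists M => // z /AB/hM.
- move=> p pr; have [d d0 hd] := cg p pr 1 ltr01; exists d => //.
  exists (normc (g p) + 1); first by rewrite ltr_pwDr // normc_ge0.
  move=> z /= /hd h; have := normc_dist_le (g z) (g p); lra.
Qed.

Lemma circle_comp_cont g r : (forall t, cdiff g (circle r t)) -> curve_cont (fun t => g (circle r t)).
Proof. by move=> h; apply: curve_cont_comp (circle_cont r) _ => t; exact: cdiff_cont. Qed.

Lemma curve_deriv_line (a b : R[i]) l : curve_deriv (fun l => a + l%:C%C * b) l b.
Proof.
apply/curve_derivP => e e0; exists 1 => // y _.
have -> : a + y%:C%C * b - (a + l%:C%C * b) - b * (y - l)%:C%C = 0 by rewrite rmorphB /=; ring.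
by rewrite normc00 mulr_ge0 // ltW.
Qed.

Lemma cderiv_homothety g z (b w d : R[i]) : cderiv g (z + b * (w - z)) d ->
  cderiv (fun w => g (z + b * (w - z))) w (b * d).
Proof.
have E v : z + b * (v - z) = (z - b * z) + b * v by ring.
by rewrite E => /cderiv_affine; rewrite (_ : (fun w => g (z + b * (w - z))) = (fun w => g (z - b * z + b * w))) //; apply/funext => v; rewrite E.
Qed.

Lemma circle_sub_neq0 r z w t : normc z < r -> normc w <= normc z -> circle r t - w != 0.
Proof.
move=> zr wz; rewrite -normc_gt0; apply: lt_le_trans (normc_dist_ge _ _).
by rewrite normc_circle ?subr_gt0; [lra|have := normc_ge0 z; lra].
Qed.

Lemma normc_scale (l : R) z : normc (l%:C%C * z) = `|l| * normc z.
Proof. by rewrite normcMl normc_real. Qed.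

Lemma cderiv_inv_sub (a w : R[i]) : w - a != 0 ->
  cderiv (fun w => (w - a)^-1) w (- 1 / (w - a) ^+ 2).
Proof.
move=> wa; have h1 := cderivB (cderiv_id w) (cderiv_cst a w).
by apply: cderiv_eq (cderivV (g := fun w => w - a) wa h1) _; rewrite subr0.
Qed.

(** With [l * z] in place of z the integral does not depend on l in [0, 1], and at
  l = 0 the integrand is 1. *)
Lemma cauchy_kernel r z : normc z < r ->
  cintegral (fun t => circle r t / (circle r t - z)) = (2 * pi)%:C%C.
Proof.
move=> zr; have z0 := normc_ge0 z.
(* a margin around [0, 1] for the parameter l, small enough that [l * z] stays inside *)
pose eta := (r - normc z) / (2 * (normc z + 1)).
have eta0 : 0 < eta by rewrite divr_gt0 ?subr_gt0 // mulr_gt0 // ltr_wpDl.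
have etaz : eta * normc z <= (r - normc z) / 2.
  have -> : (r - normc z) / 2 = eta * (normc z + 1) by rewrite /eta; field; apply: lt0r_neq0; lra.
  by apply: ler_wpM2l; lra.
have r0 : 0 < r by lra.
pose c := (r - normc z) / 2; have c0 : 0 < c by rewrite divr_gt0 ?subr_gt0.
have lz l : - eta < l < 1 + eta -> normc (l%:C%C * z) <= r - c.
  move=> /andP[l1 l2]; rewrite normc_scale.
  apply: (@le_trans _ _ ((1 + eta) * normc z)).
    by apply: ler_wpM2r => //; rewrite ler_norml; apply/andP; split; lra.
  by rewrite mulrDl mul1r; rewrite /c; lra.
have dlow l t : - eta < l < 1 + eta -> c <= normc (circle r t - l%:C%C * z).
  move=> /lz h; apply: le_trans (normc_dist_ge _ _); rewrite normc_circle //; lra.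
have dn0 l t : - eta < l < 1 + eta -> circle r t - l%:C%C * z != 0.
  by move=> /(dlow _ t) h; rewrite -normc_gt0; apply: lt_le_trans h.
pose phi l t := circle r t / (circle r t - l%:C%C * z).
pose D l t := circle r t * z / (circle r t - l%:C%C * z) ^+ 2.
have := @cintegral_param_cst _ phi D (- eta) (1 + eta) (r * normc z / c ^+ 2).
move=> /(_ _ _ _ _ 0 1) H.
have -> : cintegral (fun t => circle r t / (circle r t - z)) = cintegral (phi 1).
  by congr cintegral; apply/funext => t; rewrite /phi mul1r.
rewrite H; first last.
- by apply/andP; split; lra.
- by apply/andP; split; lra.
- move=> l ll; pose G w := 'i%C * z / (w - l%:C%C * z).
  have dG t : cderiv G (circle r t) ('i%C * (- z) / (circle r t - l%:C%C * z) ^+ 2).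
    apply: cderiv_eq (cderivM (cderiv_cst ('i%C * z) _) (cderiv_inv_sub (dn0 l t ll))) _.
    by have dn := dn0 l t ll; field.
  apply: (@cintegral_deriv _ (fun t => G (circle r t))).
  + apply: (@circle_comp_cont (fun w => w * z / (w - l%:C%C * z) ^+ 2)) => t.
    apply: cdiffM; first by apply: cdiffM; [exact: cdiff_id|exact: cdiff_cst].
    apply: cdiffV; first by rewrite expf_neq0 // dn0.
    by apply: cdiffX; exact: cdiff_sub.
  + move=> t; have := curve_deriv_comp (dG t) (circle_deriv r t).
    have ii : ('i%C * 'i%C : R[i]) = -1 by rewrite -expr2 sqr_i.
    rewrite (_ : _ * ('i%C * _) = D l t) // /D.
    have dn := dn0 l t ll.
    rewrite (_ : _ * _ = ('i%C * 'i%C) * (- z * circle r t) / (circle r t - l%:C%C * z) ^+ 2); last by field.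
    by rewrite ii; field.
  + by rewrite circle_period.
- move=> l t ll; rewrite /D normcMl normcVl normcX normcMl normc_circle ?(ltW r0) //.
  apply: ler_wpM2l; first by rewrite mulr_ge0 // ltW.
  rewrite lef_pV2 ?posrE ?exprn_gt0 //; last by rewrite normc_gt0 dn0.
  by rewrite lerXn2r ?nnegrE ?normc_ge0 ?(ltW c0) //; exact: dlow.
- move=> l t ll.
  have h1 : curve_deriv (fun l => circle r t + l%:C%C * (- z)) l (- z) := curve_deriv_line _ _ _.
  have E : (fun l => circle r t + l%:C%C * (- z)) = (fun l => circle r t - l%:C%C * z).
    by apply/funext => l'; rewrite mulrN.
  rewrite E in h1.
  have h2 := cderivM (cderiv_cst (circle r t) (circle r t - l%:C%C * z)) (cderivV (g := id) (dn0 l t ll) (cderiv_id _)).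
  have := curve_deriv_comp h2 h1; rewrite (_ : _ * - z = D l t) //.
  by rewrite /D; have dn := dn0 l t ll; field.
- move=> l ll; apply: (@circle_comp_cont (fun w => w / (w - l%:C%C * z))) => t.
  apply: cdiffM; first exact: cdiff_id.
  apply: cdiffV; first exact: dn0.
  exact: cdiff_sub.
have -> : phi 0 = (fun=> 1).
  apply/funext => t; rewrite /phi mul0r subr0 divff //.
  by rewrite -normc_gt0 normc_circle ?(ltW r0).
by rewrite cintegral_cst mulr1.
Qed.

(** The homothety of centre z and ratio l is allowed to leave [0, 1] slightly, so
  that integrals that depend on l have derivatives at l = 0 and at l = 1. *)
Lemma radial_segment r rho z : normc z < r -> r < rho ->
  exists eta rho1 r' : R, [/\ 0 < eta, r < rho1 < rho, r' < rho &
    forall l w, - eta < l < 1 + eta -> normc w < rho1 ->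
      normc (z + l%:C%C * (w - z)) <= r'].
Proof.
move=> zr rrho; have z0 := normc_ge0 z; have r0 : 0 < r by lra.
pose rho1 := (r + rho) / 2; pose r' := (rho1 + rho) / 2.
have r10 : 0 < rho1 by rewrite /rho1; lra.
pose eta := (r' - rho1) / (2 * rho1).
have eta0 : 0 < eta by rewrite divr_gt0 ?mulr_gt0 // /r' /rho1; lra.
have etar : 2 * eta * rho1 = r' - rho1 by rewrite /eta; field; exact: lt0r_neq0.
exists eta, rho1, r'; split => //; [by rewrite /rho1; apply/andP; split; lra|by rewrite /r' /rho1; lra|].
move=> l w /andP[l1 l2] wr.
have -> : z + l%:C%C * (w - z) = (1 - l)%:C%C * z + l%:C%C * w by rewrite rmorphB /=; ring.
apply: le_trans (normcD _ _) _; rewrite !normc_scale.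
apply: (@le_trans _ _ ((`|1 - l| + `|l|) * rho1)).
  rewrite mulrDl; apply: lerD; apply: ler_wpM2l => //; last exact: ltW.
  by apply: (le_trans (ltW zr)); rewrite /rho1; lra.
have -> : r' = (1 + 2 * eta) * rho1 by rewrite mulrDl mul1r etar; ring.
apply: ler_wpM2r; first exact: ltW.
by have [h|h] := leP 0 l; have [k|k] := leP 0 (1 - l);
   rewrite ?(ger0_norm h) ?(ltr0_norm h) ?(ger0_norm k) ?(ltr0_norm k); lra.
Qed.

(** Shrink the circle to z by homotheties.  The derivative in l of
  [F (z + l * (w - z)) / (w - z)] is [g (z + l * (w - z))], whose integral over the
  circle vanishes because it has the primitive [F (z + l * (w - z)) / l].  So the
  integral at l = 1 equals the one at l = 0, where F is replaced by its value at z.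
  Continuity of the derivative is used to differentiate under the integral. *)
Lemma cauchy_C1 F g rho : (forall w, normc w < rho -> cderiv F w (g w)) ->
  (forall w, normc w < rho -> ccont g w) -> forall r z, normc z < r -> r < rho ->
  cintegral (fun t => F (circle r t) * (circle r t / (circle r t - z))) = (2 * pi)%:C%C * F z.
Proof.
move=> HF cg r z zr rrho; have z0 := normc_ge0 z.
have r0 : 0 < r by lra.
have [eta [rho1 [r' [eta0 /andP[rr1 _] r'rho seg]]]] := radial_segment zr rrho.
have inr' l t : - eta < l < 1 + eta -> normc (z + l%:C%C * (circle r t - z)) <= r'.
  by move=> ll; apply: seg => //; rewrite normc_circle // ltW.
have inrho l t : - eta < l < 1 + eta -> normc (z + l%:C%C * (circle r t - z)) < rho.
  by move=> /(inr' _ t) h; apply: le_lt_trans h r'rho.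
have [M M0 HM] := @disc_bounded g r' (fun w h => cg w (le_lt_trans h r'rho)).
have dn t : circle r t - z != 0 by exact: circle_sub_neq0 zr _.
pose phi l t := F (z + l%:C%C * (circle r t - z)) * (circle r t / (circle r t - z)).
pose D l t := g (z + l%:C%C * (circle r t - z)) * circle r t.
have cD l : - eta < l < 1 + eta -> curve_cont (D l).
  move=> ll; apply: curve_contM (circle_cont r).
  apply: curve_cont_comp; last by move=> t; apply: cg; exact: inrho.
  apply: curve_contD; first exact: curve_cont_cst.
  apply: curve_contM; first exact: curve_cont_cst.
  by apply: curve_contD; [exact: circle_cont|exact: curve_cont_cst].
have dF l t : - eta < l < 1 + eta ->
    cderiv (fun w => F (z + l%:C%C * (w - z))) (circle r t) (l%:C%C * g (z + l%:C%C * (circle r t - z))).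
  by move=> ll; apply: cderiv_homothety; apply: HF; exact: inrho.
have cint0 : cintegral (circle r) = 0.
  have ii : ('i%C * 'i%C : R[i]) = -1 by rewrite -expr2 sqr_i.
  apply: (@cintegral_deriv _ (fun t => - 'i%C * circle r t)); first exact: circle_cont.
    move=> t; have h1 := cderivM (cderiv_cst (- 'i%C) (circle r t)) (cderiv_id (circle r t)).
    have := curve_deriv_comp h1 (circle_deriv r t); rewrite (_ : _ * ('i%C * _) = circle r t) //.
    rewrite (_ : _ * _ = - ('i%C * 'i%C) * circle r t); last by ring.
    by rewrite ii opprK mul1r.
  by rewrite circle_period.
have H := @cintegral_param_cst _ phi D (- eta) (1 + eta) (M * r) _ _ _ _ 0 1.
have -> : (fun t => F (circle r t) * (circle r t / (circle r t - z))) = phi 1.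
  by apply/funext => t; rewrite /phi mul1r subrKC.
rewrite H; first last.
- by apply/andP; split; lra.
- by apply/andP; split; lra.
- move=> l ll; have [l0|l0] := eqVneq l 0.
    have -> : D l = (fun t => g z * circle r t) by apply/funext => t; rewrite /D l0 mul0r addr0.
    by rewrite cintegralZ ?cint0 ?mulr0 //; exact: circle_cont.
  have lC : (l%:C%C : R[i]) * 'i%C != 0.
    by apply: mulf_neq0; rewrite eq_complex /= ?(negPf l0) ?oner_eq0 ?andbF.
  apply: (mulfI lC); rewrite mulr0 -cintegralZ; last exact: cD.
  apply: (@cintegral_deriv _ (fun t => F (z + l%:C%C * (circle r t - z)))).
  + by apply: curve_contM; [exact: curve_cont_cst|exact: cD].
  + move=> t; have := curve_deriv_comp (dF l t ll) (circle_deriv r t).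
    by rewrite (_ : _ * ('i%C * _) = l%:C%C * 'i%C * D l t) // /D; ring.
  + by rewrite circle_period.
- move=> l t ll; rewrite /D normcMl normc_circle ?(ltW r0) //.
  by apply: ler_wpM2r; [exact: ltW|apply: HM; exact: inr'].
- move=> l t ll.
  have h1 := curve_deriv_comp (HF _ (inrho l t ll)) (curve_deriv_line z (circle r t - z) l).
  pose k := circle r t / (circle r t - z).
  have h2 := cderivM (cderiv_id (F (z + l%:C%C * (circle r t - z)))) (cderiv_cst k _).
  have := curve_deriv_comp h2 h1; rewrite (_ : _ * (g _ * _) = D l t) //.
  by rewrite /D /k; have := dn t => dnt; field.
- move=> l ll; apply: (@circle_comp_cont (fun w => F (z + l%:C%C * (w - z)) * (w / (w - z)))) => t.
  apply: cdiffM; first by eexists; exact: dF.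
  apply: cdiffM; first exact: cdiff_id.
  apply: cdiffV; first exact: dn.
  exact: cdiff_sub.
have -> : phi 0 = (fun t => F z * (circle r t / (circle r t - z))).
  by apply/funext => t; rewrite /phi mul0r addr0.
rewrite cintegralZ ?cauchy_kernel // 1?mulrC //.
apply: (@circle_comp_cont (fun w => w / (w - z))) => t.
apply: cdiffM; first exact: cdiff_id.
apply: cdiffV; first exact: dn.
exact: cdiff_sub.
Qed.

End Cauchy.

(** * Derivatives of holomorphic functions *)

Section Holomorphic.
Variable R : realType.
Implicit Types (r t l M rho : R) (z w : R[i]) (g F : R[i] -> R[i]).

Definition cauchy_transform (phi : R -> R[i]) r n z :=
  cintegral (fun t => phi t * ((circle r t - z)^-1) ^+ n).

(** For [A = (c - z)^-1], [B = (c - w)^-1] and [h = w - z] this is the first order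
  expansion of [(c - w) ^- n] at z, with a remainder that is uniform in c. *)
Lemma inverse_power_expansion (K : R) n : 0 <= K -> exists2 C : R, 0 <= C &
  forall A B h : R[i], normc A <= K -> normc B <= K -> B - A = h * (A * B) ->
  normc (B ^+ n - A ^+ n - n%:R * h * A ^+ n.+1) <= C * normc h ^+ 2.
Proof.
move=> K0; elim: n => [|n [C C0 IH]].
  exists 0 => // A B h _ _ _.
  by rewrite !expr0 !mul0r subrr subr0 normc00.
exists (n.+1%:R * K ^+ n.+3 + K * C); first by apply: addr_ge0; apply: mulr_ge0 => //; exact: exprn_ge0.
move=> A B h nA nB E.
have -> : B ^+ n.+1 - A ^+ n.+1 - n.+1%:R * h * A ^+ n.+2 =
   n.+1%:R * (h ^+ 2 * (A ^+ n.+2 * B)) + B * (B ^+ n - A ^+ n - n%:R * h * A ^+ n.+1).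
  have EB : B = A + h * (A * B) by rewrite -E; ring.
  have -> : B ^+ n.+1 = B * B ^+ n by rewrite exprS.
  transitivity (n.+1%:R * h * A ^+ n.+1 * (B - A) + A ^+ n * (B - A - h * (A * B)) +
     B * (B ^+ n - A ^+ n - n%:R * h * A ^+ n.+1)); last first.
    by rewrite E !exprS; ring.
  by rewrite -natr1 !exprS; ring.
apply: le_trans (normcD _ _) _; rewrite mulrDl; apply: lerD.
  rewrite (normcMl _ (h ^+ 2 * _)) (normcMl (h ^+ 2)) (normcMl _ B) !normcX -mulrA.
  have -> : normc (n.+1%:R : R[i]) = n.+1%:R.
    have := normc_real (n.+1%:R : R); rewrite rmorph_nat => ->.
    by rewrite ger0_norm.
  rewrite [K ^+ _ * _]mulrC; apply: ler_wpM2l => //; apply: ler_wpM2l; first by rewrite exprn_ge0 // normc_ge0.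
  rewrite [leRHS]exprSr; apply: ler_pM; rewrite ?exprn_ge0 ?normc_ge0 //.
  by rewrite lerXn2r ?nnegrE ?normc_ge0.
rewrite (normcMl B) -[leRHS]mulrA; apply: ler_pM; rewrite ?normc_ge0 //; exact: IH.
Qed.

Lemma curve_contV (c : R -> R[i]) m : 0 < m -> (forall t, m <= normc (c t)) ->
  curve_cont c -> curve_cont (fun t => (c t)^-1).
Proof.
move=> m0 hm cc; apply: (@curve_cont_comp _ (fun w => w^-1)) => // t.
apply/cdiff_cont/cdiffV; last exact: cdiff_id.
by rewrite -normc_gt0; apply: lt_le_trans (hm t).
Qed.

Lemma curve_contX (c : R -> R[i]) n : curve_cont c -> curve_cont (fun t => c t ^+ n).
Proof.
move=> cc; apply: (@curve_cont_comp _ (fun w => w ^+ n)) => // t.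
by apply/cdiff_cont/cdiffX/cdiff_id.
Qed.

Lemma cauchy_transform_deriv phi M r n z : curve_cont phi -> (forall t, normc (phi t) <= M) ->
  normc z < r ->
  cderiv (cauchy_transform phi r n) z (n%:R * cauchy_transform phi r n.+1 z).
Proof.
move=> cphi HM zr; have z0 := normc_ge0 z; have r0 : 0 < r by lra.
have M0 : 0 <= M by apply: le_trans (HM 0); exact: normc_ge0.
pose c := (r - normc z) / 2; have c0 : 0 < c by rewrite divr_gt0 ?subr_gt0.
have low w t : normc (w - z) < c -> c <= normc (circle r t - w).
  move=> wz; apply: le_trans (normc_dist_ge _ _); rewrite normc_circle ?(ltW r0) //.
  have := normc_dist_le w z; rewrite /c in wz *; lra.
have lowz t : c <= normc (circle r t - z).
  by apply: low; rewrite subrr normc00.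
have Vlow w t : normc (w - z) < c -> normc (circle r t - w)^-1 <= c^-1.
  by move=> /(low _ t) h; rewrite normcVl lef_pV2 ?posrE //; exact: lt_le_trans h.
have cc w k : normc (w - z) < c -> curve_cont (fun t => phi t * ((circle r t - w)^-1) ^+ k).
  move=> wz; apply: curve_contM => //; apply: curve_contX.
  apply: (@curve_contV _ c) => //; first by move=> t; exact: low.
  apply: curve_contD; [exact: circle_cont|exact: curve_cont_cst].
have zz : normc (z - z) < c by rewrite subrr normc00.
have c10 : 0 <= c^-1 by rewrite invr_ge0 ltW.
have [C C0 HC] := @inverse_power_expansion c^-1 n c10.
apply/cderivP => e e0.
pose K := 2 * pi * (M * C) + 1.
have K0 : 0 < K by rewrite ltr_wpDl // mulr_ge0 ?(ltW (twopi_gt0 R)) // mulr_ge0.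
exists (Num.min c (e / K)); first by rewrite lt_min c0 divr_gt0.
move=> w.
rewrite lt_min => /andP[wc we].
pose rem t := phi t * (((circle r t - w)^-1) ^+ n - ((circle r t - z)^-1) ^+ n
      - n%:R * (w - z) * ((circle r t - z)^-1) ^+ n.+1).
have remE : rem = (fun t => (phi t * (circle r t - w)^-1 ^+ n + -1 * (phi t * ((circle r t - z)^-1) ^+ n))
      + - (n%:R * (w - z)) * (phi t * ((circle r t - z)^-1) ^+ n.+1)).
  by apply/funext => t; rewrite /rem; ring.
have c1 := cc w n wc; have c2 := cc z n zz; have c3 := cc z n.+1 zz.
have c2' := curve_contM (curve_cont_cst (-1)) c2.
have c3' := curve_contM (curve_cont_cst (- (n%:R * (w - z)))) c3.
have -> : cauchy_transform phi r n w - cauchy_transform phi r n z -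
     n%:R * cauchy_transform phi r n.+1 z * (w - z) = cintegral rem.
  rewrite remE (cintegralD (curve_contD c1 c2') c3') (cintegralD c1 c2').
  rewrite (cintegralZ _ c2) (cintegralZ _ c3).
  have idn (x y u k : R[i]) : x - y - n%:R * u * k = x + -1 * y + - (n%:R * k) * u by ring.
  exact: idn.
apply: le_trans (cintegral_norm (M := M * C * normc (w - z) ^+ 2) _ _) _.
- by rewrite remE; exact: curve_contD (curve_contD c1 c2') c3'.
- move=> t; rewrite /rem (normcMl (phi t)) -[leRHS]mulrA; apply: ler_pM; rewrite ?normc_ge0 //.
  apply: HC; [exact: Vlow|exact: Vlow|].
  have n1 : circle r t - w != 0 by rewrite -normc_gt0; apply: lt_le_trans (low w t wc).
  have n2 : circle r t - z != 0 by rewrite -normc_gt0; apply: lt_le_trans (lowz t).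
  by field; rewrite n1 n2.
rewrite expr2 !mulrA; apply: ler_wpM2r; first exact: normc_ge0.
apply: (@le_trans _ _ (K * normc (w - z))).
  by apply: ler_wpM2r; [exact: normc_ge0|rewrite /K -!mulrA lerDl].
by rewrite mulrC -ler_pdivlMr // ltW.
Qed.

Definition cder g z : R[i] := 'D_(1 : R[i]^o) (g : R[i]^o -> R[i]^o) z.

Lemma cder_val g z d : cderiv g z d -> cder g z = d.
Proof. by case. Qed.

Lemma cder_cderiv g z : cdiff g z -> cderiv g z (cder g z).
Proof. by move=> [d hd]; rewrite (cder_val hd). Qed.

Definition hol rho g := forall w, normc w < rho -> cdiff g w.

Lemma primitive_cauchy F g rho r z : (forall w, normc w < rho -> cderiv F w (g w)) ->
  (forall w, normc w < rho -> ccont g w) -> normc z < r -> r < rho ->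
  cauchy_transform (fun t => F (circle r t) * circle r t) r 1 z = (2 * pi)%:C%C * F z.
Proof.
move=> HF cg zr rrho; rewrite -(cauchy_C1 HF cg zr rrho).
by congr cintegral; apply/funext => t; rewrite expr1 mulrA.
Qed.

Lemma boundary_values g rho r : hol rho g -> 0 < r < rho ->
  curve_cont (fun t => g (circle r t) * circle r t) /\
  exists M, forall t, normc (g (circle r t) * circle r t) <= M.
Proof.
move=> hg /andP[r0 rrho]; split.
  apply: (@circle_comp_cont _ (fun w => g w * w)) => t.
  by apply: cdiffM; [apply: hg; rewrite normc_circle ?ltW|exact: cdiff_id].
have [M M0 HM] := @disc_bounded _ g r (fun w h => cdiff_cont (hg w (le_lt_trans h rrho))).
exists (M * r) => t; rewrite normcMl normc_circle ?(ltW r0) //.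
by apply: ler_wpM2r; [exact: ltW|apply: HM; rewrite normc_circle ?(ltW r0)].
Qed.

Let twopi_neq0 : ((2 * pi)%:C%C : R[i]) != 0.
Proof. by rewrite eq_complex /= eqxx andbT gt_eqF // twopi_gt0. Qed.

(** On a smaller disc F is a Cauchy transform of its boundary values, hence so are
  its first two derivatives. *)
Lemma derivative_local F g rho : 0 < rho -> (forall w, normc w < rho -> cderiv F w (g w)) ->
  (forall w, normc w < rho -> ccont g w) ->
  exists g', forall w, normc w < rho / 2 -> cderiv g w (g' w) /\ cdiff g' w.
Proof.
move=> rho0 HF cg; have hr : 0 < rho / 2 < rho by lra.
have hF : hol rho F by move=> w /HF h; eexists; exact: h.
set r := rho / 2 in hr *; pose phi t := F (circle r t) * circle r t.
have [cphi [M HM]] : curve_cont phi /\ exists M, forall t, normc (phi t) <= M :=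
  boundary_values hF hr.
have rrho : r < rho by case/andP: hr.
have E w : normc w < r -> F w = ((2 * pi)%:C%C)^-1 * cauchy_transform phi r 1 w.
  by move=> wr; rewrite (primitive_cauchy HF cg wr rrho) mulKf.
have tr n w : normc w < r -> cderiv (cauchy_transform phi r n) w (n%:R * cauchy_transform phi r n.+1 w).
  by move=> wr; apply: (cauchy_transform_deriv _ cphi HM).
have scal (k : R[i]) h w d : cderiv h w d -> cderiv (fun w => k * h w) w (k * d).
  move=> hd; apply: cderiv_eq (cderivM (cderiv_cst k w) hd) _; by rewrite mul0r add0r.
have inner w : normc w < r -> exists2 e : R, 0 < e & forall v, normc (v - w) < e -> normc v < r.
  move=> wr; exists (r - normc w); first by rewrite subr_gt0.
  by move=> v vw; have := normc_dist_le v w; lra.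
have gE w : normc w < r -> g w = ((2 * pi)%:C%C)^-1 * cauchy_transform phi r 2 w.
  move=> wr; apply: (cderiv_unique (HF w (lt_trans wr rrho))).
  have h := scal ((2 * pi)%:C%C)^-1 _ _ _ (tr 1%N w wr); rewrite mul1r in h.
  apply: near_cderiv h _; have [e e0 He] := inner _ wr; exists e => // v /He vr.
  by rewrite E.
exists (fun w => ((2 * pi)%:C%C)^-1 * (2%:R * cauchy_transform phi r 3 w)) => w wr; split.
  have h := scal ((2 * pi)%:C%C)^-1 _ _ _ (tr 2%N w wr).
  apply: near_cderiv h _; have [e e0 He] := inner _ wr; exists e => // v /He vr.
  by rewrite gE.
have h := scal 2%:R _ _ _ (tr 3%N w wr).
exact: cderiv_diff (scal ((2 * pi)%:C%C)^-1 _ _ _ h).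
Qed.

(** By Goursat's theorem g is locally the derivative of some F, to which
  [derivative_local] applies. *)
Lemma hol_cder_local g z rho : 0 < rho -> (forall w, normc (w - z) < rho -> cdiff g w) ->
  cdiff (cder g) z.
Proof.
move=> rho0 hg; have [F [r r0 HF]] := local_primitive rho0 hg.
pose s := Num.min r rho; have s0 : 0 < s by rewrite lt_min r0.
pose F1 w := F (z + 1 * w); pose g1 w := g (z + 1 * w).
have sh w : normc w < s -> normc (z + 1 * w - z) < r /\ normc (z + 1 * w - z) < rho.
  by rewrite mul1r addrC addKr lt_min => /andP[].
have [||g' Hg'] := @derivative_local F1 g1 s s0.
- move=> w /sh[h1 _]; apply: cderiv_eq (cderiv_affine (HF _ h1)) _.
  by rewrite mul1r.
- move=> w /sh[_ h2]; apply: cdiff_cont.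
  by have [d hd] := hg _ h2; exists (1 * d); exact: cderiv_affine.
have s20 : 0 < s / 2 by rewrite divr_gt0.
have key w : normc (w - z) < s / 2 -> cderiv g w (g' (- z + 1 * w)) /\ cdiff g' (- z + 1 * w).
  move=> wz; have ws : normc (- z + 1 * w) < s / 2 by rewrite mul1r addrC.
  have [h1 h2] := Hg' _ ws; split => //.
  have := cderiv_affine h1; rewrite mul1r.
  by congr is_derive; apply/funext => v; rewrite /g1 !mul1r addrA subrr add0r.
have zz : normc (z - z) < s / 2 by rewrite subrr normc00.
apply: (@near_cdiff _ (fun w => g' (- z + 1 * w))).
  by have [_ [d hd]] := key z zz; exists (1 * d); exact: cderiv_affine.
exists (s / 2) => // w wz; have [h1 _] := key w wz.
by rewrite (cder_val h1).
Qed.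

Lemma hol_cder rho g : hol rho g -> hol rho (cder g).
Proof.
move=> hg w wr; apply: (@hol_cder_local _ _ (rho - normc w)); first by rewrite subr_gt0.
by move=> v vw; apply: hg; have := normc_dist_le v w; lra.
Qed.

Lemma cauchy_formula g rho r z : hol rho g -> normc z < r -> r < rho ->
  cintegral (fun t => g (circle r t) * (circle r t / (circle r t - z))) = (2 * pi)%:C%C * g z.
Proof.
move=> hg; apply: (@cauchy_C1 _ g (cder g) rho) => w wr; first exact/cder_cderiv/hg.
exact/cdiff_cont/(hol_cder hg).
Qed.

(** The difference of Cauchy's formulas at w and at 0 is w times a Cauchy
  transform, which is differentiable at 0 as well. *)
Lemma hol_divide_centre g rho : 0 < rho -> hol rho g -> g 0 = 0 ->
  exists2 h, forall w, g w = w * h w & hol rho h.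
Proof.
move=> rho0 hg g0.
exists (fun w => if w == 0 then cder g 0 else g w / w).
  move=> w; case: eqP => [->|/eqP w0]; first by rewrite mul0r.
  by rewrite mulrC divfK.
move=> w wr; have [w0|w0] := eqVneq w 0; last first.
  have w00 : 0 < normc w by rewrite normc_gt0.
  apply: (@near_cdiff _ (fun w => g w * w^-1)).
    by apply: cdiffM; [exact: hg|apply: cdiffV => //; exact: cdiff_id].
  exists (normc w) => // v vw; case: eqP => [v0|//].
  by move: vw; rewrite v0 sub0r normcNE ltxx.
rewrite {}w0 in wr *; clear w; have hr : 0 < rho / 2 < rho by lra.
set r := rho / 2 in hr *; have /andP[r0 rrho] := hr.
pose psi t := g (circle r t).
have cpsi : curve_cont psi.
  by apply: circle_comp_cont => t; apply: hg; rewrite normc_circle ?(ltW r0).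
have [N N0 HN] := @disc_bounded _ g r (fun w h => cdiff_cont (hg w (le_lt_trans h rrho))).
have HN' t : normc (psi t) <= N by apply: HN; rewrite normc_circle ?(ltW r0).
have n0 := normc00 R.
have c0 t : circle r t != 0 by rewrite -normc_gt0 normc_circle ?(ltW r0).
have cdif w : normc w < r -> forall t, circle r t - w != 0.
  move=> wr' t; rewrite -normc_gt0; apply: lt_le_trans (normc_dist_ge _ _).
  by rewrite normc_circle ?(ltW r0) // subr_gt0.
have E w : normc w < r -> (2 * pi)%:C%C * g w = w * cauchy_transform psi r 1 w.
  move=> wr'; have -> : (2 * pi)%:C%C * g w = (2 * pi)%:C%C * g w - (2 * pi)%:C%C * g 0.
    by rewrite g0 mulr0 subr0.
  rewrite -(cauchy_formula hg wr' rrho) -(@cauchy_formula g rho r 0 hg) ?n0 // -cintegralB.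
  - rewrite -cintegralZ; last first.
      apply: curve_contM => //; apply: curve_contX; apply: circle_comp_cont (fun w0 => (w0 - w)^-1) _ _ => t.
      apply: cdiffV; first exact: cdif.
      exact: cdiff_sub.
    congr cintegral; apply/funext => t; rewrite /psi subr0 divff // expr1.
    by have d1 := cdif _ wr' t; field.
  - apply: (@circle_comp_cont _ (fun v => g v * (v / (v - w)))) => t.
    apply: cdiffM; first by apply: hg; rewrite normc_circle ?(ltW r0).
    apply: cdiffM; first exact: cdiff_id.
    apply: cdiffV; first exact: cdif.
    exact: cdiff_sub.
  - apply: (@circle_comp_cont _ (fun v => g v * (v / (v - 0)))) => t.
    apply: cdiffM; first by apply: hg; rewrite normc_circle ?(ltW r0).
    apply: cdiffM; first exact: cdiff_id.
    apply: cdiffV; first by rewrite subr0.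
    exact: cdiff_sub.
pose k w := ((2 * pi)%:C%C)^-1 * cauchy_transform psi r 1 w.
have gk w : normc w < r -> g w = w * k w.
  by move=> /E h; rewrite /k mulrCA -h mulKf.
have dk : cdiff k 0.
  apply: cdiffM; first exact: cdiff_cst.
  by eexists; apply: (cauchy_transform_deriv 1 cpsi HN'); rewrite n0.
apply: (near_cdiff dk); exists r => // w; rewrite subr0 => wr'.
case: eqP => [->|/eqP w0]; last by rewrite gk // mulrC mulKf.
have [d hd] := dk.
have h1 : cderiv g 0 (k 0).
  apply: (@near_cderiv _ (fun w => w * k w)).
    apply: cderiv_eq (cderivM (cderiv_id 0) hd) _; by rewrite mul1r mul0r addr0.
  by exists r => // v; rewrite subr0 => /gk ->.
by rewrite (cder_val h1).
Qed.

End Holomorphic.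

(** * Removable singularities and division by linear factors *)

Section Division.
Variable R : realType.
Implicit Types (r t l M rho d e : R) (z w a b : R[i]) (g F : R[i] -> R[i]).

Lemma local_divide g b d : 0 < d -> (forall w, normc (w - b) < d -> cdiff g w) ->
  g b = 0 -> exists2 h, cdiff h b & forall w, g w = (w - b) * h w.
Proof.
move=> d0 hg gb.
have [||h hE hh] := @hol_divide_centre _ (fun w => g (b + 1 * w)) d d0.
- move=> w wd; have [|D hD] := hg (b + 1 * w); first by rewrite mul1r addrC addKr.
  by exists (1 * D); exact: cderiv_affine.
- by rewrite mulr0 addr0.
exists (fun w => h (- b + 1 * w)); last first.
  by move=> w; rewrite mul1r [- b + w]addrC -hE mul1r addrC subrK.
have [|D hD] := hh (- b + 1 * b); first by rewrite mul1r addNr normc00.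
by exists (1 * D); exact: cderiv_affine.
Qed.

(** The function [(w - b) * g w], extended by 0, is differentiable at b with
  derivative a.  Dividing it by [w - b] again extends g. *)
Lemma removable_singularity g b a d : 0 < d ->
  (forall w, w != b -> normc (w - b) < d -> cdiff g w) ->
  (forall e, 0 < e -> exists2 d', 0 < d' &
     forall w, w != b -> normc (w - b) < d' -> normc (g w - a) <= e) ->
  cdiff (fun w => if w == b then a else g w) b.
Proof.
move=> d0 hg ga; pose G w := if w == b then 0 else (w - b) * g w.
have Gb : G b = 0 by rewrite /G eqxx.
have dGb : cderiv G b a.
  apply/cderivP => e e0; have [d' d'0 hd'] := ga e e0; exists d' => // w wd.
  rewrite Gb subr0 /G; case: eqP => [->|/eqP wb].
    by rewrite subrr mulr0 subrr normc00 mulr0.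
  rewrite (_ : _ - _ = (g w - a) * (w - b)); last by ring.
  by rewrite normcMl ler_wpM2r ?normc_ge0 // hd'.
have hG w : normc (w - b) < d -> cdiff G w.
  move=> wd; have [->|wb] := eqVneq w b; first exact: cderiv_diff dGb.
  apply: (@near_cdiff _ (fun w => (w - b) * g w)).
    by apply: cdiffM; [exact: cdiff_sub|exact: hg].
  exists (normc (w - b)); first by rewrite normc_gt0 subr_eq0.
  move=> v vw; rewrite /G; case: eqP => // vb; move: vw.
  by rewrite vb normc_distC ltxx.
have [h hh hE] := local_divide d0 hG Gb.
apply: (near_cdiff hh); exists d => // w wd; case: eqP => [->|/eqP wb].
  have [D hD] := hh; apply: (cderiv_unique _ dGb).
  apply: (@near_cderiv _ (fun w => (w - b) * h w)); last by exists d => // v _; rewrite hE.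
  have h1 := cderivB (cderiv_id b) (cderiv_cst b b).
  by apply: cderiv_eq (cderivM h1 hD) _; rewrite subrr mul0r addr0 subr0 mul1r.
have wb0 : w - b != 0 by rewrite subr_eq0.
by apply: (mulfI wb0); rewrite -hE /G (negPf wb).
Qed.

Lemma hol_divide g b rho : hol rho g -> normc b < rho -> g b = 0 ->
  exists2 h, hol rho h & forall w, g w = (w - b) * h w.
Proof.
move=> hg br gb; have d0 : 0 < rho - normc b by rewrite subr_gt0.
have [|h0 dh0 hE] := local_divide d0 _ gb.
  by move=> w wd; apply: hg; have := normc_dist_le w b; lra.
exists h0 => // w wr; have [->//|wb] := eqVneq w b.
apply: (@near_cdiff _ (fun w => g w * (w - b)^-1)).
  apply: cdiffM; first exact: hg.
  by apply: cdiffV; [rewrite subr_eq0|exact: cdiff_sub].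
exists (normc (w - b)); first by rewrite normc_gt0 subr_eq0.
move=> v vw; rewrite hE mulrC mulKf // subr_eq0.
by apply/eqP => vb; move: vw; rewrite vb normc_distC ltxx.
Qed.

Lemma holM rho g F : hol rho g -> hol rho F -> hol rho (fun w => g w * F w).
Proof. by move=> h1 h2 w wr; apply: cdiffM; [exact: h1|exact: h2]. Qed.

Lemma hol_sub rho rho' g : rho' <= rho -> hol rho g -> hol rho' g.
Proof. by move=> h hg w wr; apply: hg; exact: lt_le_trans h. Qed.

End Division.

(** * Poisson's formula and the maximum principle *)

Section Poisson.
Variable R : realType.
Implicit Types (r t l M rho d e s : R) (z w a b : R[i]) (g v F : R[i] -> R[i]).

Definition poisson_kernel r z t : R := (r ^+ 2 - normc z ^+ 2) / normc (circle r t - z) ^+ 2.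

Lemma mulc_conj z : z * (z^*)%C = ((normc z ^+ 2)%:C)%C.
Proof. by rewrite -sqr_normc normc_norm -rmorphXn. Qed.

Lemma normc_conj z : normc (z^*)%C = normc z.
Proof. by case: z => x y; rewrite /= sqrrN. Qed.

Lemma poisson_kernel_upper r z t : normc z < r ->
  0 <= poisson_kernel r z t <= (r + normc z) / (r - normc z).
Proof.
move=> zr; have z0 := normc_ge0 z; have r0 : 0 < r by lra.
have rz : 0 < r - normc z by lra.
have low : r - normc z <= normc (circle r t - z).
  by apply: le_trans (normc_dist_ge _ _); rewrite normc_circle ?(ltW r0).
have lp : 0 < normc (circle r t - z) := lt_le_trans rz low.
rewrite /poisson_kernel subr_sqr; apply/andP; split.
  by rewrite mulr_ge0 ?invr_ge0 ?sqr_ge0 // mulr_ge0; lra.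
rewrite ler_pdivrMr ?exprn_gt0 //.
rewrite (_ : (r - _) * (r + _) = (r + normc z) / (r - normc z) * (r - normc z) ^+ 2); last first.
  by field; rewrite gt_eqF.
apply: ler_wpM2l; first by rewrite divr_ge0; lra.
by rewrite lerXn2r ?nnegrE ?normc_ge0 // ltW.
Qed.

Lemma poisson_kernel_lower r z t : normc z < r ->
  (r - normc z) / (r + normc z) <= poisson_kernel r z t.
Proof.
move=> zr; have z0 := normc_ge0 z; have r0 : 0 < r by lra.
have rz : 0 < r - normc z by lra.
have low : r - normc z <= normc (circle r t - z).
  by apply: le_trans (normc_dist_ge _ _); rewrite normc_circle ?(ltW r0).
have up : normc (circle r t - z) <= r + normc z.
  by apply: le_trans (normcB _ _) _; rewrite normc_circle ?(ltW r0).
have lp : 0 < normc (circle r t - z) := lt_le_trans rz low.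
rewrite /poisson_kernel subr_sqr ler_pdivlMr ?exprn_gt0 //.
rewrite (_ : (r - _) * (r + _) = (r - normc z) / (r + normc z) * (r + normc z) ^+ 2); last first.
  by field; rewrite gt_eqF //; lra.
apply: ler_wpM2l; first by rewrite divr_ge0; lra.
by rewrite lerXn2r ?nnegrE ?normc_ge0 //; lra.
Qed.

Lemma real_continuousM (f1 f2 : R -> R) : continuous f1 -> continuous f2 ->
  continuous (fun t => f1 t * f2 t).
Proof. by move=> h1 h2 t; apply: cvgM; [exact: h1|exact: h2]. Qed.

Lemma real_continuous_cst (k : R) : continuous (fun _ : R => k).
Proof. by move=> ?; exact: cvg_cst. Qed.

Lemma curve_cont_norm c : curve_cont c -> continuous (fun t : R => normc (c t : R[i])).
Proof.
move=> cc; apply/real_continuousP => x e e0; have [d d0 hd] := cc x e e0.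
exists d => // y /hd; apply: le_lt_trans.
have h1 := normc_dist_ge (c y) (c x); have h2 := normc_dist_ge (c x) (c y).
by rewrite ler_norml; rewrite normc_distC in h2; apply/andP; split; lra.
Qed.

Lemma poisson_kernel_cont r z : normc z < r -> continuous (poisson_kernel r z).
Proof.
move=> zr; have z0 := normc_ge0 z; have r0 : 0 < r by lra.
have h : continuous (fun t => normc (circle r t - z)).
  by apply: curve_cont_norm; apply: curve_contD; [exact: circle_cont|exact: curve_cont_cst].
apply: real_continuousM; first exact: real_continuous_cst.
move=> t; apply: cvgV; last by apply: (real_continuousM h h).
by rewrite expf_neq0 // gt_eqF // normc_gt0; exact: circle_sub_neq0 zr _.
Qed.

(** Cauchy's formula at z for the product of g with [(r^2 - |z|^2) / den], which is
  1 at z and which, on the circle, turns the Cauchy kernel into the Poisson kernel. *)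
Lemma poisson_complex rho r g z : hol rho g -> normc z < r -> r < rho ->
  cintegral (fun t => g (circle r t) * ((poisson_kernel r z t)%:C)%C) = (2 * pi)%:C%C * g z.
Proof.
move=> hg zr rrho; have z0 := normc_ge0 z; have r0 : 0 < r by lra.
pose rho' := Num.min rho (2 * r - normc z).
have rr' : r < rho' by rewrite lt_min rrho; lra.
pose den w := (r ^+ 2)%:C%C - (z^*)%C * w.
have den0 w : normc w < rho' -> den w != 0.
  rewrite lt_min => /andP[_ wr]; rewrite -normc_gt0.
  apply: lt_le_trans (normc_dist_ge _ _).
  rewrite normc_real normcMl normc_conj subr_gt0 ger0_norm ?sqr_ge0 //.
  apply: (@le_lt_trans _ _ (normc z * (2 * r - normc z))).
    by apply: ler_wpM2l => //; exact: ltW.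
  rewrite -subr_gt0 (_ : _ - _ = (r - normc z) ^+ 2); last by ring.
  by rewrite exprn_gt0 // subr_gt0.
pose G w := g w * ((r ^+ 2 - normc z ^+ 2)%:C%C / den w).
have hG : hol rho' G.
  move=> w wr; apply: cdiffM; first by apply: hg; move: wr; rewrite lt_min => /andP[].
  apply: cdiffM; first exact: cdiff_cst.
  apply: cdiffV; first exact: den0.
  exact: cdiff_linear.
have GE : G z = g z.
  rewrite /G /den mulrC [_^*%C * _]mulrC mulc_conj -rmorphB divff ?mul1r //.
  by rewrite eq_complex /= eqxx andbT subr_eq0 gt_eqF // ltrXn2r.
rewrite -GE -(cauchy_formula hG zr rr'); congr cintegral; apply/funext => t.
have cn0 : circle r t - z != 0 by exact: circle_sub_neq0 zr _.
have c0 : circle r t != 0 by rewrite -normc_gt0 normc_circle ?(ltW r0).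
have cj : circle r t * (circle r t)^*%C = (r ^+ 2)%:C%C by rewrite mulc_conj normc_circle ?(ltW r0).
have dn : den (circle r t) != 0 by apply: den0; rewrite normc_circle ?(ltW r0).
rewrite /G -mulrA; congr (_ * _).
have E2 : den (circle r t) = circle r t * (circle r t - z)^*%C.
  by rewrite rmorphB /= mulrBr cj /den [z^*%C * _]mulrC.
have j0 : (circle r t - z)^*%C != 0 by rewrite conjc_eq0.
rewrite E2 /poisson_kernel fmorph_div /= -mulc_conj.
by move: (circle r t - z)^*%C j0 => j j0; field; rewrite cn0 j0 c0.
Qed.

Lemma poisson_Re rho r g z : hol rho g -> normc z < r -> r < rho ->
  period_integral (fun t => complex.Re (g (circle r t)) * poisson_kernel r z t) =
  2 * pi * complex.Re (g z).
Proof.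
move=> hg zr rrho; have H := poisson_complex hg zr rrho.
have -> : 2 * pi * complex.Re (g z) = complex.Re ((2 * pi)%:C%C * g z).
  by rewrite (mulrC (2 * pi)%:C%C) complex_Re_mulr mulrC.
by rewrite -H /cintegral /=; apply: eq_period_integral => t; rewrite complex_Re_mulr.
Qed.

Lemma poisson_kernel_integral r z : normc z < r ->
  period_integral (poisson_kernel r z) = 2 * pi.
Proof.
move=> zr; have h : hol (r + 1) (fun=> 1 : R[i]) by move=> w _; exact: cdiff_cst.
have := poisson_Re h zr; rewrite ltrDl ltr01 => /(_ isT); rewrite /= mulr1 => <-.
by apply: eq_period_integral => t; rewrite mul1r.
Qed.

Lemma hol_circle_cont rho r g : hol rho g -> 0 <= r < rho -> curve_cont (fun t => g (circle r t)).
Proof.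
by move=> hg /andP[r0 rr]; apply: circle_comp_cont => t; apply: hg; rewrite normc_circle.
Qed.

(** After multiplication by a unimodular constant, g z is nonnegative and thus an
  average of real parts of boundary values. *)
Lemma max_principle rho r g M : hol rho g -> 0 < r < rho ->
  (forall t, normc (g (circle r t)) <= M) -> forall z, normc z < r -> normc (g z) <= M.
Proof.
move=> hg /andP[r0 rrho] HM z zr.
have M0 : 0 <= M by apply: le_trans (HM 0); exact: normc_ge0.
have [->|gz0] := eqVneq (g z) 0; first by rewrite normc00.
pose u := (normc (g z))%:C%C / g z.
have nu : normc u = 1.
  by rewrite /u normcMl normc_real normcVl ger0_norm ?normc_ge0 // divff // normc_eq0.
have ug : u * g z = (normc (g z))%:C%C by rewrite divfK.
have hug : hol rho (fun w => u * g w) by move=> w wr; apply: cdiffM; [exact: cdiff_cst|exact: hg].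
have := poisson_Re hug zr rrho; rewrite ug => H.
rewrite -(@ler_pM2l _ (2 * pi)) ?twopi_gt0 // -[X in X <= _]H.
rewrite [leRHS]mulrC -{1}(poisson_kernel_integral zr) -period_integralZ; last exact: poisson_kernel_cont.
apply: period_integral_le.
- apply: real_continuousM; last exact: poisson_kernel_cont.
  by apply: curve_cont_Re; apply: (hol_circle_cont hug); rewrite rrho ltW.
- by apply: real_continuousM; [exact: real_continuous_cst|exact: poisson_kernel_cont].
move=> t; apply: ler_wpM2r; first by case/andP: (poisson_kernel_upper t zr).
apply: le_trans (ler_norm _) _; apply: le_trans (normc_Re _) _.
by rewrite normcMl nu mul1r.
Qed.

Lemma ln_normc_deriv (c : R -> R[i]) t (d : R[i]) : c t != 0 -> curve_deriv c t d ->
  is_derive t 1 (fun t => ln (normc (c t))) (complex.Re (d / c t)).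
Proof.
move=> c0 [h1 h2].
pose N s := complex.Re (c s) * complex.Re (c s) + complex.Im (c s) * complex.Im (c s).
have NE s : N s = normc (c s) ^+ 2 by rewrite normc_sqr !expr2.
have N0 : 0 < N t by rewrite NE exprn_gt0 // normc_gt0.
have dN : is_derive t 1 N (complex.Re (c t) * complex.Re d *+ 2 + complex.Im (c t) * complex.Im d *+ 2).
  apply: is_derive_eq (is_deriveD (is_deriveM h1 h1) (is_deriveM h2 h2)) _.
  by rewrite /GRing.scale /= !mulr2n.
have E : (fun s => ln (normc (c s))) = (fun s => 2^-1 * (@ln R \o N) s).
  apply/funext => s /=; rewrite NE; have [->|cs] := eqVneq (c s) 0.
    by rewrite normc00 expr0n /= ln0 // mulr0.
  by rewrite lnXn ?normc_gt0 // mulr2n; field.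
rewrite E.
have dl := is_derive1_comp (is_derive1_ln N0) dN.
have dc : is_derive t 1 (cst (2^-1 : R)) 0 by exact: is_derive_cst.
apply: is_derive_eq (is_deriveM dc dl) _.
rewrite /GRing.scale /= mulr0 addr0.
have nd : normc (c t) ^+ 2 != 0 by rewrite -NE gt_eqF.
have -> : d / c t = d * (c t)^*%C * (normc (c t) ^- 2)%:C%C.
  have j0 : (c t)^*%C != 0 by rewrite conjc_eq0.
  rewrite fmorphV /= -mulc_conj; move: (c t)^*%C j0 => j j0; field.
  by rewrite c0 j0.
rewrite complex_Re_mulr -NE /N in nd *; move: nd; case: (c t) => x y; case: d {h1 h2 dN dl} => u v /= nd.
by rewrite !mulr2n; field.
Qed.

(** No branch of the logarithm is needed: the Poisson integral of the logarithm of
  the modulus of [v (z + l * (w - z))] is constant in l.  Its derivative in l is the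
  Poisson integral of the real part of a holomorphic function that vanishes at z,
  the product of [v' / v], at the point [z + l * (w - z)], with [w - z]. *)
Lemma log_poisson rho r v z : hol rho v -> (forall w, normc w < rho -> v w != 0) ->
  normc z < r -> r < rho ->
  period_integral (fun t => ln (normc (v (circle r t))) * poisson_kernel r z t)
  = 2 * pi * ln (normc (v z)).
Proof.
move=> hv v0 zr rrho; have z0 := normc_ge0 z; have r0 : 0 < r by lra.
have [eta [rho1 [r' [eta0 /andP[rr1 r1rho] r'rho seg]]]] := radial_segment zr rrho.
pose q w := cder v w / v w.
have hq : hol rho q.
  by move=> w wr; apply: cdiffM; [exact: (hol_cder hv)|apply: cdiffV; [exact: v0|exact: hv]].
have [M M0 HM] := @disc_bounded _ q r' (fun w h => cdiff_cont (hq w (le_lt_trans h r'rho))).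
have inr l w : - eta < l < 1 + eta -> normc w < rho1 -> normc (z + l%:C%C * (w - z)) < rho.
  by move=> h1 h2; apply: le_lt_trans (seg _ _ h1 h2) r'rho.
have inc t : normc (circle r t) < rho1 by rewrite normc_circle ?(ltW r0).
pose G l w := q (z + l%:C%C * (w - z)) * (w - z).
have hhom l g : - eta < l < 1 + eta -> hol rho g -> hol rho1 (fun w => g (z + l%:C%C * (w - z))).
  move=> ll hg w wr; have [D hD] := hg _ (inr l w ll wr).
  by exists (l%:C%C * D); exact: cderiv_homothety.
have hG l : - eta < l < 1 + eta -> hol rho1 (G l).
  move=> ll; apply: holM; first exact: hhom ll hq.
  by move=> w _; exact: cdiff_sub.
pose phi l t := ln (normc (v (z + l%:C%C * (circle r t - z)))) * poisson_kernel r z t.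
pose D l t := complex.Re (G l (circle r t)) * poisson_kernel r z t.
have -> : (fun t => ln (normc (v (circle r t))) * poisson_kernel r z t) = phi 1.
  by apply/funext => t; rewrite /phi mul1r subrKC.
have -> : period_integral (phi 1) = period_integral (phi 0).
  apply: (@period_integral_param_cst _ phi D (- eta) (1 + eta)
    (M * (2 * r) * ((r + normc z) / (r - normc z)))).
  - move=> l ll; apply: real_continuousM; last exact: poisson_kernel_cont.
    have cn : continuous (fun t => normc (v (z + l%:C%C * (circle r t - z)))).
      by apply: curve_cont_norm; apply: (hol_circle_cont (hhom l v ll hv)); rewrite rr1 ltW.
    move=> t; apply: (@continuous_comp _ _ _ (fun t => normc (v (z + l%:C%C * (circle r t - z)))) (@ln R)); first exact: cn.
    by apply: continuous_ln; rewrite normc_gt0; apply: v0; exact: inr.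
  - move=> l t ll.
    have dv := cder_cderiv (hv _ (inr l _ ll (inc t))).
    have dc := curve_deriv_comp dv (curve_deriv_line z (circle r t - z) l).
    have vn0 := v0 _ (inr l _ ll (inc t)).
    have dl := ln_normc_deriv vn0 dc.
    have dk : is_derive l 1 (cst (poisson_kernel r z t)) 0 by exact: is_derive_cst.
    apply: is_derive_eq (is_deriveM dl dk) _.
    rewrite /GRing.scale /= mulr0 add0r mulrC /D /G /q.
    by congr (complex.Re _ * _); rewrite mulrAC.
  - move=> l t ll; rewrite /D normrM.
    have /andP[k0 k1] := poisson_kernel_upper t zr.
    apply: ler_pM => //; last by rewrite ger0_norm.
    apply: le_trans (normc_Re _) _; rewrite /G normcMl; apply: ler_pM; rewrite ?normc_ge0 //.
      by apply: HM; apply: seg.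
    by apply: le_trans (normcB _ _) _; rewrite normc_circle ?(ltW r0) //; lra.
  - move=> l ll; rewrite (poisson_Re (hG l ll) zr rr1).
    have -> : G l z = 0 by rewrite /G subrr mulr0.
    by rewrite /= mulr0.
  - by apply/andP; split; lra.
  - by apply/andP; split; lra.
have -> : phi 0 = (fun t => ln (normc (v z)) * poisson_kernel r z t).
  by apply/funext => t; rewrite /phi mul0r addr0.
by rewrite period_integralZ ?poisson_kernel_integral 1?mulrC //; exact: poisson_kernel_cont.
Qed.

End Poisson.

(** * Harnack's inequality and the division of bounds *)

Section Harnack.
Variable R : realType.
Implicit Types (r t l M rho d e s B K L kappa : R) (z w a b : R[i]) (g v F A G H : R[i] -> R[i]).

Lemma real_continuousZ (k : R) (f : R -> R) : continuous f -> continuous (fun t => k * f t).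
Proof. by move=> cf; apply: (real_continuousM (@real_continuous_cst R k) cf). Qed.

(** The largest value that the Poisson kernel of the circle of radius r takes when
  the point z has modulus at most s. *)
Definition harnack_constant r s : R := (r + s) / (r - s).

Lemma harnack_constant_ge1 r s : 0 <= s < r -> 1 <= harnack_constant r s.
Proof. by move=> /andP[? ?]; rewrite /harnack_constant ler_pdivlMr ?subr_gt0 //; lra. Qed.

Lemma harnack_constant_anti r r' s : 0 <= s < r -> r <= r' ->
  harnack_constant r' s <= harnack_constant r s.
Proof.
move=> /andP[s0 sr] rr; rewrite /harnack_constant ler_pdivrMr; last lra.
by rewrite mulrAC ler_pdivlMr; nra.
Qed.

Lemma poisson_kernel_bounds r s z t : normc z <= s -> s < r ->
  (harnack_constant r s)^-1 <= poisson_kernel r z t <= harnack_constant r s.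
Proof.
move=> zs sr; have z0 := normc_ge0 z; have zr := le_lt_trans zs sr.
have /andP[_ h2] := poisson_kernel_upper t zr; have h1 := poisson_kernel_lower t zr.
rewrite /harnack_constant invf_div; apply/andP; split.
  apply: le_trans h1; rewrite ler_pdivrMr; last lra.
  by rewrite mulrAC ler_pdivlMr; nra.
apply: le_trans h2 _; rewrite ler_pdivrMr; last lra.
by rewrite mulrAC ler_pdivlMr; nra.
Qed.

Lemma log_norm_cont rho r v : hol rho v -> (forall w, normc w < rho -> v w != 0) ->
  0 <= r < rho -> continuous (fun t => ln (normc (v (circle r t)))).
Proof.
move=> hv v0 rr t; have /andP[r0 rrho] := rr.
have cn := curve_cont_norm (hol_circle_cont hv rr).
apply: (@continuous_comp _ _ _ (fun t => normc (v (circle r t))) (@ln R)); first exact: cn.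
by apply: continuous_ln; rewrite normc_gt0; apply: v0; rewrite normc_circle.
Qed.

(** The difference of [ln M] and the logarithm of the modulus of v is the Poisson
  integral of a nonnegative function, and the kernels at z and z1 are comparable. *)
Lemma harnack rho r s v M z z1 : hol rho v -> (forall w, normc w < rho -> v w != 0) ->
  s < r < rho -> normc z <= s -> normc z1 <= s -> 0 < M ->
  (forall t, normc (v (circle r t)) <= M) ->
  ln M - ln (normc (v z)) <= harnack_constant r s ^+ 2 * (ln M - ln (normc (v z1))).
Proof.
move=> hv v0 /andP[sr rrho] zs z1s M0 HM.
have s0 : 0 <= s := le_trans (normc_ge0 z) zs; have r0 : 0 < r by lra.
set kappa := harnack_constant r s.
have k1 : 1 <= kappa by apply: harnack_constant_ge1; rewrite s0.
have k0 : 0 < kappa by lra.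
pose u t := ln M - ln (normc (v (circle r t))).
have inr t : normc (circle r t) < rho by rewrite normc_circle // ltW.
have u0 t : 0 <= u t.
  by rewrite subr_ge0 ler_ln ?posrE ?normc_gt0 // v0.
have cl : continuous (fun t => ln (normc (v (circle r t)))).
  by apply: (log_norm_cont hv v0); rewrite rrho ltW.
have cu : continuous u.
  by move=> t; apply: cvgB; [exact: cvg_cst|exact: cl].
have rep x : normc x <= s -> period_integral (fun t => u t * poisson_kernel r x t)
    = 2 * pi * (ln M - ln (normc (v x))).
  move=> xs; have xr := le_lt_trans xs sr; have ck := poisson_kernel_cont xr.
  rewrite mulrBr -(log_poisson hv v0 xr rrho) [X in X - _]mulrC -{1}(poisson_kernel_integral xr).
  rewrite -period_integralZ // -period_integralB; [|by apply: real_continuousZ; exact: ck|exact: real_continuousM].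
  by apply: eq_period_integral => t; rewrite mulrBl.
have cz x : normc x <= s -> continuous (fun t => u t * poisson_kernel r x t).
  by move=> xs; apply: real_continuousM => //; apply: poisson_kernel_cont; exact: le_lt_trans sr.
rewrite -(@ler_pM2l _ (2 * pi)) ?twopi_gt0 // mulrCA -!rep //.
rewrite -period_integralZ; last exact: cz.
apply: period_integral_le; [exact: cz|by apply: real_continuousZ; exact: cz|].
move=> t; rewrite [leRHS]mulrCA; apply: ler_wpM2l => //.
have /andP[_ h1] := poisson_kernel_bounds t zs sr.
have /andP[h2 _] := poisson_kernel_bounds t z1s sr.
apply: le_trans h1 _; rewrite expr2 -/kappa -mulrA ler_peMr //; first exact: ltW.
by rewrite mulrC -ler_pdivrMr // mul1r.
Qed.

(** The upper half of the Poisson-Jensen formula for a function without zeros. *)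
Lemma log_norm_upper rho r s v z : hol rho v -> (forall w, normc w < rho -> v w != 0) ->
  s < r < rho -> normc z <= s ->
  ln (normc (v z)) <= harnack_constant r s *
    ((2 * pi)^-1 * period_integral (fun t => Num.max (ln (normc (v (circle r t)))) 0)).
Proof.
move=> hv v0 /andP[sr rrho] zs.
have s0 : 0 <= s := le_trans (normc_ge0 z) zs; have r0 : 0 < r by lra.
have zr := le_lt_trans zs sr.
have cl : continuous (fun t => ln (normc (v (circle r t)))).
  by apply: (log_norm_cont hv v0); rewrite rrho ltW.
have cm : continuous (fun t => Num.max (ln (normc (v (circle r t)))) 0).
  move=> t; apply: (@continuous_max _ _ (fun t => ln (normc (v (circle r t)))) (fun=> 0)).
    exact: cl.
  exact: cvg_cst.
have p0 := twopi_gt0 R.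
rewrite mulrCA mulrC ler_pdivlMr // mulrC -(log_poisson hv v0 zr rrho).
rewrite -period_integralZ //.
apply: period_integral_le.
- by apply: real_continuousM => //; exact: poisson_kernel_cont.
- by apply: real_continuousZ; exact: cm.
move=> t; have /andP[h0 _] := poisson_kernel_upper t zr.
have /andP[_ h1] := poisson_kernel_bounds t zs sr.
set x := ln _; rewrite mulrC; apply: (@le_trans _ _ (poisson_kernel r z t * Num.max x 0)).
  by apply: ler_wpM2l => //; rewrite le_max lexx.
by apply: ler_wpM2r => //; rewrite le_max lexx orbT.
Qed.

(** For a in the disc of radius r, the Blaschke factor
  [r * (z - a) / (r^2 - conj a * z)] thus has modulus 1 on the circle of radius r and
  modulus less than 1 inside. *)
Lemma blaschke_identity r a z :
  normc ((r ^+ 2)%:C%C - (a^*)%C * z) ^+ 2 - r ^+ 2 * normc (z - a) ^+ 2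
  = (r ^+ 2 - normc a ^+ 2) * (r ^+ 2 - normc z ^+ 2).
Proof. by case: a => a1 a2; case: z => z1 z2; rewrite !normc_sqr /=; ring. Qed.

(** Divide G by the Blaschke factor of each zero a in the disc of radius s: this
  moves the zero out of the disc of radius r, keeps the modulus on the circle and
  increases it inside.  At z1 the square of the modulus grows at least by the factor
  1 / k, where k < 1 depends on r and s only, while it stays below [M ^+ 2] by the
  maximum principle.  Hence there are finitely many divisions, and along the way
  the zeros of G in the disc of radius s are found to form a finite list S. *)
Lemma zero_free_factor G rho s r z1 : 0 < s -> s < r < rho -> hol rho G ->
  normc z1 <= s -> G z1 != 0 ->
  exists v, [/\ hol rho v,
    (forall t, normc (v (circle r t)) = normc (G (circle r t))),
    (forall z, normc z <= r -> normc (G z) <= normc (v z)),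
    (forall z, normc z <= s -> v z != 0) &
    (forall z, normc z < rho -> normc z * s < r ^+ 2 -> v z = 0 -> G z = 0) /\
    exists S : seq R[i], forall z, normc z <= s -> G z = 0 -> z \in S].
Proof.
move=> s0 /andP[sr rrho] hG z1s Gz1; have r0 : 0 < r by lra.
have rr : 0 < r < rho by rewrite r0.
have [M M0 HM] : exists2 M, 0 < M & forall t, normc (G (circle r t)) <= M.
  have [M M0 HM] := @disc_bounded _ G r (fun w h => cdiff_cont (hG w (le_lt_trans h rrho))).
  by exists M => // t; apply: HM; rewrite normc_circle // ltW.
(* [blaschke_identity] at z1, whose right-hand side is at least [(r^2 - s^2)^2],
   while the denominator of the factor is at most [2 * r^2] in modulus *)
pose k : R := 1 - (r ^+ 2 - s ^+ 2) ^+ 2 / (4 * r ^+ 4).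
have rs2 : 0 < r ^+ 2 - s ^+ 2 by rewrite subr_gt0 ltrXn2r ?nnegrE // ltW.
have r4 : 0 < 4 * r ^+ 4 by rewrite mulr_gt0 // exprn_gt0.
have k1 : k < 1 by rewrite /k ltrBlDr ltrDl divr_gt0 // exprn_gt0.
have k0 : 0 <= k.
  rewrite /k subr_ge0 ler_pdivrMr // mul1r.
  have : (r ^+ 2 - s ^+ 2) ^+ 2 <= (r ^+ 2) ^+ 2.
    by rewrite lerXn2r ?nnegrE ?sqr_ge0 //; [exact: ltW|rewrite lerBlDr lerDl sqr_ge0].
  have := sqr_ge0 (r ^+ 2); rewrite -exprM; lra.
have [N HN] : exists N, M ^+ 2 * k ^+ N < normc (G z1) ^+ 2.
  have q0 : 0 < normc (G z1) ^+ 2 / M ^+ 2 by rewrite divr_gt0 ?exprn_gt0 ?normc_gt0.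
  have : geometric 1 k @ \oo --> (0 : R) by apply: cvg_geometric; rewrite ger0_norm.
  move=> /cvgrPdist_lt /(_ _ q0) [N _ HN]; exists N.
  have := HN N (leqnn N); rewrite /= sub0r normrN mul1r ger0_norm ?exprn_ge0 //.
  by rewrite ltr_pdivlMr ?exprn_gt0 // [k ^+ N * _]mulrC.
elim: N G hG Gz1 HM HN => [|N IH] G hG Gz1 HM HN.
  exfalso; move: HN; rewrite expr0 mulr1 ltNge => /negP; apply.
  rewrite lerXn2r ?nnegrE ?normc_ge0 //; first exact: ltW.
  exact: (max_principle hG rr HM (le_lt_trans z1s sr)).
have [hz|] := pselect (forall z, normc z <= s -> G z != 0).
  exists G; split => //; split => //; exists [::] => z zs Gz.
  by have := hz z zs; rewrite Gz eqxx.
move=> /existsNP[a /not_implyP[as_ /negP/negPn/eqP Ga]].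
have arho : normc a < rho by lra.
have [G1 hG1 G1E] := hol_divide hG arho Ga.
pose den w := (r ^+ 2)%:C%C - (a^*)%C * w.
pose G2 w := G1 w * (den w * (r^-1)%:C%C).
have a0 := normc_ge0 a.
have ident z : r ^+ 2 * normc (z - a) ^+ 2 = normc (den z) ^+ 2 - (r ^+ 2 - normc a ^+ 2) * (r ^+ 2 - normc z ^+ 2).
  by rewrite -blaschke_identity; ring.
have sq x y : 0 <= x -> 0 <= y -> x ^+ 2 <= y ^+ 2 -> x <= y.
  by move=> x0 y0; rewrite ler_pXn2r ?nnegrE.
have G2sq z : r ^+ 2 * normc (G2 z) ^+ 2 = normc (G1 z) ^+ 2 * normc (den z) ^+ 2.
  rewrite /G2 !normcMl normc_real ger0_norm ?invr_ge0; last exact: ltW.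
  by field; exact: lt0r_neq0.
have Gsq z : normc (G z) ^+ 2 = normc (G1 z) ^+ 2 * normc (z - a) ^+ 2.
  by rewrite G1E normcMl exprMn mulrC.
have a2 : 0 <= r ^+ 2 - normc a ^+ 2.
  by rewrite subr_ge0 lerXn2r ?nnegrE //; lra.
have rr0 : 0 < r ^+ 2 by rewrite exprn_gt0.
have circ t : normc (G2 (circle r t)) = normc (G (circle r t)).
  apply/eqP; rewrite -(@eqrXn2 _ 2) ?normc_ge0 //; apply/eqP.
  apply: (mulfI (lt0r_neq0 rr0)); rewrite G2sq Gsq [RHS]mulrCA ident.
  by rewrite normc_circle ?(ltW r0) // subrr mulr0 subr0.
have inside z : normc z <= r -> normc (G z) <= normc (G2 z).
  move=> zr; apply: sq; rewrite ?normc_ge0 // -(ler_pM2l rr0) G2sq Gsq [leLHS]mulrCA.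
  apply: ler_wpM2l; first exact: sqr_ge0.
  rewrite ident lerBlDr lerDl mulr_ge0 // subr_ge0 lerXn2r ?nnegrE ?normc_ge0 //.
  exact: ltW.
have hG2 : hol rho G2.
  move=> w wr; apply: cdiffM; first exact: hG1.
  apply: cdiffM; last exact: cdiff_cst.
  exact: cdiff_linear.
have G2z1 : G2 z1 != 0.
  rewrite -normc_gt0; apply: lt_le_trans (inside _ _); last lra.
  by rewrite normc_gt0.
have den_up : normc (den z1) <= 2 * r ^+ 2.
  apply: le_trans (normcB _ _) _; rewrite normc_real normcMl normc_conj ger0_norm ?(ltW rr0) //.
  have : normc a * normc z1 <= r * r by apply: ler_pM; rewrite ?normc_ge0 //; lra.
  by rewrite -expr2; lra.
have contr : normc (G z1) ^+ 2 <= k * normc (G2 z1) ^+ 2.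
  rewrite -(ler_pM2l rr0) [leRHS]mulrCA G2sq Gsq [leLHS]mulrCA [leRHS]mulrCA.
  apply: ler_wpM2l; first exact: sqr_ge0.
  rewrite ident /k [leRHS]mulrBl mul1r lerD2l lerN2.
  apply: (@le_trans _ _ ((r ^+ 2 - s ^+ 2) ^+ 2)).
    rewrite mulrAC ler_pdivrMr //; apply: ler_wpM2l; first exact: sqr_ge0.
    have -> : 4 * r ^+ 4 = (2 * r ^+ 2) ^+ 2 by ring.
    by rewrite lerXn2r ?nnegrE ?normc_ge0 //; lra.
  have sq1 x : 0 <= x -> x <= s -> x ^+ 2 <= s ^+ 2.
    by move=> x0 xs; rewrite lerXn2r ?nnegrE // ltW.
  have h1 := sq1 _ a0 as_; have h2 := sq1 _ (normc_ge0 z1) z1s.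
  by rewrite expr2; apply: ler_pM; rewrite ?(ltW rs2) // lerD2l lerN2.
have HM2 t : normc (G2 (circle r t)) <= M by rewrite circ.
have HN2 : M ^+ 2 * k ^+ N < normc (G2 z1) ^+ 2.
  have k00 : 0 < k.
    rewrite lt_def k0 andbT; apply/eqP => kz.
    by move: contr; rewrite kz mul0r leNgt exprn_gt0 // normc_gt0.
  rewrite -(ltr_pM2l k00); apply: lt_le_trans contr.
  by rewrite mulrCA -exprS.
have [v [hv vc vi vs [vz [S HS]]]] := IH G2 hG2 G2z1 HM2 HN2.
have den0 z : normc z * s < r ^+ 2 -> den z != 0.
  move=> zs; rewrite -normc_gt0; apply: lt_le_trans (normc_dist_ge _ _).
  rewrite normc_real normcMl normc_conj subr_gt0 ger0_norm ?(ltW rr0) //.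
  apply: le_lt_trans zs; rewrite mulrC; apply: ler_wpM2l => //; exact: normc_ge0.
have rC : ((r^-1)%:C%C : R[i]) != 0 by rewrite eq_complex /= eqxx andbT invr_eq0 gt_eqF.
exists v; split => //.
- by move=> t; rewrite vc circ.
- by move=> z zr; apply: le_trans (inside z zr) (vi z zr).
split.
  move=> z zr zs /(vz z zr zs)/eqP; rewrite /G2 !mulf_eq0 (negPf rC) (negPf (den0 z zs)) !orbF.
  by move=> /eqP G10; rewrite G1E G10 mulr0.
exists (a :: S) => z zs; rewrite G1E => /eqP; rewrite mulf_eq0 subr_eq0 inE => /orP[->//|/eqP G10].
by rewrite HS ?orbT // /G2 G10 mul0r.
Qed.

(** The lower bound for G at the single point z1 has to become one in the whole
  disc, although G may vanish there.  So G is replaced by the v of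
  [zero_free_factor]: A v is bounded by the maximum principle, since on the circle
  its modulus is that of A G, and Harnack's inequality carries the lower bound for
  v from z1 to z. *)
Lemma quotient_bound rho r s1 s2 s A G z z1 B K L :
  0 < s -> s < s2 -> s2 < s1 -> s1 < r -> r < rho -> hol rho A -> hol rho G ->
  (forall t, normc (A (circle r t) * G (circle r t)) <= expR B) ->
  (forall t, normc (G (circle r t)) <= expR K) -> 0 <= K ->
  normc z1 <= s -> expR (- L) <= normc (G z1) -> normc z <= s ->
  normc (A z) <= expR (B + harnack_constant s2 s ^+ 2 * (K + L)).
Proof.
move=> s0 ss2 s21 s1r rrho hA hG HB HK K0 z1s HL zs.
have Gz1 : G z1 != 0 by rewrite -normc_gt0; apply: lt_le_trans HL; exact: expR_gt0.
have r0 : 0 < r by lra.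
have s1r' : s1 < r < rho by rewrite s1r.
have s10 : 0 < s1 by lra.
have z1s1 : normc z1 <= s1 by lra.
have rr : 0 < r < rho by rewrite r0.
have [v [hv vc vi vs _]] := zero_free_factor s10 s1r' hG z1s1 Gz1.
have hAv := holM hA hv.
have Avb : normc (A z * v z) <= expR B.
  apply: (max_principle hAv rr) => [t|]; last lra.
  by rewrite normcMl vc -normcMl.
have vK t : normc (v (circle s2 t)) <= expR K.
  apply: (max_principle hv rr) => [t'|]; first by rewrite vc.
  rewrite normc_circle; lra.
have hv1 : hol s1 v by apply: hol_sub hv; lra.
have vs1 w : normc w < s1 -> v w != 0 by move=> /ltW; exact: vs.
have s221 : s < s2 < s1 by rewrite ss2.
have := harnack hv1 vs1 s221 zs z1s (expR_gt0 K) vK.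
rewrite expRK => h.
have vz0 : v z != 0 by apply: vs; lra.
have vz10 : v z1 != 0 by apply: vs.
have lnz1 : - L <= ln (normc (v z1)).
  rewrite -[- L]expRK ler_ln ?posrE ?expR_gt0 ?normc_gt0 //.
  by apply: le_trans HL _; apply: vi; lra.
set k2 := harnack_constant s2 s ^+ 2 in h *.
have k20 : 0 <= k2 by exact: sqr_ge0.
have lnz : - (k2 * (K + L)) <= ln (normc (v z)).
  have : k2 * (K - ln (normc (v z1))) <= k2 * (K + L) by apply: ler_wpM2l => //; lra.
  lra.
rewrite -(@ler_pM2r _ (normc (v z))) ?normc_gt0 // -normcMl; apply: le_trans Avb _.
have -> : normc (v z) = expR (ln (normc (v z))) by rewrite lnK // posrE normc_gt0.
by rewrite -expRD ler_expR; lra.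
Qed.

End Harnack.

(** * Poles and Nevanlinna's functions *)

Section Poles.
Variable R : realType.
Implicit Types (r t d e : R) (z w a b : R[i]) (f g v F G : R[i] -> R[i]).

Definition punctured_limit g b a := forall e, 0 < e -> exists2 d, 0 < d &
  forall w, w != b -> normc (w - b) < d -> normc (g w - a) <= e.

Lemma punctured_limitM g h b a a' : punctured_limit g b a -> punctured_limit h b a' ->
  punctured_limit (fun w => g w * h w) b (a * a').
Proof.
by move=> /ccvgP h1 /ccvgP h2; apply/ccvgP; exact: (cvgM h1 h2).
Qed.

Lemma punctured_limit_cont g b : ccont g b -> punctured_limit g b (g b).
Proof. by move=> cg e e0; have [d d0 hd] := cg e e0; exists d => // w _ /hd/ltW. Qed.

Lemma near_punctured_limit g h b a d : 0 < d ->
  (forall w, w != b -> normc (w - b) < d -> g w = h w) ->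
  punctured_limit g b a -> punctured_limit h b a.
Proof.
move=> d0 gh hg e e0; have [d' d'0 hd'] := hg e e0.
exists (Num.min d d') => [|w wb]; first by rewrite lt_min d0.
by rewrite lt_min => /andP[w1 w2]; rewrite -gh // hd'.
Qed.

Lemma punctured_limit_unique g b a a' : punctured_limit g b a -> punctured_limit g b a' -> a = a'.
Proof.
move=> h1 h2; apply/eqP; rewrite -subr_eq0 -normc_eq0 eq_le normc_ge0 andbT.
apply/ler_addgt0Pl => e e0; rewrite addr0; have e2 : 0 < e / 2 by rewrite divr_gt0.
have [d1 d10 k1] := h1 _ e2; have [d2 d20 k2] := h2 _ e2.
pose dl := Num.min d1 d2 / 2.
have dl0 : 0 < dl by rewrite divr_gt0 // lt_min d10.
have [l1 l2] : dl < d1 /\ dl < d2.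
  have := ltr_pdivrMr (Num.min d1 d2) (Num.min d1 d2) (ltr0Sn R 1).
  have m1 : Num.min d1 d2 <= d1 by rewrite ge_min lexx.
  have m2 : Num.min d1 d2 <= d2 by rewrite ge_min lexx orbT.
  have : 0 < Num.min d1 d2 by rewrite lt_min d10.
  by rewrite /dl => *; split; lra.
pose w := b + dl%:C%C.
have wb : w - b = dl%:C%C by rewrite /w addrC addKr.
have nwb : normc (w - b) = dl by rewrite wb normc_real gtr0_norm.
have wnb : w != b by rewrite -subr_eq0 -normc_gt0 nwb.
have q1 := k1 w wnb; have q2 := k2 w wnb; rewrite nwb in q1 q2.
have -> : a - a' = (g w - a') - (g w - a) by ring.
apply: le_trans (normcB _ _) _; have := q1 l1; have := q2 l2; lra.
Qed.

Lemma pole_of_orderP f z m : pole_of_order f z m <->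
  (0 < m)%N /\ exists2 a, a != 0 & punctured_limit (fun w => (w - z) ^+ m * f w) z a.
Proof.
split => -[m0 [a a0 h]]; split => //; exists a => //; exact/ccvgP.
Qed.

Lemma cdiff_not_pole f z : cdiff f z -> ~ pole f z.
Proof.
move=> df [m /pole_of_orderP[m0 [a a0 ha]]].
have h : punctured_limit (fun w => (w - z) ^+ m * f w) z ((z - z) ^+ m * f z).
  apply: (@punctured_limit_cont (fun w => (w - z) ^+ m * f w)); apply: cdiff_cont.
  by apply: cdiffM => //; apply: cdiffX; exact: cdiff_sub.
move: a0; rewrite (punctured_limit_unique ha h) subrr expr0n.
by rewrite gtn_eqF // mul0r eqxx.
Qed.

Lemma meromorphic_punctured f z : meromorphic f ->
  exists2 d, 0 < d & forall w, w != z -> normc (w - z) < d -> cdiff f w.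
Proof.
move=> /(_ z)[/cnbhsP[d d0 h]|[/cdnbhsP[d d0 h] _]]; exists d => // w wz wd.
  by apply/cdiffP; exact: h.
by apply/cdiffP; exact: h.
Qed.

Lemma meromorphic_not_pole f z : meromorphic f -> ~ pole f z -> cdiff f z.
Proof.
move=> /(_ z)[/cnbhsP[d d0 h]|[_]//] _; apply/cdiffP; apply: h.
by rewrite subrr normc00.
Qed.

(** Poles are isolated and the disc is compact. *)
Lemma finite_poles f r : meromorphic f ->
  exists2 S : seq R[i], uniq S & forall z, (z \in S) <-> (normc z <= r /\ pole f z).
Proof.
move=> mf.
have [S HS] : exists S : seq R[i], forall z, normc z <= r -> pole f z -> z \in S.
  apply: (@disc_induction _ (fun A => exists S : seq R[i], forall z, A z -> pole f z -> z \in S) r).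
  - by exists [::].
  - move=> A B [S hS] [T hT]; exists (S ++ T) => z [Az|Bz] pz; rewrite mem_cat.
      by rewrite hS.
    by rewrite hT ?orbT.
  - by move=> A B AB [S hS]; exists S => z /AB; exact: hS.
  - move=> p _; have [d d0 hd] := meromorphic_punctured p mf; exists d => //.
    exists [:: p] => z /= zd pz; rewrite inE; apply: contraPT pz => zp.
    by apply: cdiff_not_pole; exact: hd.
pose S' := [seq z <- undup S | (normc z <= r) && `[< pole f z >]].
exists S'; first by rewrite filter_uniq ?undup_uniq.
move=> z; rewrite mem_filter mem_undup; split.
  by move=> /andP[/andP[zr /asboolP pz] _].
by move=> [zr pz]; rewrite zr HS // andbT; exact/asboolP.
Qed.

Lemma pole_multP f z : pole f z -> pole_of_order f z (pole_mult f z).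
Proof. by move=> pz; rewrite /pole_mult; apply: xgetPex. Qed.

Lemma pole_mult0 f z : ~ pole f z -> pole_mult f z = 0%N.
Proof. by move=> np; rewrite /pole_mult xgetPN // => m hm; apply: np; exists m. Qed.

Lemma pole_countE f r t (S : seq R[i]) : uniq S ->
  (forall z, (z \in S) <-> (normc z <= r /\ pole f z)) -> t <= r ->
  pole_count t f = (\sum_(b <- S | (normc b <= t)%R) pole_mult f b)%N.
Proof.
move=> uS HS tr; rewrite /pole_count [RHS](bigfs _ (P := fun z => (normc z <= t)%R)) //.
move=> i it iS; apply: pole_mult0 => pi; move/negP: iS; apply; apply/HS; split => //.
exact: le_trans tr.
Qed.

Lemma pole_count_le f t t' : meromorphic f -> t <= t' -> (pole_count t f <= pole_count t' f)%N.
Proof.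
move=> mf tt; have [S uS HS] := finite_poles t' mf.
rewrite (pole_countE uS HS tt) (pole_countE uS HS (lexx _)).
rewrite [leqRHS](bigID (fun b => (normc b <= t)%R)) /=.
apply: leq_trans (leq_addr _ _).
by rewrite leq_eqVlt; apply/orP; left; apply/eqP/eq_bigl => b; case: (leP (normc b) t) => [h|]; rewrite ?andbF // (le_trans h).
Qed.

Lemma pole_count_near0 f : meromorphic f -> exists2 d, 0 < d &
  forall t, 0 <= t < d -> pole_count t f = pole_count 0 f.
Proof.
move=> mf; have [d d0 hd] := meromorphic_punctured 0 mf; exists d => // t /andP[t0 td].
have [S uS HS] := finite_poles t mf.
rewrite (pole_countE uS HS (lexx _)) (pole_countE uS HS t0).
rewrite big_seq_cond [RHS]big_seq_cond; apply: eq_bigl => b.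
case bS : (b \in S) => //=; have [/(_ bS)[bt pb] _] := HS b; rewrite bt.
have [->|b0] := eqVneq b 0; first by rewrite normc00 lexx.
by exfalso; apply: (cdiff_not_pole _ pb); apply: hd; rewrite ?subr0 //; exact: le_lt_trans td.
Qed.

Lemma proximity_ge0 f r : 0 <= proximity r f.
Proof.
rewrite /proximity mulr_ge0 ?invr_ge0 ?(ltW (twopi_gt0 R)) //.
by apply: Rintegral_ge0 => t _; rewrite le_max lexx orbT.
Qed.

(** On ]r, r'] the integrand of the counting function is at least
  [(n r - n 0) / r'], and the term [n 0 * ln r'] accounts for a pole at 0, since
  [ln r' >= 1 - r / r'] for r >= 1. *)
Lemma counting_ge f r r' : meromorphic f -> 1 <= r < r' ->
  (pole_count r f)%:R * ((r' - r) / r') <= counting_function r' f.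
Proof.
move=> mf /andP[r1 rr']; have r0 : 0 < r by lra. have r'0 : 0 < r' by lra.
set n := fun t => (pole_count t f)%:R : R.
have nle t t' : t <= t' -> n t <= n t'.
  by move=> h; rewrite /n ler_nat pole_count_le.
have n0 t : 0 <= n t by rewrite /n.
pose g t := (n t - n 0) / t.
have mI : measurable (`]0, r']%classic : set (measurableTypeR R)) by [].
have muI : (lebesgue_measure (`]0%R, r'] : set R) < +oo)%E.
  by rewrite lebesgue_measure_itv /=; case: ifP => _; rewrite ?ltry // -EFinB ltry.
have mV : measurable_fun (`]0, +oo[%classic : set (measurableTypeR R)) (@GRing.inv R : measurableTypeR R -> measurableTypeR R).
  apply: open_continuous_measurable_fun; first exact: interval_open.
  by move=> x; rewrite inE /= in_itv /= andbT => x0; apply: inv_continuous; exact: lt0r_neq0.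
have mg : measurable_fun `]0, r'] g.
  apply: measurable_funM.
    apply: measurable_funB; last exact: measurable_cst.
    by apply: nondecreasing_measurable => // x y; exact: nle.
  by apply: measurable_funS mV => // x /=; rewrite !in_itv /= => /andP[->].
have [d d0 hd] := pole_count_near0 mf.
have gb t : 0 < t <= r' -> 0 <= g t <= n r' / d.
  move=> /andP[t0 tr]; have [td|td] := ltP t d.
    have -> : g t = 0 by rewrite /g /n hd ?subrr ?mul0r // td ltW.
    by rewrite lexx divr_ge0 // ltW.
  have nt : 0 <= n t - n 0 by rewrite subr_ge0 nle // ltW.
  rewrite /g divr_ge0 //=; last exact: ltW.
  apply: ler_pM => //; [by rewrite invr_ge0 ltW| |by rewrite lef_pV2 ?posrE].
  by have := nle _ _ tr; have := n0 0; lra.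
have ig : lebesgue_measure.-integrable `]0, r'] (EFin \o g).
  apply: measurable_bounded_integrable => //.
  exists (n r' / d); split; first by rewrite num_real.
  move=> M HM t /=; rewrite in_itv /= => /gb /andP[g0 g1].
  by rewrite ger0_norm // (le_trans g1) // ltW.
pose c := (n r - n 0) / r'.
have c0 : 0 <= c by rewrite divr_ge0 ?subr_ge0 ?nle ?ltW.
pose h := (fun t => c * \1_(`]r, r']%classic : set R) t).
have mh : measurable_fun `]0, r'] h.
  by apply: measurable_funM; [exact: measurable_cst|exact: measurable_indic].
have ih : lebesgue_measure.-integrable `]0, r'] (EFin \o h).
  apply: measurable_bounded_integrable => //.
  exists c; split; first by rewrite num_real.
  move=> M HM t _ /=; rewrite /h ger0_norm; last by rewrite mulr_ge0.
  apply: le_trans (ltW HM); rewrite -[leRHS]mulr1; exact: ler_wpM2l.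
have hg t : `]0, r']%classic t -> h t <= g t.
  rewrite /= in_itv /= => /[dup] t0r /andP[t0 tr]; rewrite /h indicE.
  have /andP[g0 _] := gb t t0r.
  case: (boolP (t \in _)); last by rewrite mulr0.
  rewrite inE /= in_itv /= mulr1 => /andP[rt _]; rewrite /c /g.
  apply: ler_pM; rewrite ?subr_ge0 ?nle ?invr_ge0 ?(ltW r'0) ?(ltW r0) //.
    by rewrite lerB ?nle // ltW.
  by rewrite lef_pV2 ?posrE.
have Ih : \int[@lebesgue_measure R]_(t in `]0, r']) h t = c * (r' - r).
  rewrite /h RintegralZl //; last first.
    apply: measurable_bounded_integrable => //.
    exists 1; split; first by rewrite num_real.
    by move=> M HM t _ /=; rewrite ger0_norm // (le_trans _ (ltW HM)).
  congr (_ * _); rewrite /Rintegral integral_indic //.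
  have E : (`]r, r']%classic `&` `]0, r']%classic : set R) = `]r, r']%classic.
    apply/seteqP; split => t /=; rewrite !in_itv /=; first by case.
    by move=> /andP[t1 t2]; rewrite t1 t2 (lt_trans r0).
  have := @lebesgue_measure_itv R `]r, r']; rewrite /= lte_fin rr' -EFinB => E2.
  by rewrite [X in lebesgue_measure X]E [X in fine X]E2.
rewrite /counting_function -/(n 0).
have H1 : c * (r' - r) <= \int[@lebesgue_measure R]_(t in `]0, r']) g t.
  by rewrite -Ih; apply: le_Rintegral.
have H2 : (r' - r) / r' <= ln r'.
  have h1 : ln (r / r') <= r / r' - 1.
    have := @le_ln1Dx R (r / r' - 1); rewrite subrKC; apply.
    by rewrite ltrBDr addNr divr_gt0.
  have h2 : 0 <= ln r by exact: ln_ge0.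
  rewrite ln_div ?posrE // in h1; rewrite mulrBl divff ?gt_eqF //; lra.
apply: le_trans (lerD H1 (ler_wpM2l (n0 0) H2)).
by apply: le_of_eq; rewrite /c /n; field; rewrite gt_eqF.
Qed.

Lemma nevanlinna_bounds f r r' : meromorphic f -> 1 <= r < r' ->
  [/\ proximity r' f <= nevanlinna_characteristic r' f,
      (pole_count r f)%:R * ((r' - r) / r') <= nevanlinna_characteristic r' f &
      0 <= nevanlinna_characteristic r' f].
Proof.
move=> mf rr'; have h := counting_ge mf rr'; have hp := proximity_ge0 f r'.
have /andP[r1 rr] := rr'.
have h0 : 0 <= (pole_count r f)%:R * ((r' - r) / r').
  by rewrite mulr_ge0 // divr_ge0; lra.
by rewrite /nevanlinna_characteristic; split; lra.
Qed.

End Poles.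

(** * Meromorphic functions on a disc as quotients *)

Section DiscRepresentation.
Variable R : realType.
Implicit Types (r t d e s rho : R) (z w a b : R[i]) (f g v u F G Q : R[i] -> R[i]).

Lemma finite_isolated (S : seq R[i]) b : exists2 d, 0 < d &
  forall w, w != b -> normc (w - b) < d -> w \notin S.
Proof.
elim: S => [|a S [d d0 hd]]; first by exists 1.
have [->|ab] := eqVneq a b.
  by exists d => // w wb wd; rewrite inE negb_or wb hd.
exists (Num.min d (normc (a - b))); first by rewrite lt_min d0 normc_gt0 subr_eq0.
move=> w wb; rewrite lt_min => /andP[wd wa]; rewrite inE negb_or hd // andbT.
by apply/eqP => wa'; move: wa; rewrite wa' ltxx.
Qed.

(** Multiplication by the power of w - b turns the pole b into a removable
  singularity, and the remaining poles keep finite limits. *)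
Lemma clear_poles (m : R[i] -> nat) (S : seq R[i]) g rho : uniq S ->
  (forall w, normc w < rho -> w \notin S -> cdiff g w) ->
  (forall b, b \in S -> exists a, punctured_limit (fun w => (w - b) ^+ m b * g w) b a) ->
  exists2 u, hol rho u & forall w, w \notin S ->
    u w = \prod_(b <- S) (w - b) ^+ m b * g w.
Proof.
elim: S g => [|b S IH] g.
  by move=> _ hg _; exists g => [w wr|w _]; [exact: hg|rewrite big_nil mul1r].
move=> /= /andP[bS uS] hg hl.
have [a ha] := hl b (mem_head _ _).
pose h w := (w - b) ^+ m b * g w.
pose g1 w := if w == b then a else h w.
have g1h w : w != b -> g1 w = h w by rewrite /g1 => /negPf ->.
have dh w : normc w < rho -> w \notin b :: S -> cdiff h w.
  by move=> wr wS; apply: cdiffM; [apply: cdiffX; exact: cdiff_sub|exact: hg].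
have g1near b' : b' != b -> forall w, w != b' -> normc (w - b') < normc (b' - b) -> h w = g1 w.
  move=> bb w _ wd; rewrite g1h //; apply/eqP => wb; move: wd.
  by rewrite wb normc_distC ltxx.
have [| |u hu uE] := IH g1 uS.
- move=> w; have [->|wb] := eqVneq w b => wr wS.
    have [d d0 hd] := finite_isolated S b.
    apply: (@removable_singularity _ h b a (Num.min d (rho - normc b))) => //; first by rewrite lt_min d0 subr_gt0.
    move=> v vb; rewrite lt_min => /andP[vd vr]; apply: dh.
      by have := normc_dist_le v b; lra.
    by rewrite inE negb_or vb hd.
  apply: (@near_cdiff _ h); first by apply: dh => //; rewrite inE negb_or wb.
  exists (normc (w - b)); first by rewrite normc_gt0 subr_eq0.
  move=> v vw; have [->|vw'] := eqVneq v w; first by rewrite g1h.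
  exact: (g1near w wb v vw' vw).
- move=> b' b'S; have b'b : b' != b by apply: contra bS => /eqP <-.
  have [|a' ha'] := hl b'; first by rewrite inE b'S orbT.
  exists ((b' - b) ^+ m b * a').
  apply: (@near_punctured_limit _ (fun w => (w - b) ^+ m b * ((w - b') ^+ m b' * g w)) _ _ _ (normc (b' - b))).
  + by rewrite normc_gt0 subr_eq0.
  + by move=> w wb wd; rewrite -(g1near b') // /h mulrCA.
  + apply: punctured_limitM ha'; apply: (@punctured_limit_cont _ (fun w => (w - b) ^+ m b)).
    by apply: cdiff_cont; apply: cdiffX; exact: cdiff_sub.
exists u => // w; rewrite inE negb_or => /andP[wb wS].
by rewrite uE // g1h // big_cons /h mulrA [_ ^+ _ * \prod_(_ <- _) _]mulrC.
Qed.

(** Cut the interval into thirds, once for each element of L.  It is used to find a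
  circle that stays away from finitely many zeros and poles. *)
Lemma avoid_moduli (L : seq R) r r' : r < r' -> exists s s', [/\ r < s, s < s', s' < r' &
  forall x, x \in L -> ~~ (s <= x <= s')].
Proof.
move=> rr; elim: L => [|x L [s [s' [h1 h2 h3 h4]]]].
  by exists (r + (r' - r) / 3), (r + (r' - r) / 3 * 2); split => //; lra.
have [xs|xs] := leP x ((s + s') / 2).
  exists (s + (s' - s) / 3 * 2), s'; split; [lra|lra|lra|].
  move=> y; rewrite inE => /orP[/eqP ->|yL].
    by rewrite negb_and -!ltNge; apply/orP; left; lra.
  have := h4 y yL; rewrite !negb_and -!ltNge => /orP[?|?]; apply/orP; [left|right]; lra.
exists s, (s + (s' - s) / 3); split; [lra|lra|lra|].
move=> y; rewrite inE => /orP[/eqP ->|yL].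
  by rewrite negb_and -!ltNge; apply/orP; right; lra.
have := h4 y yL; rewrite !negb_and -!ltNge => /orP[?|?]; apply/orP; [left|right]; lra.
Qed.

Definition blaschke r a w : R[i] := r%:C%C * (w - a) / ((r ^+ 2)%:C%C - (a^*)%C * w).

Lemma blaschke_den_neq0 r s a w : normc a <= s -> normc w * s < r ^+ 2 ->
  (r ^+ 2)%:C%C - (a^*)%C * w != 0.
Proof.
move=> as_ zs; rewrite -normc_gt0; apply: lt_le_trans (normc_dist_ge _ _).
rewrite normc_real normcMl normc_conj subr_gt0 ger0_norm ?sqr_ge0 //.
apply: le_lt_trans zs; rewrite mulrC; apply: ler_wpM2l => //; exact: normc_ge0.
Qed.

Lemma blaschke_circle r a t : 0 < r -> normc a < r -> normc (blaschke r a (circle r t)) = 1.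
Proof.
move=> r0 ar; have cr : normc (circle r t) = r by rewrite normc_circle ?(ltW r0).
have den0 : (r ^+ 2)%:C%C - (a^*)%C * circle r t != 0.
  by apply: (blaschke_den_neq0 (lexx _)); rewrite cr expr2 ltr_pM2l.
have := blaschke_identity r a (circle r t); rewrite cr subrr mulr0 => /eqP.
rewrite subr_eq0 /blaschke normcMl normcMl normcVl normc_real gtr0_norm // -exprMn => /eqP E.
have E2 : normc ((r ^+ 2)%:C%C - (a^*)%C * circle r t) = r * normc (circle r t - a).
  by apply/eqP; rewrite -(@eqrXn2 _ 2) ?normc_ge0 ?mulr_ge0 ?normc_ge0 ?(ltW r0) //; apply/eqP.
by rewrite -E2 divff // normc_eq0.
Qed.

Lemma blaschke_le1 r a w : 0 < r -> normc a < r -> normc w < r -> normc (blaschke r a w) <= 1.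
Proof.
move=> r0 ar wr.
have den0 : (r ^+ 2)%:C%C - (a^*)%C * w != 0.
  apply: (blaschke_den_neq0 (ltW ar)); rewrite expr2 ltr_pM2r //.
rewrite /blaschke normcMl normcMl normcVl normc_real gtr0_norm //.
rewrite ler_pdivrMr ?normc_gt0 // mul1r.
rewrite -(@ler_pXn2r _ 2) ?nnegrE ?normc_ge0 ?mulr_ge0 ?normc_ge0 ?(ltW r0) //.
rewrite exprMn -subr_ge0 blaschke_identity mulr_ge0 //; rewrite subr_ge0 ler_pXn2r ?nnegrE ?normc_ge0 //; lra.
Qed.

Lemma blaschke_ge r a w d : 0 < r -> normc a < r -> normc w < r -> 0 < d -> d <= normc (w - a) ->
  d / (2 * r) <= normc (blaschke r a w).
Proof.
move=> r0 ar wr d0 dw.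
have den0 : (r ^+ 2)%:C%C - (a^*)%C * w != 0.
  by apply: (blaschke_den_neq0 (ltW ar)); rewrite expr2 ltr_pM2r.
rewrite /blaschke normcMl normcMl normcVl normc_real gtr0_norm //.
rewrite ler_pdivlMr ?normc_gt0 // mulrAC ler_pdivrMr ?mulr_gt0 //.
have -> : r * normc (w - a) * (2 * r) = normc (w - a) * (2 * r ^+ 2) by ring.
apply: ler_pM => //; [exact: ltW|exact: normc_ge0|].
apply: le_trans (normcB _ _) _; rewrite normc_real normcMl normc_conj ger0_norm ?sqr_ge0 //.
have : normc a * normc w <= r * r by apply: ler_pM; rewrite ?normc_ge0 // ltW.
by rewrite expr2; lra.
Qed.

Lemma hol_cont_nonzero g z : ccont g z -> g z != 0 -> exists2 d, 0 < d &
  forall w, normc (w - z) < d -> g w != 0.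
Proof.
move=> cg gz; have gz0 : 0 < normc (g z) by rewrite normc_gt0.
have [d d0 hd] := cg _ gz0; exists d => // w /hd; apply: contraTneq => ->.
by rewrite sub0r normcNE ltxx.
Qed.

(** The Poisson-Jensen inequality.  Let Q be the Blaschke product of the poles in a
  disc whose boundary circle avoids the zeros and poles of f, and u = Q f.  Dividing
  out the zeros of u gives v without zeros, with the modulus of f on the circle and
  with at least the modulus of u inside; so [log_norm_upper] bounds u by the
  proximity function.  Each factor of Q is at least [d / (2 * r)] at a point whose
  distance to the poles is at least d. *)
Lemma meromorphic_disc_rep f z0 r1 r2 : meromorphic f -> ~ pole f z0 -> f z0 != 0 ->
  0 < r1 -> normc z0 <= r1 -> r1 < r2 ->
  exists r Q u, [/\ (r1 + r2) / 2 < r < r2, hol r Q, hol r u,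
   (forall w, normc w <= r1 -> normc (Q w) <= 1 /\
      normc (u w) <= expR (harnack_constant ((r1 + r2) / 2) r1 * proximity r f)) &
   (forall w, normc w < r -> ~ pole f w -> u w = Q w * f w) /\
   (forall w d, normc w < r -> 0 < d -> d <= 2 * r -> (forall b, pole f b -> d <= normc (w - b)) ->
      (d / (2 * r)) ^+ pole_count r f <= normc (Q w))].
Proof.
move=> mf pz0 fz0 r10 z0r r12.
have [rm [rmE rm1 rm2]] : exists rm, [/\ (r1 + r2) / 2 = rm, r1 < rm & rm < r2].
  by exists ((r1 + r2) / 2); split; lra.
rewrite rmE {rmE}.
have poles_lim b : pole f b -> exists a, punctured_limit (fun w => (w - b) ^+ pole_mult f b * f w) b a.
  by move=> /pole_multP/pole_of_orderP[_ [a _ ha]]; exists a.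
have [S0 uS0 HS0] := finite_poles r2 mf.
have [||u0 hu0 u0E] := @clear_poles (pole_mult f) S0 f r2 uS0.
- move=> w wr wS; apply: (@meromorphic_not_pole _ f w mf) => pw.
  by move/negP: wS; apply; apply/HS0; split; [exact: ltW|exact: pw].
- by move=> b /HS0[_ pb]; exact: poles_lim.
have z0S : z0 \notin S0 by apply/negP => /HS0[_ pz]; exact: pz0 pz.
have u0z0 : u0 z0 != 0.
  rewrite u0E // mulf_neq0 // prodf_seq_neq0; apply/allP => b bS /=.
  by rewrite expf_neq0 // subr_eq0; apply: contraNneq z0S => ->.
have [r3 [rm3 r3r2]] : exists r3, rm < r3 /\ r3 < r2.
  by exists ((rm + r2) / 2); split; lra.
have [r4 r34] : exists r4, r3 < r4 < r2.
  by exists ((r3 + r2) / 2); apply/andP; split; lra.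
have r30 : 0 < r3 by lra.
have z0r3 : normc z0 <= r3 by lra.
have [_ [_ _ _ _ [_ [Z HZ]]]] := zero_free_factor r30 r34 hu0 z0r3 u0z0.
have [s [s' [rs ss s'r avoid]]] := avoid_moduli ([seq normc z | z <- S0] ++ [seq normc z | z <- Z]) rm3.
have avS z : z \in S0 -> ~~ (s <= normc z <= s').
  by move=> zS; apply: avoid; rewrite mem_cat map_f.
have avZ z : z \in Z -> ~~ (s <= normc z <= s').
  by move=> zS; apply: avoid; rewrite mem_cat [X in _ || X]map_f ?orbT.
have [r [sr rs']] : exists r, s < r /\ r < s' by exists ((s + s') / 2); split; lra.
have r1s : r1 < s := lt_trans rm1 rs.
have r1r : r1 < r := lt_trans r1s sr.
have s0 : 0 < s := lt_trans r10 r1s.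
have r0 : 0 < r := lt_trans s0 sr.
pose S := [seq b <- S0 | normc b < r].
have uS : uniq S by rewrite filter_uniq.
have HS z : normc z < s' -> (z \in S) <-> pole f z.
  move=> zs; rewrite mem_filter; split; first by move=> /andP[_ /HS0[_ pz]]; exact: pz.
  move=> pz; have zS0 : z \in S0 by apply/HS0; split; [lra|exact: pz].
  rewrite zS0 andbT; have := avS z zS0; rewrite negb_and -!ltNge => /orP[zs1|/(lt_trans zs)].
    exact: lt_trans zs1 sr.
  by rewrite ltxx.
have Sless b : b \in S -> normc b < s.
  rewrite mem_filter => /andP[br bS]; have := avS b bS.
  by rewrite negb_and -!ltNge => /orP[//|?]; lra.
have [||u1 hu1 u1E] := @clear_poles (pole_mult f) S f s' uS.
- by move=> w ws wS; apply: (@meromorphic_not_pole _ f w mf) => /(HS w ws); exact/negP.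
- by move=> b; rewrite mem_filter => /andP[_ /HS0[_ pb]]; exact: poles_lim.
pose den b w := (r ^+ 2)%:C%C - (b^*)%C * w.
pose rho := Num.min s' (r ^+ 2 / s).
have rrho : r < rho by rewrite lt_min rs' ltr_pdivlMr // expr2 ltr_pM2l.
have den0 b w : b \in S -> normc w < rho -> den b w != 0.
  move=> /Sless/ltW bs; rewrite lt_min ltr_pdivlMr // => /andP[_ ws].
  exact: (blaschke_den_neq0 bs).
have dden b w : cdiff (den b) w.
  exact: cdiff_linear.
pose E w := \prod_(b <- S) (r%:C%C / den b w) ^+ pole_mult f b.
pose u w := E w * u1 w.
pose Q w := \prod_(b <- S) blaschke r b w ^+ pole_mult f b.
have hE : hol rho E.
  move=> w wr; rewrite /E.
  apply: (@eq_cdiff _ (fun w => \prod_(b <- S | b \in S) (r%:C%C / den b w) ^+ pole_mult f b)).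
    by move=> v; rewrite -big_seq.
  apply: (@cdiff_prod R _ S (fun b => b \in S) (fun b w => (r%:C%C / den b w) ^+ pole_mult f b) w) => b bS.
  apply: (cdiffX (g := fun w => r%:C%C / den b w)).
  by apply: cdiffM; [exact: cdiff_cst|apply: cdiffV; [exact: den0|exact: dden]].
have hQ : hol rho Q.
  move=> w wr; rewrite /Q.
  apply: (@eq_cdiff _ (fun w => \prod_(b <- S | b \in S) blaschke r b w ^+ pole_mult f b)).
    by move=> v; rewrite -big_seq.
  apply: (@cdiff_prod R _ S (fun b => b \in S) (fun b w => blaschke r b w ^+ pole_mult f b) w) => b bS.
  apply: (cdiffX (g := blaschke r b)).
  apply: cdiffM; last by apply: cdiffV; [exact: den0|exact: dden].
  by apply: cdiffM; [exact: cdiff_cst|exact: cdiff_sub].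
have rhos' : rho <= s' by rewrite ge_min lexx.
have hu : hol rho u by apply: holM => //; exact: hol_sub hu1.
have uQ w : normc w < rho -> ~ pole f w -> u w = Q w * f w.
  move=> wr pw; rewrite /u u1E; last by apply/negP => /(HS _ (lt_le_trans wr rhos')) h; exact: pw h.
  rewrite mulrA; congr (_ * _); rewrite /E /Q -big_split /=; apply: eq_bigr => b _.
  by rewrite -exprMn; congr (_ ^+ _); rewrite /blaschke mulrAC.
have E0 w : normc w < rho -> E w != 0.
  move=> wr; rewrite prodf_seq_neq0; apply/allP => b bS /=.
  rewrite expf_neq0 // mulf_neq0 ?invr_eq0 ?den0 //.
  by rewrite eq_complex /= eqxx andbT gt_eqF.
have P0 w : w \notin S -> \prod_(b <- S) (w - b) ^+ pole_mult f b != 0.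
  move=> wS; rewrite prodf_seq_neq0; apply/allP => b bS /=.
  by rewrite expf_neq0 // subr_eq0; apply: contraNneq wS => ->.
have uzero w : normc w < rho -> u w = 0 -> normc w < s.
  move=> wr; have [wS|wS] := boolP (w \in S); first by move=> _; exact: Sless.
  move=> /eqP; rewrite /u mulf_eq0 (negPf (E0 w wr)) u1E // mulf_eq0 (negPf (P0 w wS)) => /eqP fw.
  have ws' : normc w < s' := lt_le_trans wr rhos'.
  have npw : ~ pole f w by move=> pw; move/negP: wS; apply; apply/(HS w ws'); exact: pw.
  have wS0 : w \notin S0 by apply/negP => /HS0[_ pw]; exact: npw pw.
  have wZ : w \in Z by apply: HZ; [exact: ltW (lt_trans ws' s'r)|rewrite u0E // fw mulr0].
  have := avZ w wZ; rewrite negb_and -!ltNge => /orP[//|/(lt_trans ws')].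
  by rewrite ltxx.
have z0s : normc z0 <= s := le_trans z0r (ltW r1s).
have z0rho : normc z0 < rho := le_lt_trans z0s (lt_trans sr rrho).
have uz0 : u z0 != 0.
  have z0S' : z0 \notin S by apply/negP => /(HS _ (lt_le_trans z0rho rhos')) h; exact: pz0 h.
  by rewrite /u u1E // !mulf_neq0 ?E0 ?P0.
have srrho : s < r < rho by rewrite sr.
have [v [hv vc vi vs [vz _]]] := zero_free_factor s0 srrho hu z0s uz0.
have v0 w : normc w < rho -> v w != 0.
  move=> wr; apply/eqP => vw.
  have ws : normc w * s < r ^+ 2.
    by rewrite -ltr_pdivlMr //; move: wr; rewrite lt_min => /andP[].
  by have := vs w (ltW (uzero w wr (vz w wr ws vw))); rewrite vw eqxx.
have Sr b : b \in S -> normc b < r by move=> /Sless bs; exact: lt_trans bs sr.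
have circle_eq t : normc (v (circle r t)) = normc (f (circle r t)).
  have cr : normc (circle r t) = r by rewrite normc_circle ?(ltW r0).
  have npc : ~ pole f (circle r t).
    move=> pc; have /Sr : circle r t \in S by apply/HS; [rewrite cr; exact: rs'|exact: pc].
    by rewrite cr ltxx.
  have crho : normc (circle r t) < rho by rewrite cr.
  rewrite vc (uQ _ crho npc) normcMl /Q normc_prod big_seq big1 ?mul1r // => b /Sr bS.
  by rewrite normcX blaschke_circle // expr1n.
exists r, Q, u; split.
- by rewrite (lt_trans rs sr) (lt_trans rs' (lt_trans s'r r3r2)).
- exact: hol_sub (ltW rrho) hQ.
- exact: hol_sub (ltW rrho) hu.
- move=> w wr1; split.
    rewrite /Q normc_prod big_seq; apply: prodr_ile1 => b /Sr bS.
    rewrite normc_ge0 normcX; apply: exprn_ile1; rewrite ?normc_ge0 //.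
    apply: blaschke_le1 => //; exact: le_lt_trans wr1 r1r.
  have w_r : normc w < r := le_lt_trans wr1 r1r.
  have w_rho : normc w < rho := lt_trans w_r rrho.
  apply: le_trans (vi w (ltW w_r)) _.
  have r1r' : r1 < r < rho by rewrite r1r.
  rewrite -[leLHS]lnK ?posrE ?normc_gt0 ?v0 // ler_expR.
  apply: le_trans (log_norm_upper hv v0 r1r' wr1) _.
  rewrite (_ : _^-1 * _ = proximity r f); last first.
    rewrite /proximity; congr (_ * _); apply: eq_period_integral => t.
    by rewrite circle_eq.
  apply: ler_wpM2r; first exact: proximity_ge0.
  apply: harnack_constant_anti (ltW (lt_trans rs sr)).
  by rewrite (ltW r10) rm1.
split; first by move=> w wr pw; exact: uQ (lt_trans wr rrho) pw.
move=> w d wr d0 dr hd.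
have HSr z : (z \in S) <-> (normc z <= r /\ pole f z).
  split; first by move=> zS; split; [exact/ltW/Sr|apply/(HS z); [exact: lt_trans (Sr z zS) rs'|exact: zS]].
  by move=> [zr pz]; apply/(HS z); [exact: le_lt_trans zr rs'|exact: pz].
rewrite (pole_countE uS HSr (lexx _)) /Q normc_prod.
rewrite big_seq_cond (eq_bigl (mem S)); last first.
  by move=> b /=; case: (boolP (b \in S)) => //= /Sr/ltW ->.
rewrite -prodrXr [leRHS]big_seq; apply: ler_prod => b bS.
have dd : 0 <= d / (2 * r) by apply: divr_ge0; [exact: ltW|apply: mulr_ge0 => //; exact: ltW].
have pb : pole f b.
  by apply/(HS b); [exact: lt_trans (Sr b bS) rs'|exact: bS].
have hb := blaschke_ge r0 (Sr b bS) wr d0 (hd b pb).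
by apply/andP; split; [exact: exprn_ge0|rewrite normcX; apply: lerXn2r; rewrite ?nnegrE ?normc_ge0].
Qed.

End DiscRepresentation.

(** * Iterated exponentials and logarithms *)

Section Asymptotics.
Variable R : realType.
Implicit Types (x y a b r s t C : R) (n p q : nat).

Definition iterexp n x : R := iter n (@expR R) x.

Lemma iterexpS n x : iterexp n.+1 x = expR (iterexp n x).
Proof. by []. Qed.

Lemma iterexpSr n x : iterexp n.+1 x = iterexp n (expR x).
Proof. exact: iterSr. Qed.

Lemma ler_iterexp n x y : x <= y -> iterexp n x <= iterexp n y.
Proof. by move=> xy; elim: n => //= n IH; rewrite ler_expR. Qed.

Lemma expR_ge x : x <= expR x.
Proof. by apply: le_trans (expR_ge1Dx x); rewrite lerDr. Qed.

Lemma iterexp_ge n x : x <= iterexp n x.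
Proof. by elim: n => //= n IH; apply: le_trans IH (expR_ge _). Qed.

Lemma iterexp_le n m x : (n <= m)%N -> iterexp n x <= iterexp m x.
Proof.
move=> /subnKC <-; elim: (m - n)%N => [|k IH]; first by rewrite addn0.
by rewrite addnS; apply: le_trans IH (expR_ge _).
Qed.

(** As [ln] is 0 on nonpositive arguments, [iterlog n] and [iterexp n] are inverse
  to each other only for large arguments; this adjunction and its converse below
  hold for every x. *)
Lemma iterlog_le n x y : 0 <= y -> x <= iterexp n y -> iterlog n x <= y.
Proof.
elim: n x => [|n IH] x y0 h //.
rewrite /iterlog iterSr -/(iterlog n _); apply: IH => //.
have [x0|x0] := leP x 0; first by rewrite ln0 //; apply: le_trans y0 (iterexp_ge n y).
by rewrite -ler_expR lnK.
Qed.

Lemma ln_le_expR x y : ln x <= y -> x <= expR y.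
Proof.
move=> h; have [x0|x0] := leP x 0; first by apply: le_trans x0 _; exact/ltW/expR_gt0.
by rewrite -[x]lnK ?posrE // ler_expR.
Qed.

Lemma le_iterexp n x y : iterlog n x <= y -> x <= iterexp n y.
Proof.
elim: n x y => [|n IH] x y //; rewrite /iterlog iterSr -/(iterlog n _) => /IH.
exact: ln_le_expR.
Qed.

Lemma iterlogS n x : iterlog n.+1 x = ln (iterlog n x).
Proof. by []. Qed.

Lemma near_ge C : \forall r \near +oo, C <= r.
Proof. by apply: nbhs_pinfty_ge; exact: num_real. Qed.

Lemma near_gt C : \forall r \near +oo, C < r.
Proof. by apply: nbhs_pinfty_gt; exact: num_real. Qed.

Lemma pinfty_geS x0 (P : R -> Prop) : (forall r, x0 <= r -> P r) -> \forall r \near +oo, P r.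
Proof. by move=> h; near=> r; apply: h; near: r; exact: near_ge. Unshelve. all: by end_near. Qed.

Lemma pinfty_exists (P : R -> Prop) : (\forall r \near +oo, P r) ->
  exists x0, forall r, x0 <= r -> P r.
Proof.
move=> [M [_ HM]]; exists (M + 1) => r Mr; apply: HM; lra.
Qed.

Lemma pinfty_scale (P : R -> Prop) C : 1 <= C ->
  (\forall r \near +oo, P r) -> \forall r \near +oo, P (C * r).
Proof.
move=> C1 /pinfty_exists[x0 h]; apply: (@pinfty_geS (Num.max 0 x0)) => r.
rewrite ge_max => /andP[r0 xr]; apply: h; apply: le_trans xr _.
by rewrite ler_peMl.
Qed.

Lemma iterlog_pinfty n C : \forall r \near +oo, C <= iterlog n r.
Proof.
elim: n C => [|n IH] C; first exact: near_ge.
apply: filterS (IH (expR C)) => r h; rewrite iterlogS -ler_expR lnK //.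
by rewrite posrE; apply: lt_le_trans h; exact: expR_gt0.
Qed.

Lemma iterlog_mono n : exists x0, forall r s, x0 <= r -> r <= s -> iterlog n r <= iterlog n s.
Proof.
elim: n => [|n [x0 h]]; first by exists 0.
have [x1 h1] := pinfty_exists (iterlog_pinfty n 1).
exists (Num.max x0 x1) => r s; rewrite ge_max => /andP[r0 r1] rs.
rewrite !iterlogS ler_ln ?posrE; [exact: h|by apply: lt_le_trans (h1 r r1)|].
by apply: lt_le_trans (h1 s (le_trans r1 rs)).
Qed.

(** [ln (C * x) = ln C + ln x] is at most [C * ln x] as soon as [ln x >= 1]. *)
Lemma iterlog_dilate n C : 1 <= C -> \forall r \near +oo, iterlog n (C * r) <= C * iterlog n r.
Proof.
move=> C1; elim: n => [|n IH]; first by apply: nearW => r.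
near=> r.
have h1 : expR 1 <= iterlog n r by near: r; exact: iterlog_pinfty.
have h2 : iterlog n (C * r) <= C * iterlog n r by near: r.
have l0 : 0 < iterlog n r by apply: lt_le_trans h1; exact: expR_gt0.
have C0 : 0 < C by lra.
rewrite !iterlogS; apply: (@le_trans _ _ (ln (C * iterlog n r))).
  have [h|h] := leP (iterlog n (C * r)) 0.
    rewrite ln0 //; apply: ln_ge0; rewrite -[1]mulr1; apply: ler_pM => //.
    by apply: le_trans h1; apply: le_trans (expR_ge1Dx _); lra.
  by rewrite ler_ln ?posrE // mulr_gt0.
rewrite lnM ?posrE //.
have h3 : 1 <= ln (iterlog n r) by rewrite -ler_expR lnK.
have h4 : ln C <= C - 1 by have := @le_ln1Dx R (C - 1); rewrite subrKC; apply; lra.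
have h5 : 0 <= (C - 1) * (ln (iterlog n r) - 1) by rewrite mulr_ge0; lra.
lra.
Unshelve. all: by end_near. Qed.

Lemma iterexpK n : \forall r \near +oo, iterexp n (iterlog n r) = r.
Proof.
elim: n => [|n IH]; first by apply: nearW.
near=> r; rewrite iterexpSr iterlogS lnK; first by near: r.
by rewrite posrE; apply: (lt_le_trans ltr01); near: r; exact: iterlog_pinfty.
Unshelve. all: by end_near. Qed.

(** For n = 1: [expR a + C * expR b <= expR a * expR (C * b)], because
  [C * expR b <= expR (C * b)] and because both factors are at least 2. *)
Lemma iterexp_add n C a b : 1 <= C -> 1 <= a -> 1 <= b ->
  iterexp n a + C * iterexp n b <= iterexp n (a + C * b).
Proof.
move=> C1 a1 b1; elim: n => [|n IH] //; rewrite !iterexpS.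
set x := iterexp n a in IH *; set y := iterexp n b in IH *.
have x1 : 1 <= x by apply: le_trans a1 (iterexp_ge _ _).
have y1 : 1 <= y by apply: le_trans b1 (iterexp_ge _ _).
apply: (@le_trans _ _ (expR (x + C * y))); last by rewrite ler_expR.
rewrite expRD.
have X2 : 2 <= expR x by apply: le_trans (expR_ge1Dx _); lra.
have Y2 : 2 <= expR y by apply: le_trans (expR_ge1Dx _); lra.
have YC : C * expR y <= expR (C * y).
  have -> : C * y = y + (C - 1) * y by ring.
  rewrite expRD mulrC ler_pM2l ?expR_gt0 //.
  apply: le_trans (expR_ge1Dx _); nra.
have Y3 : 2 <= expR (C * y) by apply: le_trans YC; nra.
nra.
Qed.

Lemma iterexp_mul n a b : 2 <= a -> 2 <= b ->
  iterexp n a * iterexp n b <= iterexp n (a * b).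
Proof.
move=> a2 b2; elim: n => [|n IH] //; rewrite !iterexpS -expRD ler_expR.
apply: le_trans IH.
have x2 : 2 <= iterexp n a by apply: le_trans a2 (iterexp_ge _ _).
have y2 : 2 <= iterexp n b by apply: le_trans b2 (iterexp_ge _ _).
nra.
Qed.

Lemma le_expR_linear e y : 0 < e -> 4 / e ^+ 2 <= y -> y <= expR (e * y).
Proof.
move=> e0 ye; have e20 : 0 < e ^+ 2 by rewrite exprn_gt0.
have y0 : 0 < y by apply: lt_le_trans ye; rewrite divr_gt0.
have -> : e * y = e * y / 2 + e * y / 2 by field.
(* y is at most the square of t, and t is at most [expR t] *)
rewrite expRD; set t := e * y / 2.
have t0 : 0 < t by rewrite divr_gt0 ?mulr_gt0.
have h : t <= expR t := expR_ge t.
apply: (@le_trans _ _ (t * t)); last by apply: ler_pM => //; exact: ltW.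
have -> : t * t = (e ^+ 2 / 4 * y) * y by rewrite /t; field.
rewrite -[leLHS]mul1r ler_pM2r //.
by move: ye; rewrite ler_pdivrMr // => ye; rewrite mulrAC ler_pdivlMr // mul1r mulrC.
Qed.

Section Level.
Variables (q : nat).
Let Lam r : R := iterlog q r.

Lemma powRD_gt0 x a b : 0 < x -> x `^ (a + b) = x `^ a * x `^ b.
Proof. by move=> x0; rewrite powRD // (gt_eqF x0) implybT. Qed.

Lemma powR_expR x y : 0 < x -> x `^ y = expR (y * ln x).
Proof. by move=> x0; rewrite /powR gt_eqF. Qed.

Lemma iterexp_log n s : \forall r \near +oo, iterexp n.+1 (s * iterlog q.+1 r) = iterexp n (Lam r `^ s).
Proof.
near=> r; rewrite iterexpSr powR_expR //.
by apply: (lt_le_trans ltr01); near: r; exact: iterlog_pinfty.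
Unshelve. all: by end_near. Qed.

Lemma powR_pinfty C e : 0 < e -> \forall r \near +oo, C <= Lam r `^ e.
Proof.
move=> e0; near=> r.
have L1 : 0 < Lam r by apply: (lt_le_trans ltr01); near: r; exact: iterlog_pinfty.
rewrite powR_expR //; apply: le_trans (expR_ge _).
by rewrite mulrC -ler_pdivrMr //; near: r; exact: (iterlog_pinfty q.+1).
Unshelve. all: by end_near. Qed.

Lemma powR_absorb C s s' : s < s' -> \forall r \near +oo, C * Lam r `^ s <= Lam r `^ s'.
Proof.
move=> ss; near=> r.
have L1 : 0 < Lam r by apply: (lt_le_trans ltr01); near: r; exact: iterlog_pinfty.
rewrite -[s'](subrK s) powRD_gt0 //; apply: ler_wpM2r; first exact: powR_ge0.
by near: r; apply: powR_pinfty; rewrite subr_gt0.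
Unshelve. all: by end_near. Qed.

Lemma powR_dilate C s : 1 <= C -> 0 <= s ->
  \forall r \near +oo, Lam (C * r) `^ s <= C `^ s * Lam r `^ s.
Proof.
move=> C1 s0; near=> r.
have L1 : 0 <= Lam r by apply: (le_trans ler01); near: r; exact: iterlog_pinfty.
have L2 : 0 <= Lam (C * r).
  apply: (le_trans ler01); near: r; apply: (@pinfty_scale (fun r => 1 <= Lam r) C); first by lra.
  exact: iterlog_pinfty.
rewrite -powRM //; last by lra.
apply: ge0_ler_powR; rewrite ?nnegrE //; first by rewrite mulr_ge0 //; lra.
by near: r; exact: iterlog_dilate.
Unshelve. all: by end_near. Qed.

(** [r = iterexp q (Lam r)] and [Lam r <= expR (Lam r `^ e)], so r is at most
  [iterexp q.+1 (Lam r `^ e)].  This is where q <= n is needed: it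
  makes a factor [ln r] harmless for functions whose growth is measured by
  [iterexp n]. *)
Lemma ln_le_iterexp n e : (q <= n)%N -> 0 < e ->
  \forall r \near +oo, ln r <= iterexp n (Lam r `^ e).
Proof.
move=> qn e0; near=> r.
have L1 : 0 < Lam r by apply: (lt_le_trans ltr01); near: r; exact: iterlog_pinfty.
have r0 : 0 < r by near: r; exact: near_gt.
rewrite -ler_expR lnK // -iterexpS.
have E : iterexp q (Lam r) = r by near: r; exact: iterexpK.
rewrite -[leLHS]E.
apply: (@le_trans _ _ (iterexp q.+1 (Lam r `^ e))); last by apply: iterexp_le; rewrite ltnS.
rewrite iterexpSr; apply: ler_iterexp.
rewrite -[leLHS]lnK ?posrE // ler_expR powR_expR //.
by apply: le_expR_linear => //; near: r; exact: (iterlog_pinfty q.+1).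
Unshelve. all: by end_near. Qed.

(** A dilation of the argument, a constant and a factor [ln r] together cost only
  an increase of the exponent s.  The factor [ln r] is the price of one pole. *)
Lemma iterexp_product n C D s s' : (q <= n)%N -> 1 <= D -> 0 < s -> s < s' ->
  \forall r \near +oo, C * iterexp n (Lam (D * r) `^ s) * ln r <= iterexp n (Lam r `^ s').
Proof.
move=> qn D1 s0 ss.
pose e := (s' - s) / 4; have e0 : 0 < e by rewrite divr_gt0 // subr_gt0.
near=> r.
have L1 : 0 < Lam r by apply: (lt_le_trans ltr01); near: r; exact: iterlog_pinfty.
have h1 : ln r <= iterexp n (Lam r `^ e) by near: r; exact: ln_le_iterexp.
have h2 : Lam (D * r) `^ s <= D `^ s * Lam r `^ s by near: r; apply: powR_dilate => //; exact: ltW.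
have h3 : D `^ s * Lam r `^ s <= Lam r `^ (s + e) by near: r; apply: powR_absorb; rewrite ltrDl.
have h4 : 2 <= Lam r `^ e by near: r; exact: powR_pinfty.
have h5 : C <= Lam r `^ e by near: r; exact: powR_pinfty.
have h6 : 2 <= Lam r `^ (s + e) by near: r; apply: powR_pinfty; lra.
have h7 : 0 <= ln r by apply: ln_ge0; near: r; exact: near_ge.
have h8 : Lam r `^ e <= iterexp n (Lam r `^ e) := iterexp_ge _ _.
have h9 : iterexp n (Lam (D * r) `^ s) <= iterexp n (Lam r `^ (s + e)).
  by apply: ler_iterexp; exact: le_trans h2 h3.
set X := iterexp n (Lam (D * r) `^ s) in h9 *.
have X0 : 0 <= X by apply: le_trans (iterexp_ge _ _); exact: powR_ge0.
set Y := iterexp n (Lam r `^ (s + e)) in h9 *; set Z := iterexp n (Lam r `^ e) in h1 h8.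
have Y0 : 0 <= Y := le_trans X0 h9.
have Z0 : 0 <= Z by lra.
apply: (@le_trans _ _ (Z * Y * Z)).
  apply: (@le_trans _ _ (Z * Y * ln r)).
    apply: ler_wpM2r => //; apply: (@le_trans _ _ (Z * X)).
      by apply: ler_wpM2r => //; lra.
    exact: ler_wpM2l.
  by apply: ler_wpM2l => //; rewrite mulr_ge0.
have k1 : Z * Y <= iterexp n (Lam r `^ (e + (s + e))).
  rewrite powRD_gt0 //; exact: iterexp_mul.
have h10 : 2 <= Lam r `^ (e + (s + e)) by near: r; apply: powR_pinfty; lra.
apply: (@le_trans _ _ (iterexp n (Lam r `^ (e + (s + e))) * Z)); first exact: ler_wpM2r.
apply: le_trans (iterexp_mul n h10 h4) _.
apply: ler_iterexp; rewrite -powRD_gt0 //.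
have L11 : 1 <= Lam r by near: r; exact: iterlog_pinfty.
by apply: ler_powR => //; rewrite /e; lra.
Unshelve. all: by end_near. Qed.

(** A dilation by 1 + d multiplies [Lam r `^ rho] at most by [(1 + d) `^ rho]; d is
  chosen so that this replaces t by the midpoint of t and t1.  The remaining gap
  absorbs the second term, whose exponent is smaller.  Note that d depends neither
  on C nor on D, which will be functions of d. *)
Lemma growth_comparison n t t1 s rho : 0 < t -> t < t1 -> 0 < s -> s < rho ->
  exists2 d : R, 0 < d & forall C D, 1 <= C -> 1 <= D -> \forall r \near +oo,
   iterexp n (t * Lam ((1 + d) * r) `^ rho) + C * iterexp n (Lam (D * r) `^ s)
   <= iterexp n (t1 * Lam r `^ rho).
Proof.
move=> t0 tt s0 srho; have rho0 : 0 < rho by lra.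
pose t2 := (t + t1) / 2; have tt2 : t < t2 by rewrite /t2; lra.
have t21 : t2 < t1 by rewrite /t2; lra.
pose k := (t2 / t) `^ rho^-1.
have tq1 : 1 < t2 / t by rewrite ltr_pdivlMr // mul1r.
have k1 : 1 < k.
  have := @gt0_ltr_powR R rho^-1; rewrite invr_gt0 => /(_ rho0 1 (t2 / t)).
  by rewrite powR1 !nnegrE; apply => //; lra.
have kr : k `^ rho = t2 / t.
  by rewrite /k -powRrM mulVf ?gt_eqF // powRr1 //; lra.
exists (k - 1) => [|C D C1 D1]; first by lra.
rewrite subrKC.
near=> r.
have L1 : 0 < Lam r by apply: (lt_le_trans ltr01); near: r; exact: iterlog_pinfty.
have h1 : Lam (k * r) `^ rho <= k `^ rho * Lam r `^ rho by near: r; apply: powR_dilate; lra.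
have h2 : Lam (D * r) `^ s <= D `^ s * Lam r `^ s by near: r; apply: powR_dilate => //; exact: ltW.
have h3 : (C * D `^ s / (t1 - t2)) * Lam r `^ s <= Lam r `^ rho by near: r; apply: powR_absorb.
have h4 : 1 / t <= Lam (k * r) `^ rho.
  near: r; apply: (@pinfty_scale (fun r => 1 / t <= Lam r `^ rho) k); first by lra.
  exact: powR_pinfty.
have h5 : 1 <= Lam (D * r) `^ s.
  near: r; apply: (@pinfty_scale (fun r => 1 <= Lam r `^ s) D); first by lra.
  exact: powR_pinfty.
apply: le_trans (iterexp_add n C1 _ h5) _; first by rewrite mulrC -ler_pdivrMr.
apply: ler_iterexp.
apply: (@le_trans _ _ (t2 * Lam r `^ rho + C * D `^ s * Lam r `^ s)).
  apply: lerD.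
    apply: le_trans (ler_wpM2l (ltW t0) h1) _.
    rewrite kr; apply: le_of_eq; field; exact: lt0r_neq0.
  by rewrite -mulrA; apply: ler_wpM2l => //; exact: le_trans ler01 C1.
have t12 : 0 < t1 - t2 by rewrite subr_gt0.
have := ler_wpM2l (ltW t12) h3.
have -> : (t1 - t2) * (C * D `^ s / (t1 - t2) * Lam r `^ s) = C * D `^ s * Lam r `^ s.
  field; exact: lt0r_neq0.
by rewrite mulrBl lerBrDl.
Unshelve. all: by end_near. Qed.

End Level.

End Asymptotics.

(** * Growth of functions of given order or type *)

Section GrowthBounds.
Variable R : realType.
Implicit Types (x y r s t C sigma tau : R) (w z : R[i]) (f g : R[i] -> R[i]) (P Q : {poly R[i]}).

Lemma limsup_lt (u : R -> R) y : (limsup_pinfty u < y%:E)%E -> \forall r \near +oo, u r < y.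
Proof.
move=> /ereal_inf_lt[_ [A FA <-] Ay].
apply: filterS FA => r Ar; rewrite -lte_fin; apply: le_lt_trans Ay.
by apply: ereal_sup_ubound; exists r.
Qed.

Lemma lt_limsup (u : R -> R) y (P : R -> Prop) : (y%:E < limsup_pinfty u)%E ->
  (\forall r \near +oo, P r) -> exists r, P r /\ y < u r.
Proof.
move=> yu FP; have : (y%:E < ereal_sup ((fun r => (u r)%:E) @` [set r | P r]))%E.
  by apply: lt_le_trans yu _; apply: ereal_inf_lbound; exists [set r | P r].
by move=> /ereal_sup_gt[_ [r Pr <-]]; rewrite lte_fin => h; exists r.
Qed.

Lemma near_all (T : eqType) (l : seq T) (P : T -> R -> Prop) :
  (forall i, i \in l -> \forall r \near +oo, P i r) ->
  \forall r \near +oo, forall i, i \in l -> P i r.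
Proof.
elim: l => [|i l IH] h; first by apply: nearW.
have h1 := h i (mem_head _ _).
have h2 : \forall r \near +oo, forall j, j \in l -> P j r.
  by apply: IH => j jl; apply: h; rewrite inE jl orbT.
near=> r => j; rewrite inE => /orP[/eqP ->|jl]; first by near: r.
by move: j jl; near: r.
Unshelve. all: by end_near. Qed.

Lemma poly_growth P : exists2 C, 0 <= C & \forall r \near +oo,
  forall w, normc w <= r -> normc P.[w] <= expR (C * ln r).
Proof.
elim/poly_ind: P => [|P c [C C0 IH]].
  by exists 0 => //; apply: nearW => r w _; rewrite horner0 normc00 ltW // expR_gt0.
exists (C + 2); first by rewrite addr_ge0.
near=> r => w wr.
have r2 : 2 <= r by near: r; exact: near_ge.
have rc : normc c <= r by near: r; exact: near_ge.
have h : normc P.[w] <= expR (C * ln r) by move: w wr; near: r.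
rewrite hornerMXaddC; apply: le_trans (normcD _ _) _; rewrite normcMl.
have lr : r = expR (ln r) by rewrite lnK // posrE; lra.
set X := expR (C * ln r) in h *.
have X1 : 1 <= X.
  apply: le_trans (expR_ge1Dx _); rewrite lerDl mulr_ge0 // ln_ge0 //; lra.
have lC : expR ((C + 2) * ln r) = X * r * r.
  by rewrite mulrDl expRD mulr2n mulrDl !mul1r expRD -lr mulrA.
have h1 : normc P.[w] * normc w <= X * r by apply: ler_pM; rewrite ?normc_ge0.
have h2 : r <= X * r by rewrite ler_peMl //; lra.
have h3 : X * r * 2 <= X * r * r by apply: ler_wpM2l => //; lra.
rewrite lC; lra.
Unshelve. all: by end_near. Qed.

Lemma cdiff_horner P w : cdiff (fun w => P.[w]) w.
Proof.
elim/poly_ind: P => [|P c IH].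
  by apply: (eq_cdiff _ (cdiff_cst 0 w)) => v; rewrite horner0.
apply: (eq_cdiff _ (cdiffD (cdiffM IH (cdiff_id w)) (cdiff_cst c w))) => v.
by rewrite hornerMXaddC.
Qed.

Lemma poly_zeros Q : Q != 0 -> exists zs : seq R[i], forall w, Q.[w] = 0 -> w \in zs.
Proof.
move=> Q0; have [zs E] := closed_field_poly_normal Q; exists zs => w.
rewrite E hornerZ horner_prod => /eqP; rewrite mulf_eq0 lead_coef_eq0 (negPf Q0) /=.
rewrite prodf_seq_eq0 => /hasP[z zs' /=]; rewrite hornerXsubC subr_eq0 => /eqP ->//.
Qed.

Lemma poly_lower Q : Q != 0 -> exists2 c, 0 < c & \forall r \near +oo,
  forall w, normc w = r -> c <= normc Q.[w].
Proof.
move=> Q0; have [zs E] := closed_field_poly_normal Q.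
exists (normc (lead_coef Q)); first by rewrite normc_gt0 lead_coef_eq0.
have H : \forall r \near +oo, forall z, z \in zs -> normc z + 1 <= r.
  by apply: near_all => z _; exact: near_ge.
apply: filterS H => r hr w wr.
rewrite [in leRHS]E hornerZ normcMl horner_prod normc_prod -[leLHS]mulr1.
apply: ler_wpM2l; first exact: normc_ge0.
rewrite big_seq; elim/big_rec: _ => // z x zz x1.
rewrite -[1]mulr1; apply: ler_pM => //; rewrite hornerXsubC.
apply: le_trans (normc_dist_ge _ _); have := hr z zz; lra.
Qed.

Section Orders.
Variables (n q : nat).
Hypothesis qn : (q <= n)%N.
Let Lam r : R := iterlog q r.

Lemma ln_absorb C s : 0 < s -> \forall r \near +oo, C * ln r <= iterexp n (Lam r `^ s).
Proof.
move=> s0; have s2 : 0 < s / 2 by rewrite divr_gt0.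
near=> r.
have h : `|C| * iterexp n (Lam (1 * r) `^ (s / 2)) * ln r <= iterexp n (Lam r `^ s).
  by near: r; apply: iterexp_product => //; lra.
have h1 : 1 <= Lam r `^ (s / 2) by near: r; exact: powR_pinfty.
have h2 : 0 <= ln r by apply: ln_ge0; near: r; exact: near_ge.
rewrite mul1r in h; apply: le_trans h; apply: ler_wpM2r => //.
apply: le_trans (ler_norm C) _; rewrite -[leLHS]mulr1; apply: ler_wpM2l => //.
exact: le_trans h1 (iterexp_ge _ _).
Unshelve. all: by end_near. Qed.

Lemma entire_hol g rho : entire g -> hol rho g.
Proof. by move=> eg w _; apply/cdiffP; exact: eg. Qed.

Lemma maximum_modulus_ge g r w : entire g -> 0 < r -> normc w <= r ->
  normc (g w) <= maximum_modulus r g.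
Proof.
move=> eg r0 wr; have hg : hol (r + 1) g by exact: entire_hol.
have r1 : r < r + 1 by lra.
have [M M0 HM] := @disc_bounded _ g r (fun w h => cdiff_cont (hg w (le_lt_trans h r1))).
have onc z : normc z = r -> normc (g z) <= maximum_modulus r g.
  move=> zr; apply: ub_le_sup; last by exists z.
  by exists M => _ [v /= vr <-]; apply: HM; rewrite vr.
move: wr; rewrite le_eqVlt => /orP[/eqP|wr]; first exact: onc.
have rr : 0 < r < r + 1 by rewrite r0.
apply: (max_principle hg rr) wr => t; apply: onc; exact: normc_circle (ltW r0).
Qed.

(** A polynomial has order 0 by convention and not through its maximum modulus, so
  it is bounded separately. *)
Lemma entire_order_bound g sigma : entire g -> 0 < sigma ->
  (pq_order n.+1 q.+1 g < sigma%:E)%E ->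
  \forall r \near +oo, forall w, normc w <= r -> normc (g w) <= iterexp n.+1 (Lam r `^ sigma).
Proof.
move=> eg s0; rewrite /pq_order; case: asboolP => [[P [Q [Q0 gE]]] _|_].
  have [C C0 hP] := poly_growth P; have [c c0 hQ] := poly_lower Q0.
  near=> r => w wr.
  have r0 : 0 < r by near: r; exact: near_gt.
  have rr : 0 < r < r + 1 by rewrite r0; lra.
  have bnd z : normc z = r -> normc (g z) <= expR ((C + 1) * ln r).
    move=> zr; have h1 : c <= normc Q.[z] by move: z zr; near: r.
    have Qz : Q.[z] != 0 by rewrite -normc_gt0; apply: lt_le_trans h1.
    have h2 : normc P.[z] <= expR (C * ln r) by move: z zr h1 Qz => z /le_of_eq + _ _; move: z; near: r.
    rewrite gE // normcMl normcVl mulrDl mul1r expRD lnK ?posrE //.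
    apply: ler_pM; rewrite ?invr_ge0 ?normc_ge0 //.
    apply: (@le_trans _ _ c^-1); first by rewrite lef_pV2 ?posrE ?normc_gt0.
    by near: r; exact: near_ge.
  apply: (@le_trans _ _ (expR ((C + 1) * ln r))).
    move: wr; rewrite le_eqVlt => /orP[/eqP|wr]; first exact: bnd.
    have hg : hol (r + 1) g by exact: entire_hol.
    apply: (max_principle hg rr) wr => t; apply: bnd.
    exact: normc_circle (ltW r0).
  by rewrite iterexpS ler_expR; near: r; exact: ln_absorb.
case: asboolP => // _ /limsup_lt h.
near=> r => w wr.
have r0 : 0 < r by near: r; exact: near_gt.
apply: le_trans (maximum_modulus_ge eg r0 wr) _.
have lq : 0 < iterlog q.+1 r by apply: (lt_le_trans ltr01); near: r; exact: iterlog_pinfty.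
have h1 : iterlog n.+2 (maximum_modulus r g) / iterlog q.+1 r < sigma by near: r.
have E : iterexp n.+2 (sigma * iterlog q.+1 r) = iterexp n.+1 (Lam r `^ sigma).
  by near: r; exact: iterexp_log.
rewrite -E; apply: le_iterexp; apply: ltW; by rewrite -ltr_pdivrMr.
Unshelve. all: by end_near. Qed.

Lemma entire_type_bound g tau rho : entire g -> fine (pq_order n.+1 q.+1 g) = rho ->
  (pq_type n.+1 q.+1 g < tau%:E)%E ->
  \forall r \near +oo, forall w, normc w <= r -> normc (g w) <= iterexp n.+1 (tau * Lam r `^ rho).
Proof.
move=> eg hrho; rewrite /pq_type hrho; case: asboolP => // _ /limsup_lt h.
near=> r => w wr.
have r0 : 0 < r by near: r; exact: near_gt.
apply: le_trans (maximum_modulus_ge eg r0 wr) _.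
have L0 : 0 < Lam r `^ rho.
  by apply: powR_gt0; apply: (lt_le_trans ltr01); near: r; exact: iterlog_pinfty.
have h1 : iterlog n.+1 (maximum_modulus r g) / iterlog q r `^ rho < tau by near: r.
by apply: le_iterexp; apply: ltW; rewrite -ltr_pdivrMr.
Unshelve. all: by end_near. Qed.

(** Without accumulation points. *)
Definition sparse (E : set R[i]) := forall w0, exists2 d : R, 0 < d &
  forall w, w != w0 -> normc (w - w0) < d -> ~ E w.

(** Off E, [f = u / Q].  As Q vanishes at the poles of f, it is bounded from below
  only at prescribed points. *)
Definition bounded_quotient f (E : set R[i]) (ws : seq R[i]) r (K : R)
    (Q u : R[i] -> R[i]) :=
  [/\ hol r Q, hol r u,
   (forall w, normc w < r -> normc (Q w) <= expR K /\ normc (u w) <= expR K),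
   (forall w, normc w < r -> ~ E w -> u w = Q w * f w) &
   (forall w, w \in ws -> expR (- K) <= normc (Q w))].

(** The exceptional set E consists of the poles of f and, for a rational f, of the
  zeros of its denominator, where its values are arbitrary. *)
Definition quotient_rep f (K : R -> R) := exists E : set R[i],
  [/\ sparse E, (forall w, ~ E w -> ~ pole f w) &
   forall ws : seq R[i], (forall w, w \in ws -> ~ E w) -> \forall r \near +oo,
     exists (Q u : R[i] -> R[i]), bounded_quotient f E ws r (K r) Q u].

Lemma sparse_seq (zs : seq R[i]) : sparse [set w | w \in zs].
Proof.
move=> w0; have [d d0 hd] := finite_isolated zs w0; exists d => // w ww wd.
by apply/negP; exact: hd.
Qed.

Lemma sparse_subset (E E' : set R[i]) : E `<=` E' -> sparse E' -> sparse E.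
Proof.
move=> EE h w0; have [d d0 hd] := h w0; exists d => // w ww wd /EE.
exact: hd.
Qed.

Lemma rational_rep f s : Defs.rational f -> 0 < s ->
  quotient_rep f (fun r => iterexp n (Lam r `^ s)).
Proof.
move=> [P [Q [Q0 fE]]] s0.
have [zs hzs] := poly_zeros Q0.
have [C1 C10 hP] := poly_growth P; have [C2 C20 hQ] := poly_growth Q.
have Qnear z : Q.[z] != 0 -> exists2 d, 0 < d & forall w, normc (w - z) < d -> Q.[w] != 0.
  move=> Qz; have [z' z'0 hz] := finite_isolated zs z; exists z' => // w wz.
  have [->//|wnz] := eqVneq w z.
  by apply/eqP => /hzs; apply/negP; exact: hz.
exists [set w | Q.[w] = 0]; split.
- apply: sparse_subset (sparse_seq zs) => w; exact: hzs.
- move=> w /eqP Qw; apply: cdiff_not_pole.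
  have [d d0 hd] := Qnear w Qw.
  apply: (@near_cdiff _ (fun w => P.[w] * (Q.[w])^-1)).
    by apply: cdiffM; [exact: cdiff_horner|apply: cdiffV => //; exact: cdiff_horner].
  by exists d => // v /hd Qv; rewrite fE.
move=> ws hws.
have low : \forall r \near +oo, forall w, w \in ws -> expR (- iterexp n (Lam r `^ s)) <= normc Q.[w].
  apply: near_all => w /hws /eqP Qw; near=> r.
  rewrite -[leRHS]lnK ?posrE ?normc_gt0 // ler_expR lerNl.
  apply: le_trans (iterexp_ge _ _); near: r; exact: powR_pinfty.
near=> r; exists (fun w => Q.[w]), (fun w => P.[w]); split.
- by move=> w _; exact: cdiff_horner.
- by move=> w _; exact: cdiff_horner.
- move=> w /ltW wr; split.
    apply: (@le_trans _ _ (expR (C2 * ln r))); first by move: w wr; near: r.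
    by rewrite ler_expR; near: r; exact: ln_absorb.
  apply: (@le_trans _ _ (expR (C1 * ln r))); first by move: w wr; near: r.
  by rewrite ler_expR; near: r; exact: ln_absorb.
- by move=> w _ /eqP Qw; rewrite fE // mulrC divfK.
- by near: r.
Unshelve. all: by end_near. Qed.

Lemma entire_rep f s : entire f ->
  (\forall r \near +oo, forall w, normc w <= r -> normc (f w) <= iterexp n.+1 (Lam r `^ s)) ->
  quotient_rep f (fun r => iterexp n (Lam r `^ s)).
Proof.
move=> ef hf; exists set0; split.
- by move=> w0; exists 1 => // w _ _ [].
- by move=> w _; apply: cdiff_not_pole; apply/cdiffP; exact: ef.
move=> ws _; near=> r.
have K0 : 0 <= iterexp n (Lam r `^ s) by apply: le_trans (iterexp_ge _ _); exact: powR_ge0.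
have n1 : normc (1 : R[i]) = 1 := ComplexField.Normc.normc1 R.
exists (fun=> 1), f; split.
- by move=> w _; exact: cdiff_cst.
- exact: entire_hol.
- move=> w /ltW wr; rewrite n1; split.
    by apply: le_trans (expR_ge1Dx _); rewrite lerDl.
  by move: w wr; near: r.
- by move=> w _ _; rewrite mul1r.
- by move=> w _; rewrite n1 -[leRHS]expR0 ler_expR oppr_le0.
Unshelve. all: by end_near. Qed.

Lemma pole_count_characteristic f rho r : meromorphic f -> 1 <= rho -> rho <= 2 * r ->
  (pole_count rho f)%:R <= 2 * nevanlinna_characteristic (4 * r) f.
Proof.
move=> mf rho1 rho2; have r0 : 0 < r by lra.
have rho4 : 1 <= rho < 4 * r by rewrite rho1; lra.
have [_ h _] := nevanlinna_bounds mf rho4.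
have half : 2^-1 <= (4 * r - rho) / (4 * r) by rewrite ler_pdivlMr; lra.
have N0 : 0 <= (pole_count rho f)%:R :> R by [].
have := ler_wpM2l N0 half; lra.
Qed.

(** A Blaschke factor is at least the inverse of [r ^+ 2], as d is fixed and r is
  large. *)
Lemma ln_ratio_ge r rho d : 0 < d -> 0 < rho -> 4 <= d * r -> rho <= 2 * r ->
  - (2 * ln r) <= ln (d / (2 * rho)).
Proof.
move=> d0 rho0 dr rho2; have r0 : 0 < r by lra.
rewrite lerNl -lnV ?posrE ?divr_gt0 ?mulr_gt0 // invf_div.
have -> : 2 * ln r = ln (r * r) by rewrite lnM ?posrE //; ring.
rewrite ler_ln ?posrE ?mulr_gt0 ?invr_gt0 //.
rewrite ler_pdivrMr //; nra.
Qed.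

(** By [meromorphic_disc_rep] on a circle between 3 r / 2 and 2 r, u is bounded by
  the characteristic, and Q at a fixed point by the number of its factors times
  [ln r].  That number is bounded by the characteristic at 4 r, and the larger
  exponent s absorbs the logarithm. *)
Lemma characteristic_rep f sigma s : meromorphic f -> not_identically_zero f ->
  0 < sigma -> sigma < s ->
  (\forall r \near +oo, nevanlinna_characteristic r f <= iterexp n (Lam r `^ sigma)) ->
  quotient_rep f (fun r => iterexp n (Lam r `^ s)).
Proof.
move=> mf [z0 [pz0 fz0]] s0 ss hT.
exists [set w | pole f w]; split.
- move=> w0; have [d d0 hd] := meromorphic_punctured w0 mf.
  exists d; [exact: d0|move=> w ww wd].
  exact: (cdiff_not_pole (hd w ww wd)).
- by move=> w h; exact: h.
move=> ws hws.
have /pinfty_exists[t0 ht0] := hT.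
have [x0 hx0] := iterlog_mono R q.
have hd : \forall r \near +oo, forall w, w \in ws -> normc w < r /\
    exists d : R, [/\ 0 < d, d <= 1, 4 <= d * r & forall b, pole f b -> d <= normc (w - b)].
  apply: near_all => w /hws pw.
  have [d d0 hd] := meromorphic_punctured w mf.
  near=> r; split; first by near: r; exact: near_gt.
  exists (Num.min 1 d); split.
  - by rewrite lt_min ltr01.
  - by rewrite ge_min lexx.
  - have m0 : 0 < Num.min 1 d by rewrite lt_min ltr01.
    by rewrite mulrC -ler_pdivrMr //; near: r; exact: near_ge.
  - move=> b pb; rewrite leNgt; apply/negP; rewrite lt_min => /andP[_ wd].
    have [bw|bw] := eqVneq b w; first by apply: pw; rewrite -bw.
    have bwd : normc (b - w) < d by rewrite normc_distC.
    exact: (cdiff_not_pole (hd b bw bwd) pb).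
near=> r.
have r1 : expR 1 <= r by near: r; exact: near_ge.
have r2 : 2 <= r by near: r; exact: near_ge.
have z0r : normc z0 <= r by near: r; exact: near_ge.
have rt0 : t0 <= r by near: r; exact: near_ge.
have rx0 : x0 <= r by near: r; exact: near_ge.
have hdr : forall w, w \in ws -> normc w < r /\
    exists d : R, [/\ 0 < d, d <= 1, 4 <= d * r & forall b, pole f b -> d <= normc (w - b)].
  by near: r.
have prod : 5 * iterexp n (Lam (4 * r) `^ sigma) * ln r <= iterexp n (Lam r `^ s).
  by near: r; apply: iterexp_product => //; lra.
have L1 : 1 <= Lam r by near: r; exact: iterlog_pinfty.
have r0 : 0 < r by lra.
have rr2 : r < 2 * r by lra.
have r24 : 2 * r <= 4 * r by lra.
have r34 : (r + 2 * r) / 2 <= 4 * r by lra.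
have hrm : r < (r + 2 * r) / 2 by lra.
have [rho [Q [u [/andP[rho1 rho2] hQ hu bnd [rel low]]]]] :=
  meromorphic_disc_rep mf pz0 fz0 r0 z0r rr2.
have rrho : r < rho := lt_trans hrm rho1.
have rho_ge1 : 1 <= rho by apply: le_trans (ltW rrho); apply: le_trans r2; rewrite ler1n.
have rho0 : 0 < rho := lt_trans r0 rrho.
set X := iterexp n (Lam (4 * r) `^ sigma) in prod.
set K := iterexp n (Lam r `^ s) in prod *.
have X0 : 0 <= X by apply: le_trans (iterexp_ge _ _); exact: powR_ge0.
have lnr1 : 1 <= ln r by rewrite -ler_expR lnK // posrE.
have XK : 5 * X <= K by apply: le_trans prod; rewrite ler_peMr // mulr_ge0.
have K0 : 0 <= K by apply: le_trans XK; rewrite mulr_ge0.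
have Tb t : r <= t -> t <= 4 * r -> nevanlinna_characteristic t f <= X.
  move=> rt t4; apply: le_trans (ht0 t (le_trans rt0 rt)) _.
  have l1 : Lam r <= Lam t by exact: hx0.
  have l2 : Lam t <= Lam (4 * r) by apply: hx0 => //; exact: le_trans rx0 rt.
  have lt0 : 0 <= Lam t := le_trans ler01 (le_trans L1 l1).
  apply: ler_iterexp; apply: ge0_ler_powR; rewrite ?nnegrE //; first exact: ltW.
  exact: le_trans lt0 l2.
have kE : harnack_constant ((r + 2 * r) / 2) r = 5.
  rewrite /harnack_constant; field; apply/eqP; lra.
exists Q, u; split.
- by apply: hol_sub hQ; exact: ltW.
- by apply: hol_sub hu; exact: ltW.
- move=> w /ltW wr; have [b1 b2] := bnd w wr; split.
    by apply: le_trans b1 _; apply: le_trans (expR_ge1Dx _); rewrite lerDl.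
  apply: le_trans b2 _; rewrite ler_expR kE; apply: le_trans XK.
  apply: ler_wpM2l => //.
  have r1rho : (1 : R) <= 1 < rho.
    by rewrite lexx; apply: le_lt_trans rrho; apply: le_trans r2; rewrite ler1n.
  have [h1 _ _] := nevanlinna_bounds mf r1rho.
  by apply: le_trans h1 _; apply: Tb; [exact: ltW|exact: le_trans (ltW rho2) r24].
- by move=> w wr pw; exact: (rel w (lt_trans wr rrho) pw).
move=> w /hdr[wr [d [d0 d1 dr hb]]].
have d2 : d <= 2 * rho by apply: le_trans d1 _; apply: mulr_ege1 => //; rewrite ler1n.
apply: le_trans (low w d (lt_trans wr rrho) d0 d2 hb).
have hN : (pole_count rho f)%:R <= 2 * X.
  apply: le_trans (pole_count_characteristic mf rho_ge1 (ltW rho2)) _.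
  by apply: ler_wpM2l => //; apply: Tb => //; exact: le_trans (ltW rr2) r24.
rewrite -[d / (2 * rho)]lnK ?posrE ?divr_gt0 ?mulr_gt0 // -expRM_natl ler_expR.
have h : (pole_count rho f)%:R * (- (2 * ln r)) <= (pole_count rho f)%:R * ln (d / (2 * rho)).
  by apply: ler_wpM2l => //; exact: ln_ratio_ge (ltW rho2).
have lnr0 : 0 <= ln r := le_trans ler01 lnr1.
apply: le_trans h; rewrite mulrN lerN2; apply: le_trans prod.
have l20 : 0 <= 2 * ln r by rewrite mulr_ge0.
apply: le_trans (ler_wpM2r l20 hN) _.
have -> : 2 * X * (2 * ln r) = 4 * X * ln r by ring.
by apply: ler_wpM2r => //; apply: ler_wpM2r => //; rewrite ler_nat.
Unshelve. all: by end_near. Qed.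

Lemma order_rep f sigma s : meromorphic f -> not_identically_zero f ->
  0 < sigma -> sigma < s -> (pq_order n.+1 q.+1 f < sigma%:E)%E ->
  quotient_rep f (fun r => iterexp n (Lam r `^ s)).
Proof.
move=> mf nf s0 ss hf.
have [rf|nrf] := pselect (Defs.rational f); first by apply: rational_rep => //; lra.
have [ef|nef] := pselect (entire f).
  apply: entire_rep => //; apply: entire_order_bound => //; first lra.
  by apply: lt_trans hf _; rewrite lte_fin.
move: hf; rewrite /pq_order (asboolF nrf) (asboolF nef) => /limsup_lt h.
apply: (characteristic_rep mf nf s0 ss).
near=> r.
have lq : 0 < iterlog q.+1 r by apply: (lt_le_trans ltr01); near: r; exact: iterlog_pinfty.
have h1 : iterlog n.+1 (nevanlinna_characteristic r f) / iterlog q.+1 r < sigma by near: r.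
have E : iterexp n.+1 (sigma * iterlog q.+1 r) = iterexp n (Lam r `^ sigma).
  by near: r; exact: iterexp_log.
by rewrite -E; apply: le_iterexp; apply: ltW; rewrite -ltr_pdivrMr.
Unshelve. all: by end_near. Qed.

End Orders.
End GrowthBounds.

(** * Linear relations between entire functions and quotients *)

Section FamilyBound.
Variable R : realType.
Implicit Types (x y r s t C B K rho : R) (w z : R[i]) (f g : R[i] -> R[i]).

Lemma eq_off_sparse (E : set R[i]) g rho w : sparse E -> hol rho g ->
  (forall v, normc v < rho -> ~ E v -> g v = 0) -> normc w < rho -> g w = 0.
Proof.
move=> iE hg g0 wr; have [d d0 hd] := iE w.
apply: (@punctured_limit_unique _ g w).
  by apply: punctured_limit_cont; apply: cdiff_cont; exact: hg.
have d'0 : 0 < Num.min d (rho - normc w) by rewrite lt_min d0 subr_gt0.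
apply: (@near_punctured_limit _ (fun=> 0) g w 0 _ d'0) => [v vw|].
  rewrite lt_min => /andP[vd vr]; rewrite g0 //; last exact: hd.
  by have := normc_dist_le v w; lra.
by move=> e e0; exists 1 => // v _ _; rewrite subrr normc00 ltW.
Qed.

Lemma prod_le_expR (I : finType) (P : pred I) (F : I -> R[i]) K : 0 <= K ->
  (forall i, normc (F i) <= expR K) ->
  normc (\prod_(i | P i) F i) <= expR (#|P|%:R * K).
Proof.
move=> K0 hF; rewrite normc_prod expRM_natl -prodr_const.
by apply: ler_prod => i _; rewrite normc_ge0 hF.
Qed.

Lemma prod_ge_expR (I : finType) (P : pred I) (F : I -> R[i]) K :
  (forall i, expR (- K) <= normc (F i)) ->
  expR (- (#|P|%:R * K)) <= normc (\prod_(i | P i) F i).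
Proof.
move=> hF; rewrite normc_prod -mulrN expRM_natl -prodr_const.
by apply: ler_prod => i _; rewrite hF ltW // expR_gt0.
Qed.

(** Multiply the relation by all Q j: with [T i = u i * \prod_(j != i) Q j] it reads
  [\sum_i A i * T i = 0], without denominators, first off E and then everywhere by
  continuity.  So [A l * T l] is bounded through the other A i, and
  [quotient_bound] removes T l. *)
Lemma family_bound (I : finType) (A phi Q u : I -> R[i] -> R[i]) (l : I) (E : set R[i])
    rho r s1 s2 s z1 B K :
  0 < s -> s < s2 -> s2 < s1 -> s1 < r -> r < rho -> sparse E ->
  (forall i, hol rho (A i)) -> (forall i, hol rho (Q i)) -> (forall i, hol rho (u i)) ->
  (forall w, normc w < rho -> ~ E w -> forall i, u i w = Q i w * phi i w) ->
  (forall w, normc w < rho -> ~ E w -> \sum_i A i w * phi i w = 0) ->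
  0 <= K -> (forall i w, normc w < rho -> normc (Q i w) <= expR K) ->
  (forall i w, normc w < rho -> normc (u i w) <= expR K) ->
  (forall i w, i != l -> normc w < rho -> normc (A i w) <= expR B) ->
  normc z1 <= s -> (forall i, expR (- K) <= normc (Q i z1)) ->
  expR (- (2 * K)) <= normc (u l z1) ->
  let m : R := #|I|%:R in
  forall z, normc z <= s ->
  normc (A l z) <= expR (B + (m * K + m + harnack_constant s2 s ^+ 2 * (m * K + (m + 1) * K))).
Proof.
move=> s0 ss2 s21 s1r rrho iE hA hQ hu uQ eqn K0 QK uK AB z1s Qz1 ulz1 m z zs.
pose T i w := u i w * \prod_(j | j != i) Q j w.
have hT i : hol rho (T i).
  apply: holM => // w wr; apply: cdiff_prod => j _; exact: hQ.
have sum0 w : normc w < rho -> \sum_i A i w * T i w = 0.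
  move=> wr; apply: (@eq_off_sparse E (fun w => \sum_i A i w * T i w) rho w iE) => //.
    move=> v vr; apply: cdiff_sum => i _; apply: cdiffM; [exact: hA|exact: hT].
  move=> v vr vE.
  have -> : \sum_i A i v * T i v = (\prod_j Q j v) * \sum_i A i v * phi i v.
    rewrite mulr_sumr; apply: eq_bigr => i _.
    by rewrite /T (uQ v vr vE) [in RHS](bigD1 i) //=; ring.
  by rewrite (eqn v vr vE) mulr0.
have AT w : normc w < rho -> A l w * T l w = - \sum_(i | i != l) A i w * T i w.
  by move=> /sum0; rewrite (bigD1 l) //= => /eqP; rewrite addr_eq0 => /eqP.
have card (i : I) : #|[pred j : I | j != i]| = #|I|.-1.
  by rewrite -(cardC1 i); apply: eq_card => j; rewrite !inE.
have m1 : (1 <= #|I|)%N by apply/card_gt0P; exists l.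
have mE : (#|I|.-1)%:R = m - 1 :> R by rewrite /m -[in RHS](prednK m1) -natr1 addrK.
have TK i w : normc w < rho -> normc (T i w) <= expR (m * K).
  move=> wr; rewrite /T normcMl.
  have -> : m * K = K + (m - 1) * K by ring.
  rewrite expRD -mE -(card i); apply: ler_pM; rewrite ?normc_ge0 ?uK //.
  by apply: prod_le_expR => // j; exact: QK.
have Tz1 : expR (- ((m + 1) * K)) <= normc (T l z1).
  have -> : - ((m + 1) * K) = - (2 * K) + - ((m - 1) * K) by ring.
  rewrite /T normcMl expRD -mE -(card l).
  by apply: ler_pM; rewrite ?(ltW (expR_gt0 _)) //; exact: prod_ge_expR.
have circ t : normc (circle r t) < rho by rewrite normc_circle //; lra.
have mB t : normc (A l (circle r t) * T l (circle r t)) <= expR (B + m * K + m).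
  rewrite (AT _ (circ t)) normcNE; apply: le_trans (normc_sum _ _ _) _.
  apply: (@le_trans _ _ (\sum_(i | i != l) expR (B + m * K))).
    apply: ler_sum => i il; rewrite normcMl expRD; apply: ler_pM; rewrite ?normc_ge0 //.
      exact: AB.
    exact: TK.
  rewrite sumr_const -mulr_natr [leRHS]expRD; apply: ler_wpM2l; first exact/ltW/expR_gt0.
  apply: le_trans (expR_ge _); rewrite ler_nat; exact: max_card.
have mK0 : 0 <= m * K by rewrite mulr_ge0.
have := quotient_bound s0 ss2 s21 s1r rrho (hA l) (hT l) mB (fun t => TK l _ (circ t)) mK0 z1s Tz1 zs.
by move=> h; apply: le_trans h _; rewrite ler_expR !addrA.
Qed.

Lemma sparse_shift (E : set R[i]) (a : R[i]) : sparse E -> sparse [set w | E (w + a)].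
Proof.
move=> iE w0; have [d d0 hd] := iE (w0 + a); exists d => // w ww wd; apply: hd.
  by apply: contra ww => /eqP/addIr ->.
by rewrite opprD addrACA subrr addr0.
Qed.

Lemma sparse_union (I : finType) (E : I -> set R[i]) : (forall i, sparse (E i)) ->
  sparse [set w | exists i, E i w].
Proof.
move=> iE w0.
suff [d d0 hd] : exists2 d : R, 0 < d & forall i, i \in enum I ->
    forall w, w != w0 -> normc (w - w0) < d -> ~ E i w.
  by exists d => // w ww wd [i Ei]; apply: (hd i _ w ww wd Ei); rewrite mem_enum.
elim: (enum I) => [|i s [d d0 hd]]; first by exists 1.
have [d' d'0 hd'] := iE i w0; exists (Num.min d d') => [|j]; first by rewrite lt_min d0.
rewrite inE => /orP[/eqP ->|js] w ww; rewrite lt_min => /andP[w1 w2]; first exact: hd'.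
exact: (hd j js w ww w1).
Qed.

End FamilyBound.

Section Transfer.
Variables (R : realType) (n q : nat).
Hypothesis qn : (q <= n)%N.
Implicit Types (x y r s t C sigma rho : R) (w z : R[i]) (f g : R[i] -> R[i]).
Let Lam r : R := iterlog q r.

Lemma intermediate_radii d1 r : 0 < d1 -> 0 < r ->
  [/\ r < (1 + d1) * r, (1 + d1) * r < (1 + 2 * d1) * r,
      (1 + 2 * d1) * r < (1 + 3 * d1) * r & (1 + 3 * d1) * r < (1 + 4 * d1) * r].
Proof.
move=> d10 r0; split; rewrite ?ltr_pM2r //; try lra.
by rewrite mulrDl mul1r ltrDl mulr_gt0.
Qed.

(** All coefficients but A l have growth at most t.  On the disc of radius D r the
  function f is a quotient with logarithmic bound K (D r), and [family_bound] on
  nested circles between r and (1 + d) r gives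
  [log |A l| <= iterexp n (t * Lam ((1 + d) * r) `^ rho) + C * K (D * r)] with C
  independent of r; [growth_comparison] concludes.  Since D = 2 + d, the disc of
  radius D r contains the translates of the disc of radius (1 + d) r. *)
Lemma growth_transfer (I : finType) (A : I -> R[i] -> R[i]) (b : I -> bool) (sh : I -> R[i])
    (l : I) f t sigma rho :
  (forall i, entire (A i)) -> 0 < t ->
  (forall i, i != l -> \forall r \near +oo, forall w, normc w <= r ->
     normc (A i w) <= iterexp n.+1 (t * Lam r `^ rho)) ->
  meromorphic f -> not_identically_zero f ->
  0 < sigma -> sigma < rho -> (pq_order n.+1 q.+1 f < sigma%:E)%E ->
  (forall z, (forall i, b i -> ~ pole f (z + sh i)) ->
     \sum_i A i z * (if b i then f (z + sh i) else 1) = 0) ->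
  forall t1, t < t1 -> \forall r \near +oo, forall w, normc w <= r ->
     normc (A l w) <= iterexp n.+1 (t1 * Lam r `^ rho).
Proof.
move=> eA t0 hA mf nf sg0 sgr hf eqn t1 tt1.
pose s := (sigma + rho) / 2.
have sgs : sigma < s by rewrite /s; lra.
have sr : s < rho by rewrite /s; lra.
have s0 : 0 < s by lra.
have [E [iE Epole rep]] := order_rep qn mf nf sg0 sgs hf.
pose E' := [set w | exists i, E (w + sh i)].
have iE' : sparse E' by apply: sparse_union => i; exact: sparse_shift.
pose phi i z := if b i then f (z + sh i) else 1.
have [z0 [d0 d00 hd0]] : exists z0, exists2 d0 : R, 0 < d0 & forall w, normc (w - z0) < d0 -> phi l w != 0.
  rewrite /phi; case: (b l); last by exists 0, 1 => // w _; exact: oner_neq0.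
  case: nf => z0 [pz0 fz0].
  have [d d0 hd] := hol_cont_nonzero (cdiff_cont (meromorphic_not_pole mf pz0)) fz0.
  exists (z0 - sh l), d => // w wd; apply: hd.
  by move: wd; rewrite opprB addrA addrAC.
(* the point at which the denominators and u l are bounded from below *)
have [z1 [phiz1 z1E]] : exists z1, phi l z1 != 0 /\ ~ E' z1.
  have [d d'0 hd] := iE' z0.
  pose e := Num.min d0 d / 2.
  have e0 : 0 < e by rewrite divr_gt0 // lt_min d00.
  have e2 : e < Num.min d0 d by rewrite /e; have := e0; rewrite /e; lra.
  have ne : normc (z0 + e%:C%C - z0) = e by rewrite addrAC subrr add0r normc_real gtr0_norm.
  exists (z0 + e%:C%C); move: e2; rewrite lt_min => /andP[e3 e4]; split.
    by apply: hd0; rewrite ne.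
  by apply: hd; rewrite ?ne // -subr_eq0 -normc_gt0 ne.
pose ws := [seq z1 + sh i | i <- enum I].
have wsE w : w \in ws -> ~ E w.
  by move=> /mapP[i _ ->] Ei; apply: z1E; exists i.
have {rep} := rep ws wsE.
set K := fun r => iterexp n (Lam r `^ s) => rep.
have [d d'0 hd] := growth_comparison q n t0 tt1 s0 sr.
pose D := 2 + d; have D1 : 1 <= D by rewrite /D; lra.
pose d1 := d / 4; have d10 : 0 < d1 by rewrite divr_gt0.
have dd1 : d = 4 * d1 by rewrite /d1; field.
pose m : R := #|I|%:R.
(* Harnack's constant for the radii r and [(1 + d1) * r], and the factor of K in the
   bound of [family_bound], where K >= 1 absorbs the number m of terms *)
pose kap := (2 + d1) / d1.
pose C := m + m + kap ^+ 2 * (m + (m + 1)).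
have m1 : 1 <= m by rewrite /m ler1n; apply/card_gt0P; exists l.
have kap0 : 0 <= kap ^+ 2 by exact: sqr_ge0.
have m0 : 0 <= m := le_trans ler01 m1.
have C1 : 1 <= C.
  by apply: le_trans m1 _; rewrite /C -addrA lerDl !addr_ge0 // mulr_ge0 // !addr_ge0.
have rep' := pinfty_scale D1 rep.
have hA' : \forall r \near +oo, forall i, i \in enum [pred i | i != l] ->
    forall w, normc w <= (1 + d) * r -> normc (A i w) <= iterexp n.+1 (t * Lam ((1 + d) * r) `^ rho).
  apply: near_all => i; rewrite mem_enum inE => il.
  have d11 : 1 <= 1 + d by lra.
  exact: (pinfty_scale d11 (hA i il)).
have hsh : \forall r \near +oo, forall i, i \in enum I -> normc (sh i) <= r.
  by apply: near_all => i _; exact: near_ge.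
near=> r => z zr.
have r0 : 0 < r by near: r; exact: near_gt.
have shr i : normc (sh i) <= r.
  have h : forall i, i \in enum I -> normc (sh i) <= r by near: r.
  by apply: h; rewrite mem_enum.
have z1r : normc z1 <= r by near: r; exact: near_ge.
have [Q [u [hQ hu bnd rel low]]] : exists Q u,
    bounded_quotient f E ws (D * r) (K (D * r)) Q u.
  by near: r; exact: rep'.
have hAr : forall i, i \in enum [pred i | i != l] ->
    forall w, normc w <= (1 + d) * r -> normc (A i w) <= iterexp n.+1 (t * Lam ((1 + d) * r) `^ rho).
  by near: r.
have cmp : iterexp n (t * Lam ((1 + d) * r) `^ rho) + C * iterexp n (Lam (D * r) `^ s)
   <= iterexp n (t1 * Lam r `^ rho).
  by near: r; exact: hd.
have K1 : 1 <= K (D * r).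
  near: r; apply: (@pinfty_scale _ (fun r => 1 <= K r) D D1).
  near=> r'; apply: le_trans (iterexp_ge _ _); near: r'; exact: powR_pinfty.
have Kphi : - ln (normc (phi l z1)) <= K (D * r).
  near: r; apply: (@pinfty_scale _ (fun r => - ln (normc (phi l z1)) <= K r) D D1).
  near=> r'; apply: le_trans (iterexp_ge _ _); near: r'; exact: powR_pinfty.
set Kr := K (D * r) in bnd low K1 Kphi.
set rh := (1 + d) * r.
have inD i w : normc w < rh -> normc (w + sh i) < D * r.
  move=> wr; apply: le_lt_trans (normcD _ _) _.
  have -> : D * r = rh + r by rewrite /D /rh; ring.
  exact: ltr_leD wr (shr i).
have hshift g i : hol (D * r) g -> hol rh (fun w => g (w + sh i)).
  move=> hg w wr; have [dg hdg] := hg _ (inD i w wr).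
  exists (1 * dg); have := @cderiv_affine R g (sh i) 1 w dg; rewrite mul1r addrC => /(_ hdg).
  by congr is_derive; apply/funext => v; rewrite mul1r addrC.
pose Qi i w := if b i then Q (w + sh i) else 1.
pose ui i w := if b i then u (w + sh i) else 1.
have n1 : normc (1 : R[i]) = 1 := ComplexField.Normc.normc1 R.
have Kr0 : 0 <= Kr := le_trans ler01 K1.
have e1 : 1 <= expR Kr by apply: le_trans (expR_ge1Dx _); rewrite lerDl.
have e1' : expR (- Kr) <= 1 by rewrite -[leRHS]expR0 ler_expR oppr_le0.
have hQi i : hol rh (Qi i).
  by rewrite /Qi; case: (b i); [exact: hshift|move=> w _; exact: cdiff_cst].
have hui i : hol rh (ui i).
  by rewrite /ui; case: (b i); [exact: hshift|move=> w _; exact: cdiff_cst].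
have [ss2 s21 s1r] := intermediate_radii d10 r0.
rewrite -dd1 -/rh => srh.
have Qiz1 i : expR (- Kr) <= normc (Qi i z1).
  rewrite /Qi; case: (b i); last by rewrite n1.
  by apply: low; apply: map_f; rewrite mem_enum.
have z1rh : normc z1 < rh.
  by apply: le_lt_trans z1r _; rewrite /rh mulrDl mul1r ltrDl mulr_gt0.
have relE w : normc w < rh -> ~ E' w -> forall i, ui i w = Qi i w * phi i w.
  move=> wr wE i; rewrite /ui /Qi /phi; case: (b i); last by rewrite mulr1.
  by apply: (rel _ (inD i w wr)) => Ei; apply: wE; exists i.
have B i w : i != l -> normc w < rh -> normc (A i w) <= expR (iterexp n (t * Lam ((1 + d) * r) `^ rho)).
  by move=> il wr; apply: hAr; [rewrite mem_enum inE|exact: ltW].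
have ulz1 : expR (- (2 * Kr)) <= normc (ui l z1).
  rewrite (relE z1 z1rh z1E) normcMl mulr2n mulrDl mul1r opprD expRD.
  apply: ler_pM; rewrite ?(ltW (expR_gt0 _)) //.
  by rewrite -[leRHS]lnK ?posrE ?normc_gt0 // ler_expR lerNl.
have eqnE w : normc w < rh -> ~ E' w -> \sum_i A i w * phi i w = 0.
  by move=> _ wE; apply: eqn => i _; apply: Epole => Ei; apply: wE; exists i.
have QiK i w : normc w < rh -> normc (Qi i w) <= expR Kr.
  move=> wr; rewrite /Qi; case: (b i); last by rewrite n1.
  by case: (bnd _ (inD i w wr)).
have uiK i w : normc w < rh -> normc (ui i w) <= expR Kr.
  move=> wr; rewrite /ui; case: (b i); last by rewrite n1.
  by case: (bnd _ (inD i w wr)).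
have hAh i : hol rh (A i) by exact: entire_hol.
have := @family_bound R I A phi Qi ui l E' rh _ _ _ r z1 _ Kr r0 ss2 s21 s1r srh iE' hAh hQi hui
  relE eqnE Kr0 QiK uiK B z1r Qiz1 ulz1 z zr.
rewrite -/m; have -> : harnack_constant ((1 + d1) * r) r = kap.
  rewrite /harnack_constant /kap; field.
  by rewrite (gt_eqF d10) -[X in _ - X]mul1r -mulrBl addrAC subrr add0r mulf_neq0 ?gt_eqF.
move=> h; apply: le_trans h _; rewrite iterexpS ler_expR.
apply: le_trans cmp; rewrite -/(K (D * r)) -/Kr lerD2l /C.
have h1 : m <= m * Kr by rewrite ler_peMr.
have -> : (m + m + kap ^+ 2 * (m + (m + 1))) * Kr = m * Kr + m * Kr + kap ^+ 2 * (m * Kr + (m + 1) * Kr).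
  by ring.
by rewrite lerD2r lerD2l.
Unshelve. all: by end_near. Qed.

End Transfer.

(** * Orders and types of the coefficients *)

Section Coefficients.
Variables (R : realType) (n q : nat).
Hypothesis qn : (q <= n)%N.
Implicit Types (x y r s t C sigma rho tau : R) (w z : R[i]) (f g : R[i] -> R[i]).
Let Lam r : R := iterlog q r.

Lemma ereal_between (x : \bar R) y : (x < y%:E)%E -> 0 < y ->
  exists sigma : R, [/\ 0 < sigma, sigma < y & (x < sigma%:E)%E].
Proof.
case: x => [x| |] //= xy y0; last by exists (y / 2); split; [lra|lra|exact: ltNyr].
rewrite lte_fin in xy; exists ((Num.max x 0 + y) / 2).
have m1 : x <= Num.max x 0 by rewrite le_max lexx.
have m2 : 0 <= Num.max x 0 by rewrite le_max lexx orbT.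
have m3 : Num.max x 0 < y by rewrite gt_max xy.
by rewrite lte_fin; split; lra.
Qed.

Lemma ereal_two_between (x y : \bar R) r : 0 < r -> (r%:E < y)%E -> (x < y)%E ->
  exists s s' : R, [/\ r < s, (x < s%:E)%E, s < s' & (s'%:E < y)%E].
Proof.
case: y => [y| |] //=; rewrite ?lte_fin => r0 ry xy; last first.
  exists (Num.max (fine x) r + 1), (Num.max (fine x) r + 2).
  have m1 : fine x <= Num.max (fine x) r by rewrite le_max lexx.
  have m2 : r <= Num.max (fine x) r by rewrite le_max lexx orbT.
  split; [lra| |lra|exact: ltry].
  by case: x xy m1 m2 => [x| |] //= _ m1 m2; rewrite ?lte_fin ?ltNyr //; lra.
have [s [s0 sy hs]] := ereal_between xy (lt_trans r0 ry).
have m1 : s <= Num.max s r by rewrite le_max lexx.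
have m2 : r <= Num.max s r by rewrite le_max lexx orbT.
have m3 : Num.max s r < y by rewrite gt_max sy.
exists (Num.max s r + (y - Num.max s r) / 3), (Num.max s r + (y - Num.max s r) / 3 * 2).
rewrite lte_fin; split; [lra| |lra|lra].
by apply: lt_trans hs _; rewrite lte_fin; lra.
Qed.

Lemma ereal_pos_real (x : \bar R) : (0 < x)%E -> (x < +oo)%E ->
  exists y : R, 0 < y /\ x = y%:E.
Proof. by case: x => [y| |] //=; rewrite lte_fin => y0 _; exists y. Qed.

(** If the order is less than rho, the constant in front of [Lam r `^ rho] may be
  any positive number. *)
Lemma coefficient_bound g rho tau : entire g -> 0 < rho -> 0 < tau ->
  (pq_order n.+1 q.+1 g < rho%:E)%E \/
  (pq_order n.+1 q.+1 g = rho%:E /\ (pq_type n.+1 q.+1 g < tau%:E)%E) ->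
  exists t, [/\ 0 < t, t < tau & \forall r \near +oo, forall w, normc w <= r ->
    normc (g w) <= iterexp n.+1 (t * Lam r `^ rho)].
Proof.
move=> eg rho0 tau0 [|[ro]] h.
  have [sg [sg0 sgr hsg]] := ereal_between h rho0.
  have t0 : 0 < tau / 2 by rewrite divr_gt0.
  exists (tau / 2); split=> //; first by lra.
  have hg := entire_order_bound qn eg sg0 hsg.
  near=> r => w wr; have h1 : normc (g w) <= iterexp n.+1 (Lam r `^ sg) by move: w wr; near: r.
  apply: le_trans h1 _; apply: ler_iterexp.
  rewrite mulrC -ler_pdivrMr // mulrC; near: r; exact: powR_absorb.
have [t [t0 tt ht]] := ereal_between h tau0.
exists t; split => //; apply: entire_type_bound => //.
by rewrite ro.
Unshelve. all: by end_near. Qed.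

Lemma common_bound (I : finType) (P : I -> R -> Prop) tau : 0 < tau ->
  (forall i t t', t <= t' -> P i t -> P i t') ->
  (forall i, exists t, t < tau /\ P i t) ->
  exists t, [/\ 0 < t, t < tau & forall i, P i t].
Proof.
move=> tau0 mono h.
suff [t [t0 tt ht]] : exists t, [/\ 0 < t, t < tau & forall i, i \in enum I -> P i t].
  by exists t; split => // i; apply: ht; rewrite mem_enum.
elim: (enum I) => [|i s [t [t0 tt ht]]]; first by exists (tau / 2); split => //; lra.
have [t' [tt' ht']] := h i; exists (Num.max t t'); split.
- by rewrite lt_max t0.
- by rewrite gt_max tt.
move=> j; rewrite inE => /orP[/eqP ->|js]; first by apply: mono ht'; rewrite le_max lexx orbT.
by apply: mono (ht j js); rewrite le_max lexx.
Qed.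

Lemma maximum_modulus_le g r y : 0 < r -> (forall w, normc w <= r -> normc (g w) <= y) ->
  maximum_modulus r g <= y.
Proof.
move=> r0 h; apply: ge_sup.
  exists (normc (g r%:C%C)), r%:C%C => //=.
  by have := normc_real r; rewrite gtr0_norm.
by move=> _ [w /= wr <-]; apply: h; rewrite wr.
Qed.

Lemma type_lower_bound g rho t : entire g -> pq_order n.+1 q.+1 g = rho%:E ->
  (t%:E < pq_type n.+1 q.+1 g)%E -> 0 <= t ->
  ~ (\forall r \near +oo, forall w, normc w <= r -> normc (g w) <= iterexp n.+1 (t * Lam r `^ rho)).
Proof.
move=> eg ro; rewrite /pq_type ro; case: asboolP => // _ h t0 hb.
have hb' : \forall r \near +oo, [/\ 0 < r, 1 <= Lam r & forall w, normc w <= r -> normc (g w) <= iterexp n.+1 (t * Lam r `^ rho)].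
  near=> r; split; [near: r; exact: near_gt|near: r; exact: iterlog_pinfty|].
  by near: r.
have [r [[r0 L1 hr]]] := lt_limsup h hb'; cbv beta.
have L0 : 0 < iterlog q r `^ rho by apply: powR_gt0; apply: lt_le_trans L1.
rewrite ltr_pdivlMr // ltNge => /negP; apply.
apply: iterlog_le; first by rewrite mulr_ge0 // ltW.
exact: maximum_modulus_le.
Unshelve. all: by end_near. Qed.

Lemma order_lower_bound g sigma : entire g -> (sigma%:E < pq_order n.+1 q.+1 g)%E -> 0 < sigma ->
  ~ (\forall r \near +oo, forall w, normc w <= r -> normc (g w) <= iterexp n.+1 (Lam r `^ sigma)).
Proof.
move=> eg; rewrite /pq_order; case: asboolP => [_ h s0|_].
  by move: h; rewrite lte_fin => /(lt_trans s0); rewrite ltxx.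
case: asboolP => // _ h s0 hb.
have hb' : \forall r \near +oo, [/\ 0 < r, 1 <= iterlog q.+1 r,
   iterexp n.+2 (sigma * iterlog q.+1 r) = iterexp n.+1 (Lam r `^ sigma) &
   forall w, normc w <= r -> normc (g w) <= iterexp n.+1 (Lam r `^ sigma)].
  near=> r; split; [near: r; exact: near_gt|near: r; exact: iterlog_pinfty|near: r; exact: iterexp_log|].
  by near: r.
have [r [[r0 L1 E hr]]] := lt_limsup h hb'; cbv beta.
have L0 : 0 < iterlog q.+1 r by apply: lt_le_trans L1.
rewrite ltr_pdivlMr // ltNge => /negP; apply.
apply: iterlog_le; first by rewrite mulr_ge0 // ltW.
by rewrite E; exact: maximum_modulus_le.
Unshelve. all: by end_near. Qed.

End Coefficients.

(** * The difference equation as a homogeneous relation *)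

Section Equation.
Variables (R : realType) (k : nat).
Implicit Types (f F : R[i] -> R[i]) (z : R[i]).

(** The right-hand side is treated as one more term of the equation: index
  [ord0] carries - F with the constant function 1, and [lift ord0 j] carries A j
  with the translate of f by [total_shift c (lift ord0 j)]. *)
Definition extended_coefficient (A : 'I_k.+1 -> R[i] -> R[i]) F (i : 'I_k.+2) : R[i] -> R[i] :=
  if unlift ord0 i is Some j then A j else fun z => - F z.

Definition is_translate (i : 'I_k.+2) : bool := unlift ord0 i.

Definition total_shift (c : 'I_k -> R[i]) (i : 'I_k.+2) : R[i] :=
  if unlift ord0 i is Some j then (if unlift ord0 j is Some j' then c j' else 0) else 0.

Lemma extended_equation A c F f : difference_equation A c F f ->
  forall z, (forall i, is_translate i -> ~ pole f (z + total_shift c i)) ->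
  \sum_i extended_coefficient A F i z *
    (if is_translate i then f (z + total_shift c i) else 1) = 0.
Proof.
move=> eqn z np.
rewrite big_ord_recl /= {1}/extended_coefficient {1}/is_translate unlift_none /= mulr1.
apply/eqP; rewrite addrC subr_eq0; apply/eqP; rewrite -(eqn z).
- rewrite big_ord_recl addrC; congr (_ + _); last first.
    by rewrite /extended_coefficient /is_translate /total_shift liftK unlift_none addr0.
  apply: eq_bigr => j _.
  by rewrite /extended_coefficient /is_translate /total_shift !liftK.
- have := np (lift ord0 ord0); rewrite /is_translate /total_shift liftK unlift_none addr0.
  by move=> h; exact: (h isT).
- move=> j; have := np (lift ord0 (lift ord0 j)); rewrite /is_translate /total_shift !liftK.
  by move=> h; exact: (h isT).
Qed.

Lemma entire_opp F : entire F -> entire (fun z => - F z).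
Proof.
move=> eF z; apply/cdiffP; have /cdiffP h := eF z.
by apply: (eq_cdiff _ (cdiffM (cdiff_cst (-1) z) h)) => w; rewrite mulN1r.
Qed.

Lemma entire_extended A F i : (forall j, entire (A j)) -> entire F ->
  entire (extended_coefficient A F i).
Proof.
move=> eA eF; rewrite /extended_coefficient; case: (unlift ord0 i) => [j|]; first exact: eA.
exact: entire_opp.
Qed.

End Equation.

Theorem theorem20 (R : realType) (p q k : nat)
    (A : 'I_k.+1 -> R[i] -> R[i]) (c : 'I_k -> R[i]) (F : R[i] -> R[i])
    (l : 'I_k.+1) :
  (1 <= q)%N -> (q <= p)%N -> (2 <= k)%N ->
  (forall j, entire (A j)) -> (forall j, not_identically_zero (A j)) ->
  entire F -> not_identically_zero F ->
  injective c -> (forall j, c j != 0) ->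
  (forall j, j != l -> (pq_order p q (A j) <= pq_order p q (A l))%E) ->
  (forall j, j != l -> pq_order p q (A j) = pq_order p q (A l) ->
     (pq_type p q (A j) < pq_type p q (A l))%E) ->
  (0 < pq_order p q (A l))%E -> (pq_order p q (A l) < +oo)%E ->
  (0 < pq_type p q (A l))%E -> (pq_type p q (A l) < +oo)%E ->
  ((pq_order p q F < pq_order p q (A l))%E \/
     (pq_order p q F = pq_order p q (A l) /\
      (pq_type p q F < pq_type p q (A l))%E) ->
   forall f : R[i] -> R[i],
     meromorphic f -> not_identically_zero f -> difference_equation A c F f ->
     (pq_order p q (A l) <= pq_order p q f)%E)
  /\
  ((pq_order p q (A l) < pq_order p q F)%E ->
   forall f : R[i] -> R[i],
     meromorphic f -> not_identically_zero f -> difference_equation A c F f ->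
     (pq_order p q F <= pq_order p q f)%E).
Proof.
move=> q1 qp _ eA _ eF _ _ _ ordA typA o0 o1 t0 t1.
have [rho [rho0 ol]] := ereal_pos_real o0 o1.
have [tau [tau0 tl]] := ereal_pos_real t0 t1.
clear o0 o1 t0 t1.
rewrite ol in ordA; rewrite ol tl in typA; rewrite ol tl.
case: q q1 qp ol tl ordA typA => [|q _]; first by rewrite ltnn.
case: p => [|n] qp; first by rewrite ltn0 in qp.
move: qp; rewrite ltnS => qn ol tl ordA typA.
have eX i : entire (extended_coefficient A F i) := entire_extended eA eF.
split=> hF f mf nf eqn.
  rewrite leNgt; apply/negP => hf.
  have [sg [sg0 sgr hsg]] := ereal_between hf rho0.
  pose L := lift ord0 l.
  have [t [t0 tt ht]] : exists t, [/\ 0 < t, t < tau & forall i : 'I_k.+2, i != L ->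
      \forall r \near +oo, forall w, normc w <= r ->
      normc (extended_coefficient A F i w) <= iterexp n.+1 (t * iterlog q r `^ rho)].
    apply: (@common_bound R _ (fun i t => i != L -> \forall r \near +oo, forall w, normc w <= r ->
      normc (extended_coefficient A F i w) <= iterexp n.+1 (t * iterlog q r `^ rho))) => //.
      move=> i t t' tt' h iL; have {}h := h iL.
      apply: filterS h => r h w /h /le_trans; apply; apply: ler_iterexp.
      by apply: ler_wpM2r => //; exact: powR_ge0.
    move=> i; rewrite /extended_coefficient; case: unliftP => [j ->|->].
      have [->|jl] := eqVneq j l; first by exists 0; split => //; rewrite eqxx.
      have hj : (pq_order n.+1 q.+1 (A j) < rho%:E)%E \/
          (pq_order n.+1 q.+1 (A j) = rho%:E /\ (pq_type n.+1 q.+1 (A j) < tau%:E)%E).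
        have := ordA j jl; rewrite le_eqVlt => /orP[/eqP e|]; last by left.
        by right; split => //; exact: typA.
      have [t [_ tt ht]] := coefficient_bound qn (eA j) rho0 tau0 hj.
      by exists t; split.
    have [t [_ tt ht]] := coefficient_bound qn eF rho0 tau0 hF.
    exists t; split => // _; apply: filterS ht => r h w /h.
    by rewrite normcNE.
  pose t1 := (t + tau) / 2.
  have tt1 : t < t1 by rewrite /t1; lra.
  have t1tau : t1 < tau by rewrite /t1; lra.
  have := growth_transfer qn eX t0 ht mf nf sg0 sgr hsg (extended_equation eqn) tt1.
  rewrite /extended_coefficient /L liftK.
  by apply: (type_lower_bound (eA l) ol); rewrite ?tl ?lte_fin //; lra.
rewrite leNgt; apply/negP => hf.
(* s2 is above the orders of f and of all A j, and s4 is below the order of F *)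
have [s2 [s4 [hsA hsf s24 hs4]]] := ereal_two_between rho0 hF hf.
have s20 : 0 < s2 by lra.
pose s3 := (s2 + s4) / 2.
have s23 : s2 < s3 by rewrite /s3; lra.
have s34 : s3 < s4 by rewrite /s3; lra.
have hX i : i != ord0 -> \forall r \near +oo, forall w, normc w <= r ->
    normc (extended_coefficient A F i w) <= iterexp n.+1 (1 * iterlog q r `^ s3).
  rewrite /extended_coefficient; case: unliftP => [j ->|->]; last by rewrite eqxx.
  move=> _; have oj : (pq_order n.+1 q.+1 (A j) < s2%:E)%E.
    have [->|jl] := eqVneq j l; first by rewrite ol lte_fin.
    by apply: le_lt_trans (ordA j jl) _; rewrite lte_fin.
  have hb := entire_order_bound qn (eA j) s20 oj.
  near=> r => w wr; have h1 : normc (A j w) <= iterexp n.+1 (iterlog q r `^ s2) by move: w wr; near: r.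
  apply: le_trans h1 _; apply: ler_iterexp.
  by rewrite mul1r -[leLHS]mul1r; near: r; exact: powR_absorb.
have ht := growth_transfer qn eX ltr01 hX mf nf s20 s23 hsf (extended_equation eqn).
have {}ht := ht 2 (ltr1n _ 2).
apply: (order_lower_bound (n := n) (q := q) eF hs4); first lra.
near=> r => w wr.
have h1 : normc (extended_coefficient A F ord0 w) <= iterexp n.+1 (2 * iterlog q r `^ s3).
  by move: w wr; near: r.
move: h1; rewrite /extended_coefficient unlift_none normcNE => /le_trans; apply.
by apply: ler_iterexp; near: r; exact: powR_absorb.
Unshelve. all: by end_near. Qed.
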